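(* Let $A$ be a compact abelian Lie group, let $W$ and $W'$ be closed, oriented, connected manifolds of dimension $m+1$ and $n+1$ respectively, and let $[\theta]\in H^{m+n+2}(K_A;U(1))$. Then $$Z_A^{[\theta]}(W\times W')=\int_{\nu\in\mathcal F_W} Z_A^{[\theta]\setminus\nu_*[W]}(W')\,d\mu_W .$$
   Context: $K_A=K(A,1)$ is the Eilenberg--Mac Lane space of $A$ regarded as a discrete group. For a closed oriented manifold $N$, $\mathcal F_N=H^1(N;A)\cong\mathrm{Hom}(H_1(N;\mathbb Z),A)$ is a compact abelian Lie group (topology of pointwise convergence on $\mathrm{Hom}$) with normalized Haar measure $\mu_N$; an element $\nu\in\mathcal F_N$ is identified with the homotopy class of maps $N\to K_A$ it classifies, so it induces $\nu_*$ on homology and $\nu^*$ on cohomology. For $d=\dim N$ and $[\theta]\in H^d(K_A;U(1))$ the Dijkgraaf--Witten invariant is $$Z_A^{[\theta]}(N)=\int_{\nu\in\mathcal F_N}\langle\nu^*([\theta]),[N]\rangle\,d\mu_N,$$ where $[N]$ is the fundamental class and $\langle-,-\rangle$ is the evaluation pairing with values in $U(1)\subset\mathbb C$. It is defined when the integrand is integrable; it is assumed throughout that the integrands in question are integrable. $W\times W'$ is given the product orientation, $[W\times W']=[W]\times[W']$. Since $A$ is abelian, $K_A$ is an $H$-space (multiplication $K_A\times K_A\to K_A$ induced by the group law of $A$), giving the Pontrjagin product $\bullet\colon H_{m+1}(K_A;\mathbb Z)\otimes H_{n+1}(K_A;\mathbb Z)\to H_{m+n+2}(K_A;\mathbb Z)$.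 The Pontrjagin slant product $\setminus\colon H^{m+n+2}(K_A;U(1))\otimes H_{m+1}(K_A;\mathbb Z)\to H^{n+1}(K_A;U(1))$ is characterized by $\langle a\setminus b,c\rangle=\langle a,b\bullet c\rangle$ for all $c\in H_{n+1}(K_A;\mathbb Z)$ (recall $H^{n+1}(K_A;U(1))\cong\mathrm{Hom}(H_{n+1}(K_A;\mathbb Z),U(1))$ because $U(1)$ is divisible). *)

(* Defs.v *)
From HB Require Import structures.
From mathcomp Require Import all_boot all_order all_algebra generic_quotient ring_quotient.
From mathcomp Require Import all_classical all_reals all_analysis.
From mathcomp Require Import complex.
From mathcomp.multinomials Require Import freeg.

Set Implicit Arguments.
Unset Strict Implicit.
Unset Printing Implicit Defensive.

Import Order.TTheory GRing.Theory Num.Theory.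
Import numFieldNormedType.Exports.
Import Quotient.

Local Open Scope classical_set_scope.
Local Open Scope quotient_scope.
Local Open Scope ring_scope.

Section Subquotient.
Variables (V : zmodType) (Z B : zmodClosed V).

Definition subgroup_type : Type := {x : V | x \in Z}.
HB.instance Definition _ := [isSub of subgroup_type for sval].
HB.instance Definition _ := [Choice of subgroup_type by <:].
HB.instance Definition _ := [SubChoice_isSubZmodule of subgroup_type by <:].

Definition in_denominator : {pred subgroup_type} := fun x => val x \in B.

Lemma in_denominator_closed : zmod_closed in_denominator.
Proof.
split=> [|x y]; first by rewrite unfold_in raddf0 rpred0.
by rewrite !unfold_in raddfB; exact: rpredB.
Qed.
HB.instance Definition _ :=
  GRing.isZmodClosed.Build subgroup_type in_denominator in_denominator_closed.

Definition subquotient : Type := {quot in_denominator}.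
HB.instance Definition _ := GRing.Zmodule.on subquotient.

(* The class of [x]. Elements outside [Z] are sent to 0, but below [x] is always
   a (co)cycle: push-forwards and shuffle products of cycles are cycles, and
   pull-backs of cocycles are cocycles. *)
Definition sq_class (x : V) : subquotient :=
  \pi_({quot in_denominator}) (insubd (0 : subgroup_type) x).

Definition sq_repr (c : subquotient) : V :=
  val (repr (c : {quot in_denominator})).

End Subquotient.

Section ContinuousMaps.
Variables X Y Z : topologicalType.

Definition cts_comp (g : continuousType Y Z) (f : continuousType X Y) :
  continuousType X Z := g \o f.

Lemma cts_pair_subproof (f : continuousType X Y) (g : continuousType X Z) :
  continuous (fun x => (f x, g x)).
Proof. by move=> x; apply: (@cvg_pair _ _ _ (nbhs x)); [exact: (@cts_fun _ _ f)|exact: (@cts_fun _ _ g)]. Qed.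

Definition cts_pair (f : continuousType X Y) (g : continuousType X Z) :
  continuousType X (Y * Z)%type := mkcts (@cts_pair_subproof f g).

End ContinuousMaps.

Section Singular.
Variable R : realType.

Definition simplex_set n : set 'rV[R]_n.+1 :=
  [set t | (forall i, 0 <= t ord0 i) /\ \sum_i t ord0 i = 1].

Definition simplex n : topologicalType := set_type (@simplex_set n).

(* The affine map of simplices that sends the vertex [i] to the vertex [v i]. *)
Definition vertex_map m n (v : 'I_m.+1 -> 'I_n.+1) (t : 'rV[R]_m.+1) :
  'rV[R]_n.+1 := \row_j \sum_(i | v i == j) t ord0 i.

Lemma vertex_map_simplex m n (v : 'I_m.+1 -> 'I_n.+1) t :
  @simplex_set m t -> @simplex_set n (vertex_map v t).
Proof.
move=> [t0 t1]; split=> [j|]; first by rewrite mxE sumr_ge0.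
rewrite -t1 (partition_big v xpredT) //=.
by apply: eq_bigr => j _; rewrite mxE.
Qed.

Definition simplex_fun m n (v : 'I_m.+1 -> 'I_n.+1) (t : simplex m) :
  simplex n :=
  exist _ (vertex_map v (val t)) (mem_set (vertex_map_simplex v (set_valP t))).

Lemma simplex_fun_continuous m n (v : 'I_m.+1 -> 'I_n.+1) :
  continuous (simplex_fun v).
Proof.
apply: continuous_comp_initial => t.
have coord j : continuous (fun t : simplex m => vertex_map v (val t) ord0 j).
  rewrite (_ : (fun t => _) = fun t : simplex m =>
      \sum_(i | v i == j) val t ord0 i); last by apply/funext => u; rewrite mxE.
  apply: (continuous_big (op := +%R)); first by move=> x; exact: add_continuous.
  move=> i _ u.
  apply: (@continuous_comp _ _ _ (val : simplex m -> _)
                           (fun M : 'rV[R]_m.+1 => M ord0 i)).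
    exact: initial_continuous.
  exact: coord_continuous.
move=> P [B B_nbhs BP].
have : nbhs t [set u | forall j, B ord0 j (vertex_map v (val u) ord0 j)].
  apply: (@filter_forall _ _
    (fun j u => B ord0 j (vertex_map v (val u) ord0 j)) (nbhs t) (nbhs_filter t)).
  by move=> j; exact: (coord j t _ (B_nbhs ord0 j)).
by apply: filterS => u hu; apply: BP => i j; rewrite ord1; exact: hu.
Qed.

Definition simplex_map m n (v : 'I_m.+1 -> 'I_n.+1) :
  continuousType (simplex m) (simplex n) := mkcts (@simplex_fun_continuous m n v).

Definition singular n (X : topologicalType) : choiceType :=
  continuousType (simplex n) X.

Definition chain n (X : topologicalType) : zmodType := {freeg (singular n X) / int}.

Section OneSpace.
Variable X : topologicalType.

Definition face n (i : 'I_n.+2) (s : singular n.+1 X) : singular n X :=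
  cts_comp s (simplex_map (fintype.lift i)).

Definition boundary n : chain n X -> chain n.-1 X :=
  match n with
  | 0 => fun=> 0
  | k.+1 => fglift (fun s : singular k.+1 X =>
      (\sum_(i < k.+2) (-1) ^+ i *: << face i s >> : {freeg (singular k X) / int}))
  end.

Lemma boundary_is_zmod_morphism n : zmod_morphism (@boundary n).
Proof.
case: n => [|n] x y /=; first by rewrite subr0.
exact: lift_is_additive.
Qed.
HB.instance Definition _ n :=
  GRing.isZmodMorphism.Build (chain n X) (chain n.-1 X) (@boundary n)
    (@boundary_is_zmod_morphism n).

Definition cycle n : {pred chain n X} := fun c => boundary c == 0.

Lemma cycle_closed n : zmod_closed (@cycle n).
Proof.
split=> [|x y]; first by rewrite unfold_in raddf0.
by rewrite !unfold_in raddfB /= => /eqP -> /eqP ->; rewrite subr0.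
Qed.
HB.instance Definition _ n :=
  GRing.isZmodClosed.Build (chain n X) (@cycle n) (@cycle_closed n).

Definition bounding n : {pred chain n X} :=
  fun c => `[< exists w : chain n.+1 X, c = boundary w >].

Lemma bounding_closed n : zmod_closed (@bounding n).
Proof.
split=> [|x y]; first by apply/asboolP; exists 0; rewrite raddf0.
move=> /asboolP[w ->] /asboolP[w' ->]; apply/asboolP.
by exists (w - w'); rewrite raddfB.
Qed.
HB.instance Definition _ n :=
  GRing.isZmodClosed.Build (chain n X) (@bounding n) (@bounding_closed n).

Definition homology n : zmodType := subquotient (@cycle n) (@bounding n).

Variable G : zmodType.

Definition cochain n : zmodType := (singular n X -> G).

Definition evaluate n (phi : cochain n) (c : chain n X) : G :=
  \sum_(s <- dom c) phi s *~ coeff s c.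

Lemma evaluateB n (phi psi : cochain n) c :
  evaluate (phi - psi) c = evaluate phi c - evaluate psi c.
Proof. by rewrite -sumrB; apply: eq_bigr => s _; rewrite -mulrzBl. Qed.

Lemma evaluate0 n c : evaluate (0 : cochain n) c = 0.
Proof. by rewrite /evaluate big1 // => s _; rewrite mul0rz. Qed.

Definition cocycle n : {pred cochain n} :=
  fun phi => `[< forall c : chain n.+1 X, evaluate phi (boundary c) = 0 >].

Lemma cocycle_closed n : zmod_closed (@cocycle n).
Proof.
split=> [|x y]; first by apply/asboolP => c; rewrite evaluate0.
move=> /asboolP hx /asboolP hy; apply/asboolP => c.
by rewrite evaluateB hx hy subr0.
Qed.
HB.instance Definition _ n :=
  GRing.isZmodClosed.Build (cochain n) (@cocycle n) (@cocycle_closed n).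

Definition cobounding n : {pred cochain n} :=
  fun phi => `[< exists psi : cochain n.-1,
    forall c : chain n X, evaluate phi c = evaluate psi (boundary c) >].

Lemma cobounding_closed n : zmod_closed (@cobounding n).
Proof.
split=> [|x y].
  by apply/asboolP; exists 0 => c; rewrite !evaluate0.
move=> /asboolP[p hp] /asboolP[q hq]; apply/asboolP.
by exists (p - q) => c; rewrite !evaluateB hp hq.
Qed.
HB.instance Definition _ n :=
  GRing.isZmodClosed.Build (cochain n) (@cobounding n) (@cobounding_closed n).

Definition cohomology n : zmodType := subquotient (@cocycle n) (@cobounding n).

Definition pairing n (a : cohomology n) (c : homology n) : G :=
  evaluate (sq_repr a) (sq_repr c).

End OneSpace.

Section Functoriality.
Variables (X Y : topologicalType) (f : continuousType X Y).

Definition chain_push n (c : chain n X) : chain n Y :=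
  fglift (fun s : singular n X =>
    (<< (cts_comp f s : singular n Y) >> : {freeg (singular n Y) / int})) c.

Definition push n (c : homology X n) : homology Y n :=
  sq_class _ _ (chain_push (sq_repr c)).

Definition pull (G : zmodType) n (a : cohomology Y G n) : cohomology X G n :=
  sq_class _ _ (fun s : singular n X => sq_repr a (cts_comp f s : singular n Y)).

End Functoriality.

Section Cross.
Variables (X Y : topologicalType) (p q : nat).

(* A set [S] of [p] elements of ['I_(p + q)] is a (p,q)-shuffle: it lists the
   steps in the first direction of a monotone lattice path from (0,0) to (p,q).
   The first coordinate of the k-th vertex of that path is [count_below S k]
   and the second one is [count_below (~: S) k]. *)
Definition count_below r (S : {set 'I_(p + q)}) (k : 'I_(p + q).+1) : 'I_r.+1 :=
  inord #|[set j in S | (j < k)%N]|.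

Definition shuffle_sign (S : {set 'I_(p + q)}) : int :=
  (-1) ^+ #|[set ij : 'I_(p + q) * 'I_(p + q) |
             [&& ij.1 \in S, ij.2 \notin S & (ij.2 < ij.1)%N]]|.

Definition simplex_cross (s : singular p X) (t : singular q Y) :
    {freeg (singular (p + q) (X * Y)%type) / int} :=
  \sum_(S : {set 'I_(p + q)} | #|S| == p)
    shuffle_sign S *:
    << (cts_pair (cts_comp s (simplex_map (@count_below p S)))
                 (cts_comp t (simplex_map (@count_below q (~: S))))
        : singular (p + q) (X * Y)%type) >>.

Definition chain_cross (c : chain p X) (d : chain q Y) :
    chain (p + q) (X * Y)%type :=
  fglift (fun s : singular p X =>
    fglift (fun t : singular q Y => simplex_cross s t) d) c.

Definition cross (b : homology X p) (c : homology Y q) :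
    homology (X * Y)%type (p + q) :=
  sq_class _ _ (chain_cross (sq_repr b) (sq_repr c)).

End Cross.
End Singular.

Section Manifolds.
Variable R : realType.

Record chart d (X : topologicalType) := Chart {
  chart_dom : set X;
  chart_img : set 'rV[R]_d;
  chart_fun : X -> 'rV[R]_d;
  chart_inv : 'rV[R]_d -> X;
  chart_dom_open : open chart_dom;
  chart_img_open : open chart_img;
  chart_funP : forall x, chart_dom x ->
    chart_img (chart_fun x) /\ chart_inv (chart_fun x) = x;
  chart_invP : forall y, chart_img y ->
    chart_dom (chart_inv y) /\ chart_fun (chart_inv y) = y;
  chart_fun_continuous : forall x, chart_dom x -> {for x, continuous chart_fun};
  chart_inv_continuous : forall y, chart_img y -> {for y, continuous chart_inv}
}.

Record closed_manifold d (X : topologicalType) : Prop := {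
  manifold_hausdorff : hausdorff_space X;
  manifold_second_countable : @second_countable X;
  manifold_locally_euclidean :
    forall x : X, exists c : chart d X, chart_dom c x;
  manifold_compact : compact [set: X]
}.

Variable X : topologicalType.

(* Relative homology H_n(X, S): chains modulo the chains supported in [S]. *)
Definition supported n (S : set X) (c : chain R n X) : Prop :=
  forall s, s \in dom c -> forall t, S (s t).

Definition rel_cycle n (S : set X) (c : chain R n X) : Prop :=
  supported S (boundary c).

Definition rel_homologous n (S : set X) (c c' : chain R n X) : Prop :=
  exists (w : chain R n.+1 X) (u : chain R n X),
    supported S u /\ c - c' = boundary w + u.

Definition local_generator n (x : X) (c : chain R n X) : Prop :=
  rel_cycle (~` [set x]) c /\
  forall c', rel_cycle (~` [set x]) c' ->
    exists k : int, rel_homologous (~` [set x]) c' (c *~ k).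

Record orientation n := Orientation {
  local_class : X -> chain R n X;
  local_class_generator : forall x, local_generator x (local_class x);
  local_class_consistent : forall x, exists U, open_nbhs x U /\
    exists2 z : chain R n X, rel_cycle (~` U) z &
      forall y, U y -> rel_homologous (~` [set y]) z (local_class y)
}.

Definition fundamental_class n (o : orientation n) (c : homology R X n) : Prop :=
  forall x, rel_homologous (~` [set x]) (sq_repr c) (local_class o x).

End Manifolds.

Section Lie.
Variable R : realType.

(* For an open set [U] this says that [f] is C^k on [U]; the values of [f]
   outside of [U] do not matter. *)
Fixpoint Ck_on (V W : normedModType R) (k : nat) (U : set V) (f : V -> W) :
    Prop :=
  (forall x, U x -> {for x, continuous f}) /\
  match k with
  | 0 => True
  | j.+1 => forall v : V,
      (forall x, U x -> derivable f x v) /\ Ck_on j U ('D_v f)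
  end.

Definition smooth_on (V W : normedModType R) (U : set V) (f : V -> W) : Prop :=
  forall k, Ck_on k U f.

Record lie_group_atlas (A : topologicalZmodType) d (atlas : set (chart R d A)) :
    Prop := {
  atlas_cover : forall a : A, exists2 c, atlas c & chart_dom c a;
  atlas_compatible : forall c c', atlas c -> atlas c' ->
    smooth_on [set u | chart_img c u /\ chart_dom c' (chart_inv c u)]
              (fun u => chart_fun c' (chart_inv c u));
  atlas_opp_smooth : forall c c', atlas c -> atlas c' ->
    smooth_on [set u | chart_img c u /\ chart_dom c' (- chart_inv c u)]
              (fun u => chart_fun c' (- chart_inv c u));
  atlas_add_smooth : forall c1 c2 c, atlas c1 -> atlas c2 -> atlas c ->
    smooth_on [set u : 'rV[R]_d * 'rV[R]_d |
                 [/\ chart_img c1 u.1, chart_img c2 u.2 &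
                  chart_dom c (chart_inv c1 u.1 + chart_inv c2 u.2)]]
              (fun u => chart_fun c (chart_inv c1 u.1 + chart_inv c2 u.2))
}.

Record compact_abelian_lie_group (A : topologicalZmodType) : Prop := {
  lie_group_hausdorff : hausdorff_space A;
  lie_group_second_countable : @second_countable A;
  lie_group_smooth :
    exists d (atlas : set (chart R d A)), lie_group_atlas atlas;
  lie_group_compact : compact [set: A]
}.

End Lie.

Section EilenbergMacLane.
Variable R : realType.

Definition unit_interval : topologicalType :=
  set_type [set s : R | 0 <= s <= 1].

Definition homotopic_rel (X Y : topologicalType) (B : set X)
    (f g : continuousType X Y) : Prop :=
  exists H : continuousType (X * unit_interval)%type Y,
    forall x s, [/\ val s = 0 -> H (x, s) = f x,
                    val s = 1 -> H (x, s) = g x &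
                    B x -> H (x, s) = f x].

Definition path_connected (X : topologicalType) : Prop :=
  forall x y : X, exists p : continuousType unit_interval X,
    forall s, (val s = 0 -> p s = x) /\ (val s = 1 -> p s = y).

Definition simplex_boundary n : set (simplex R n) :=
  [set t : simplex R n | exists i, val t ord0 i = 0].

(* Elements of pi_n(X,x) are represented by maps of pairs
   (Delta^n, boundary) -> (X, x) up to homotopy relative to the boundary. *)
Definition spheroid n (X : topologicalType) (x : X) (f : singular R n X) : Prop :=
  forall t, simplex_boundary t -> f t = x.

Definition spheroid_homotopic n (X : topologicalType) (f g : singular R n X) :
  Prop := homotopic_rel (@simplex_boundary n) f g.

Definition hurewicz1 (X : topologicalType) (f : singular R 1 X) :
    homology R X 1 :=
  sq_class _ _ (<< f >> : {freeg (singular R 1 X) / int}).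

(* The identification of pi_1 with [A] is given by the fundamental class
   [em_class] in H^1(K; A): the map [f] |-> <em_class, [f]> is a homomorphism
   pi_1(K) -> H_1(K; Z) -> A, which is required to be bijective.
   Only the homotopy groups of [em_space] are prescribed, so every model of
   K(A,1) with a multiplication inducing the addition of [A] is allowed. *)
Record EM_space (A : zmodType) := EMSpace {
  em_space :> topologicalType;
  em_pt : em_space;
  em_class : cohomology R em_space A 1;
  em_mul : continuousType (em_space * em_space)%type em_space;
  em_path_connected : path_connected em_space;
  em_pi1_injective : forall f g : singular R 1 em_space,
    spheroid em_pt f -> spheroid em_pt g ->
    pairing em_class (hurewicz1 f) = pairing em_class (hurewicz1 g) ->
    spheroid_homotopic f g;
  em_pi1_surjective : forall a : A, exists2 f : singular R 1 em_space,
    spheroid em_pt f & pairing em_class (hurewicz1 f) = a;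
  em_pi_trivial : forall n (f : singular R n em_space), (1 < n)%N ->
    spheroid em_pt f -> spheroid_homotopic f (cst em_pt);
  em_mul_unitl : homotopic_rel set0
    (cts_comp em_mul (cts_pair (cst em_pt) idfun)) idfun;
  em_mul_unitr : homotopic_rel set0
    (cts_comp em_mul (cts_pair idfun (cst em_pt))) idfun;
  em_mul_pt : em_mul (em_pt, em_pt) = em_pt;
  em_mul_pi1 : forall f g : singular R 1 em_space,
    spheroid em_pt f -> spheroid em_pt g ->
    pairing em_class (hurewicz1 (cts_comp em_mul (cts_pair f g))) =
    pairing em_class (hurewicz1 f) + pairing em_class (hurewicz1 g)
}.

Variables (A : zmodType) (K : EM_space A).

Definition pontrjagin p q (b : homology R K p) (c : homology R K q) :
    homology R K (p + q) :=
  push (em_mul K) (cross b c).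

(* For divisible [G] such as U(1) there is exactly one class with this property,
   since then H^q(K; G) = Hom(H_q(K; Z), G). *)
Definition slant (G : zmodType) p q (a : cohomology R K G (p + q))
    (b : homology R K p) : cohomology R K G q :=
  xget 0 [set s | forall c, pairing s c = pairing a (pontrjagin b c)].

(* A continuous map that represents the homotopy class of maps classified by
   [nu]. *)
Definition classifying_map (N : topologicalType) (nu : cohomology R N A 1) :
    continuousType N K :=
  xget (cst (em_pt K) : continuousType N K)
    [set f : continuousType N K | pull f (em_class K) = nu].

End EilenbergMacLane.

Section Circle.
Variable R : realType.

Definition circle : Type := {z : R[i] | `|z| == 1}.
HB.instance Definition _ := [isSub of circle for sval].
HB.instance Definition _ := [Choice of circle by <:].

Lemma circle_one_subproof : `|1 : R[i]| == 1.
Proof. by rewrite normr1. Qed.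

Lemma circle_mul_subproof (x y : circle) : `|val x * val y| == 1.
Proof. by rewrite normrM (eqP (valP x)) (eqP (valP y)) mulr1. Qed.

Lemma circle_inv_subproof (x : circle) : `|(val x)^-1| == 1.
Proof. by rewrite normfV (eqP (valP x)) invr1. Qed.

Definition circle_one : circle := exist _ 1 circle_one_subproof.
Definition circle_mul (x y : circle) : circle :=
  exist _ (val x * val y) (circle_mul_subproof x y).
Definition circle_inv (x : circle) : circle :=
  exist _ (val x)^-1 (circle_inv_subproof x).

Lemma circle_mulA : associative circle_mul.
Proof. by move=> x y z; apply/val_inj; rewrite /= mulrA. Qed.
Lemma circle_mulC : commutative circle_mul.
Proof. by move=> x y; apply/val_inj; rewrite /= mulrC. Qed.
Lemma circle_mul1 : left_id circle_one circle_mul.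
Proof. by move=> x; apply/val_inj; rewrite /= mul1r. Qed.
Lemma circle_mulV : left_inverse circle_one circle_inv circle_mul.
Proof.
move=> x; apply/val_inj; rewrite /= mulVf //.
by rewrite -normr_eq0 (eqP (valP x)) oner_eq0.
Qed.

(* As a coefficient group U(1) is written additively. *)
HB.instance Definition _ :=
  GRing.isZmodule.Build circle circle_mulA circle_mulC circle_mul1 circle_mulV.

End Circle.

Section Fields.
Variables (R : realType) (A : topologicalZmodType) (N : topologicalType).

Definition period (nu : cohomology R N A 1) : {ptws homology R N 1 -> A} :=
  fun c => pairing nu c.

(* H^1(N; A) with the topology of pointwise convergence on Hom(H_1(N; Z), A). *)
Definition fields : Type := cohomology R N A 1.
HB.instance Definition _ := Topological.copy fields (initial_topology period).
HB.instance Definition _ := GRing.Zmodule.copy fields (cohomology R N A 1).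
HB.instance Definition _ := isPointed.Build fields 0.

Definition borel_fields := g_sigma_algebraType (@open fields).

Record haar_measure := HaarMeasure {
  haar :> probability borel_fields R;
  haar_invariant : forall (nu : fields) (B : set fields),
    measurable (B : set borel_fields) ->
    haar [set nu + x | x in B] = haar B
}.

End Fields.

Section ComplexIntegral.
Context d (T : measurableType d) (R : realType).
Variable mu : {measure set T -> \bar R}.

Definition Cintegrable (f : T -> R[i]) : Prop :=
  mu.-integrable setT (fun x => (complex.Re (f x))%:E) /\
  mu.-integrable setT (fun x => (complex.Im (f x))%:E).

Definition Cintegral (f : T -> R[i]) : R[i] :=
  Complex (\int[mu]_x complex.Re (f x)) (\int[mu]_x complex.Im (f x)).

End ComplexIntegral.

Section DijkgraafWitten.
Variables (R : realType) (A : topologicalZmodType) (K : EM_space R A).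
Variables (N : topologicalType) (d : nat).
Variables (theta : cohomology R K (circle R) d) (cN : homology R N d).

Definition dw_integrand (nu : fields R A N) : R[i] :=
  val (pairing (pull (classifying_map K nu) theta) cN).

Definition dw_invariant (mu : haar_measure R A N) : R[i] :=
  Cintegral mu dw_integrand.

End DijkgraafWitten.

(* Main.v *)
(** Let [p], [q] be the projections of [W * W']. By the Kuenneth formula in degree
   one, [(x, y) |-> p^* x + q^* y] is surjective from [F_W * F_W'] to
   [F_(W * W')]; it carries the product of the Haar measures to the Haar measure,
   since invariance allows one to evaluate the double integral of
   [1_B (z + p^* x + q^* y)] in both orders. A map classified by [p^* x + q^* y]
   is the product of maps classified by [x] and [y], followed by the
   multiplication of [K]; hence the integrand of [W * W'] there is
   [<theta, x_*[W] . y_*[W']>], the integrand of [W'] for the slant product of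
   [theta] with [x_*[W]], and the formula is Fubini's theorem.

   As [K] is only known through its homotopy groups, these maps are controlled by
   filling spheres: every map to [K] is chain homotopic to one that factors
   through the nerve of [A] and depends on a cocycle only, and a partition of
   unity turns a cocycle on a manifold into a map. The sums are measurable because
   degree one classes of a closed manifold are tested on countably many cycles. *)

Require Import Defs.
From HB Require Import structures.
From mathcomp Require Import all_boot all_order all_algebra generic_quotient ring_quotient.
From mathcomp Require Import all_classical all_reals all_analysis measurable_realfun.
From mathcomp Require Import complex ring lra zify.
From mathcomp.multinomials Require Import freeg.

Set Implicit Arguments.
Unset Strict Implicit.
Unset Printing Implicit Defensive.

Import Order.TTheory GRing.Theory Num.Theory.
Import numFieldNormedType.Exports.
Import Quotient.

Local Open Scope classical_set_scope.
Local Open Scope quotient_scope.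
Local Open Scope ring_scope.

(** [K] need not be a cell complex and the manifolds come without triangulations, so the usual
    description of maps to [K] up to homotopy is out of reach, and [classifying_map] is a bare
    choice. The integrand asks for less: a map with the given degree one class must exist, since
    otherwise the choice falls back to a constant map, and this class must determine the effect of
    the map on cohomology in every degree. No charts are constructed on [W * W']; its classifying
    maps come from the multiplication of [K], and its degree one classes from those of the factors.

    On the analytic side the difficulty is that [fields] has the topology of pointwise convergence
    on all of H_1, which is not shown to be finitely generated, whereas Fubini only sees the product
    of two Borel sigma-algebras. An open set of an uncountable product need not be a countable union
    of cylinders, and sums of Borel functions need not be Borel. Both obstacles disappear once a
    countable family of classes decides all values. *)

Local Notation lift := fintype.lift.
Local Notation gen s := (<< s >> : {freeg (singular _ _ _) / int}).
Implicit Types (X Y : topologicalType) (G : zmodType).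

(** * Chains and pairings *)

Section SubquotientTheory.
Variables (V : zmodType) (Z B : zmodClosed V).

Lemma sq_repr_in (c : subquotient Z B) : sq_repr c \in Z.
Proof. exact: valP. Qed.

Lemma sq_reprK (c : subquotient Z B) : sq_class Z B (sq_repr c) = c.
Proof. by rewrite /sq_class /sq_repr valKd reprK. Qed.

Lemma sq_class_eq (x y : V) : x \in Z -> y \in Z -> x - y \in B ->
  sq_class Z B x = sq_class Z B y.
Proof.
move=> xZ yZ xyB; apply/eqP; rewrite -idealrBE unfold_in raddfB /=.
by rewrite !insubdK.
Qed.

Lemma sq_repr_class (x : V) : x \in Z -> sq_repr (sq_class Z B x) - x \in B.
Proof.
move=> xZ.
have : \pi_({quot @in_denominator V Z B}) (repr (sq_class Z B x)) ==
       \pi_({quot @in_denominator V Z B}) (insubd 0 x) by rewrite reprK.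
by rewrite -idealrBE unfold_in raddfB /= insubdK.
Qed.

Lemma sq_classB (x y : V) : x \in Z -> y \in Z ->
  sq_class Z B (x - y) = sq_class Z B x - sq_class Z B y.
Proof.
move=> xZ yZ; rewrite /sq_class -raddfB; congr (\pi _).
by apply: val_inj; rewrite raddfB /= !insubdK ?rpredB.
Qed.

End SubquotientTheory.

Section Evaluation.
Variable R : realType.
Variables (X : topologicalType) (n : nat).
Local Notation chainX := (chain R n X).

Lemma scale_intz (M : lmodType int) (k : int) (v : M) : k *: v = v *~ k.
Proof. by rewrite -[k in LHS]intz scaler_int. Qed.

(** The domain of a difference depends on cancellations, so additivity is checked over one list that
    contains all the domains involved; coefficients outside a domain vanish. *)
Lemma evaluateE G (phi : cochain R X G n) (D : seq (singular R n X)) (c : chainX) :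
  uniq D -> {subset dom c <= D} ->
  evaluate phi c = \sum_(s <- D) phi s *~ coeff s c.
Proof.
move=> uD sD; rewrite /evaluate.
rewrite [RHS](bigID (fun s => s \in dom c)) /= [X in _ + X]big1 ?addr0; last first.
  by move=> s; rewrite mem_dom negbK => /eqP ->.
rewrite -[RHS]big_filter; apply: perm_big; apply: uniq_perm.
- exact: uniq_dom.
- exact: filter_uniq.
by move=> s; rewrite mem_filter; case: (boolP (s \in dom c)) => //= /sD ->.
Qed.

Lemma evaluate_is_additive G (phi : cochain R X G n) :
  zmod_morphism (evaluate phi : chainX -> G).
Proof.
move=> c d; pose D := undup (dom c ++ dom d).
have uD : uniq D by exact: undup_uniq.
have sD (e : chainX) : {subset dom e <= dom c ++ dom d} -> {subset dom e <= D}.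
  by move=> se s /se; rewrite mem_undup.
rewrite (@evaluateE _ phi D (c - d)) ?(@evaluateE _ phi D c) ?(@evaluateE _ phi D d)//;
  try (apply: sD => s; first [exact: domB | by rewrite mem_cat => ->; rewrite ?orbT]).
by rewrite -sumrB; apply: eq_bigr => s _; rewrite coeffB mulrzBr.
Qed.
HB.instance Definition _ (G : zmodType) (phi : cochain R X G n) :=
  GRing.isZmodMorphism.Build chainX G (evaluate phi) (evaluate_is_additive phi).

Lemma evaluate_chainB G (phi : cochain R X G n) (c d : chainX) :
  evaluate phi (c - d) = evaluate phi c - evaluate phi d.
Proof. exact: evaluate_is_additive. Qed.

Lemma evaluateU G (phi : cochain R X G n) (s : singular R n X) :
  evaluate phi (gen s) = phi s.
Proof. by rewrite /evaluate domU1 big_seq1 coeffU mul1r eqxx. Qed.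

Lemma chainE (c : chainX) :
  c = \sum_(s <- dom c) (gen s) *~ coeff s c.
Proof.
rewrite -{1}[c]freeg_sumE; apply: eq_bigr => s _.
by rewrite freegU_mulz intz.
Qed.

(** Differences suffice: from [0] they yield opposites and sums, hence integral multiples. *)
Lemma chain_ind (P : chainX -> Prop) : P 0 ->
  (forall s, P (gen s)) ->
  (forall c d, P c -> P d -> P (c - d)) -> forall c, P c.
Proof.
move=> P0 PU PB c; have PN d : P d -> P (- d) by rewrite -sub0r => ?; exact: PB.
have PD d e : P d -> P e -> P (d + e).
  by move=> ? ?; rewrite -[e]opprK; apply: PB => //; exact: PN.
rewrite (chainE c); elim/big_ind: _ => // s _.
have PM k : P ((gen s) *+ k).
  by elim: k => [|k IH]; rewrite ?mulr0n// mulrS; exact: PD.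
by case: (coeff s c) => k; [exact: PM | rewrite NegzE mulrNz; apply: PN; exact: PM].
Qed.

Lemma additive_evaluate G (h : {additive chainX -> G}) (c : chainX) :
  h c = evaluate (fun s => h (gen s)) c.
Proof.
rewrite {1}(chainE c) raddf_sum; apply: eq_bigr => s _.
by rewrite raddfMz.
Qed.

Lemma evaluate_comp (G H : zmodType) (h : {additive G -> H}) (phi : cochain R X G n)
  (c : chainX) : h (evaluate phi c) = evaluate (h \o phi) c.
Proof. by rewrite raddf_sum; apply: eq_bigr => s _; rewrite raddfMz. Qed.

Lemma eq_evaluate G (phi psi : cochain R X G n) (c : chainX) :
  phi =1 psi -> evaluate phi c = evaluate psi c.
Proof. by move=> e; apply: eq_bigr => s _; rewrite e. Qed.

Lemma evaluateD G (phi psi : cochain R X G n) (c : chainX) :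
  evaluate (fun s => phi s + psi s) c = evaluate phi c + evaluate psi c.
Proof. by rewrite -big_split; apply: eq_bigr => s _; rewrite /= mulrzDl. Qed.

Lemma evaluateN G (phi : cochain R X G n) (c : chainX) :
  evaluate (fun s => - phi s) c = - evaluate phi c.
Proof. by rewrite -sumrN; apply: eq_bigr => s _; rewrite mulNrz. Qed.

Lemma fglift_evaluate (K : choiceType) (f : singular R n X -> {freeg K / int}) (c : chainX) :
  fglift f c = @evaluate R X {freeg K / int} n f c.
Proof.
pose h := HB.pack_for {additive chainX -> {freeg K / int}} (fglift f)
   (GRing.isZmodMorphism.Build chainX {freeg K / int} (fglift f) (lift_is_additive _)).
rewrite -[LHS]/(h c) (additive_evaluate h); apply: eq_evaluate => s /=.
by rewrite liftU scale1r.
Qed.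

End Evaluation.

Section ChainMaps.
Variable R : realType.

Lemma boundaryU X n (s : singular R n.+1 X) :
  boundary (gen s) =
  \sum_(i < n.+2) (gen (face i s)) *~ ((-1) ^+ i).
Proof.
rewrite /= liftU scale1r; apply: eq_bigr => i _.
by rewrite scale_intz.
Qed.

Lemma cts_eq X Y (f g : continuousType X Y) : f =1 g -> f = g.
Proof. by move=> fg; apply/continuousEP. Qed.

Lemma chain_push_is_additive X Y (f : continuousType X Y) n :
  zmod_morphism (@chain_push R X Y f n).
Proof. by move=> c d; rewrite /chain_push lift_is_additive. Qed.
HB.instance Definition _ (X Y : topologicalType) (f : continuousType X Y) n :=
  GRing.isZmodMorphism.Build _ _ (@chain_push R X Y f n) (chain_push_is_additive f (n := n)).

Lemma chain_pushU X Y (f : continuousType X Y) n (s : singular R n X) :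
  chain_push f (gen s) =
  (gen (cts_comp f s : singular R n Y)).
Proof. by rewrite /chain_push liftU scale1r. Qed.

Lemma eq_additive_chain X n G
  (h k : {additive chain R n X -> G}) :
  (forall s, h (gen s) = k << s >>) -> h =1 k.
Proof.
move=> e c; rewrite (additive_evaluate h) (additive_evaluate k).
exact: eq_evaluate.
Qed.

Lemma boundary_push X Y (f : continuousType X Y) n
  (c : chain R n.+1 X) :
  boundary (chain_push f c) = chain_push f (boundary c).
Proof.
move: c; apply: (@eq_additive_chain X n.+1 _
   ((@boundary R Y n.+1) \o (@chain_push R X Y f n.+1))
   ((@chain_push R X Y f n) \o (@boundary R X n.+1))) => s.
rewrite -[LHS]/(boundary (chain_push f << s >>)) chain_pushU boundaryU.
rewrite -[RHS]/(chain_push f (boundary << s >>)) boundaryU raddf_sum.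
apply: eq_bigr => i _; rewrite raddfMz /= chain_pushU.
by congr (<< _ >> *~ _); apply: cts_eq.
Qed.

Lemma evaluate_push X Y (f : continuousType X Y) n G
  (phi : cochain R Y G n) (c : chain R n X) :
  evaluate phi (chain_push f c) = evaluate (fun s => phi (cts_comp f s)) c.
Proof.
apply: etrans (additive_evaluate ((evaluate phi : {additive chain R n Y -> G}) \o (@chain_push R X Y f n)) c) _.
by apply: eq_evaluate => s; rewrite /= chain_pushU evaluateU.
Qed.

Lemma evaluate_boundary X n G
  (phi : cochain R X G n) (c : chain R n.+1 X) :
  evaluate phi (boundary c) =
  evaluate (fun s : singular R n.+1 X =>
     \sum_(i < n.+2) phi (face i s) *~ ((-1) ^+ i)) c.
Proof.
apply: etrans (additive_evaluate ((evaluate phi : {additive chain R n X -> G}) \o (@boundary R X n.+1)) c) _.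
apply: eq_evaluate => s; rewrite -[LHS]/(evaluate phi (boundary << s >>)) boundaryU raddf_sum.
by apply: eq_bigr => i _; rewrite raddfMz /= evaluateU.
Qed.

Lemma cocycleP X n G (phi : cochain R X G n) :
  reflect (forall s : singular R n.+1 X,
     \sum_(i < n.+2) phi (face i s) *~ ((-1) ^+ i) = 0)
    (phi \in @cocycle R X G n).
Proof.
apply: (iffP (asboolP _)) => h c.
  by have := h (gen c); rewrite evaluate_boundary evaluateU.
by rewrite evaluate_boundary (eq_evaluate _ h) evaluate0.
Qed.

Lemma cocycle_boundary X n G (phi : cochain R X G n)
  (c : chain R n.+1 X) : phi \in @cocycle R X G n -> evaluate phi (boundary c) = 0.
Proof. by move=> /asboolP. Qed.

Lemma cobounding_cycle X n G (phi : cochain R X G n)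
  (c : chain R n X) : phi \in @cobounding R X G n -> c \in @Defs.cycle R X n ->
  evaluate phi c = 0.
Proof. by move=> /asboolP[psi h] /eqP cz; rewrite h cz raddf0. Qed.

Lemma cocycle_bounding X n G (phi : cochain R X G n)
  (c : chain R n X) : phi \in @cocycle R X G n -> c \in @bounding R X n ->
  evaluate phi c = 0.
Proof. by move=> hphi /asboolP[w ->]; exact: cocycle_boundary. Qed.

(** [pairing] uses arbitrarily chosen representatives. Changing the cycle by a boundary, or the
    cocycle by a coboundary, contributes zero, so any representatives compute it. *)
Lemma pairing_class X n G (phi : cochain R X G n)
  (c : chain R n X) : phi \in @cocycle R X G n -> c \in @Defs.cycle R X n ->
  pairing (sq_class (@cocycle R X G n) (@cobounding R X G n) phi)
          (sq_class (@Defs.cycle R X n) (@bounding R X n) c) = evaluate phi c.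
Proof.
move=> hphi hc; rewrite /pairing.
set p := sq_repr _; set z := sq_repr _.
have pz : p \in @cocycle R X G n by exact: sq_repr_in.
have zz : z \in @Defs.cycle R X n by exact: sq_repr_in.
apply: (@etrans _ _ (evaluate p c)); apply/eqP; rewrite -subr_eq0.
  by rewrite -evaluate_chainB (cocycle_bounding pz)// sq_repr_class.
by rewrite -evaluateB (@cobounding_cycle _ _ _ (p - phi))// sq_repr_class.
Qed.

Lemma pairing_classl X n G (phi : cochain R X G n)
  (c : homology R X n) : phi \in @cocycle R X G n ->
  pairing (sq_class (@cocycle R X G n) (@cobounding R X G n) phi) c = evaluate phi (sq_repr c).
Proof. by move=> hphi; rewrite -{1}(sq_reprK c) pairing_class// sq_repr_in. Qed.

Lemma pairing_classr X n G (a : cohomology R X G n)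
  (c : chain R n X) : c \in @Defs.cycle R X n ->
  pairing a (sq_class (@Defs.cycle R X n) (@bounding R X n) c) = evaluate (sq_repr a) c.
Proof. by move=> hc; rewrite -{1}(sq_reprK a) pairing_class// sq_repr_in. Qed.

Lemma pairingBl X n G (c : homology R X n) :
  {morph (fun a : cohomology R X G n => pairing a c) : a b / a - b}.
Proof.
move=> a b; rewrite /= -{1}[a]sq_reprK -{1}[b]sq_reprK -sq_classB ?sq_repr_in//.
by rewrite pairing_classl ?rpredB ?sq_repr_in// evaluateB.
Qed.

Lemma pairingDl X n G (c : homology R X n) :
  {morph (fun a : cohomology R X G n => pairing a c) : a b / a + b}.
Proof.
by move=> a b; have := pairingBl c (a + b) b; rewrite /= addrK => ->; rewrite subrK.
Qed.

Lemma push_cycle X Y (f : continuousType X Y) n (c : chain R n X) :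
  c \in @Defs.cycle R X n -> chain_push f c \in @Defs.cycle R Y n.
Proof.
case: n c => [|n] c; first by move=> _; exact: (introT eqP erefl).
by rewrite !unfold_in boundary_push => /eqP ->; rewrite raddf0.
Qed.

Lemma face_comp X Y (f : continuousType X Y) n (i : 'I_n.+2)
  (s : singular R n.+1 X) : face i (cts_comp f s) = cts_comp f (face i s).
Proof. exact: cts_eq. Qed.

Lemma pull_cocycle X Y (f : continuousType X Y) n G
  (phi : cochain R Y G n) : phi \in @cocycle R Y G n ->
  (fun s => phi (cts_comp f s)) \in @cocycle R X G n.
Proof.
move=> /cocycleP h; apply/cocycleP => s; rewrite -[RHS](h (cts_comp f s)).
by apply: eq_bigr => i _; rewrite face_comp.
Qed.

Lemma pairing_pull X Y (f : continuousType X Y) n G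
  (a : cohomology R Y G n) (c : homology R X n) :
  pairing (pull f a) c = pairing a (push f c).
Proof.
rewrite /pull /push pairing_classl ?pairing_classr ?evaluate_push//.
  by apply: push_cycle; exact: sq_repr_in.
by apply: pull_cocycle; exact: sq_repr_in.
Qed.

Lemma boundary_push_all X Y (f : continuousType X Y) n (c : chain R n X) :
  boundary (chain_push f c) = chain_push f (boundary c).
Proof. by case: n c => [|n] c; [rewrite /= raddf0 | exact: boundary_push]. Qed.

Lemma pull_cobounding X Y (f : continuousType X Y) n G
  (phi : cochain R Y G n) : phi \in @cobounding R Y G n ->
  (fun s => phi (cts_comp f s)) \in @cobounding R X G n.
Proof.
move=> /asboolP[psi h]; apply/asboolP; exists (fun s => psi (cts_comp f s)) => c.
by rewrite -!evaluate_push h boundary_push_all.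
Qed.

Lemma pull_class X Y (f : continuousType X Y) n G
  (phi : cochain R Y G n) : phi \in @cocycle R Y G n ->
  pull f (sq_class (@cocycle R Y G n) (@cobounding R Y G n) phi) =
  sq_class (@cocycle R X G n) (@cobounding R X G n) (fun s => phi (cts_comp f s)).
Proof.
move=> hphi; rewrite /pull; set r := sq_repr _.
have hr : r \in @cocycle R Y G n by exact: sq_repr_in.
apply: sq_class_eq; [exact: pull_cocycle|exact: pull_cocycle|].
by apply: (@pull_cobounding _ _ f n G (r - phi)); exact: sq_repr_class.
Qed.

Lemma pull_comp (X Y Z : topologicalType) (f : continuousType X Y) (g : continuousType Y Z)
  n G (a : cohomology R Z G n) : pull (cts_comp g f) a = pull f (pull g a).
Proof.
rewrite -(sq_reprK a).
have ha : sq_repr a \in @cocycle R Z G n by exact: sq_repr_in.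
rewrite !pull_class//; last exact: pull_cocycle.
by congr sq_class; apply/funext => s; congr (sq_repr _ _); exact: cts_eq.
Qed.

Lemma pullB X Y (f : continuousType X Y) n G :
  zmod_morphism (@pull R X Y f G n).
Proof.
move=> a b; rewrite -{1}[a]sq_reprK -{1}[b]sq_reprK -sq_classB ?sq_repr_in//.
rewrite pull_class ?rpredB ?sq_repr_in// /pull -sq_classB//;
  by apply: pull_cocycle; exact: sq_repr_in.
Qed.
HB.instance Definition _ (X Y : topologicalType) (f : continuousType X Y) n (G : zmodType) :=
  GRing.isZmodMorphism.Build _ _ (@pull R X Y f G n) (pullB f (n := n) (G := G)).

End ChainMaps.

(** * Shuffles and the cross product *)

Section LatticePaths.
Local Open Scope nat_scope.

(** [bump c] is the coface that skips the value [c]: it turns a path in the grid of a face of one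
    factor into a path in the grid of the whole simplex. *)
Definition bump_x (c : nat) (v : nat * nat) : nat * nat := (bump c v.1, v.2).
Definition bump_y (c : nat) (v : nat * nat) : nat * nat := (v.1, bump c v.2).

Arguments bump_x : simpl never.
Arguments bump_y : simpl never.

(* The signed sum of [f] over all monotone lattice paths with [r] steps, [p] of
   them horizontal, that start at [(a, b)]; a path is the list of its vertices. *)
Fixpoint path_sum G (r p a b : nat) (f : seq (nat * nat) -> G) : G :=
  match r with
  | 0 => if p is 0 then f [:: (a, b)] else 0%R
  | r'.+1 =>
    ((if p is p'.+1 then path_sum r' p' a.+1 b (fun l => f ((a, b) :: l)) else 0)
     + path_sum r' p a b.+1 (fun l => f ((a, b) :: l)) *~ (-1) ^+ p)%R
  end.

(** The alternating sum over the deletions of one vertex, written recursively to match [path_sum];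
    the closed form is [list_boundaryE]. *)
Fixpoint list_boundary G (f : seq (nat * nat) -> G)
    (l : seq (nat * nat)) : G :=
  if l is v :: l' then (f l' - list_boundary (fun k => f (v :: k)) l')%R else 0%R.

Local Open Scope ring_scope.
Variable G : zmodType.
Implicit Types (f g : seq (nat * nat) -> G).

Lemma mulrz_signS (x : G) k : x *~ (-1) ^+ k.+1 = - (x *~ (-1) ^+ k).
Proof. by rewrite exprS mulN1r mulrNz. Qed.

Lemma mulrz_signM (x : G) k j : x *~ (-1) ^+ k *~ (-1) ^+ j = x *~ (-1) ^+ (k + j).
Proof. by rewrite -mulrzA exprD. Qed.

Lemma mulrz_signK (x : G) k : x *~ (-1) ^+ k *~ (-1) ^+ k = x.
Proof. by rewrite mulrz_signM -signr_odd oddD addbb expr0. Qed.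

(** The bounds confine the path to its rectangle; without them the truncations by [inord] in
    [lattice_simplex] could not be removed. *)
Lemma eq_path_sum r p a b f g :
  (forall l, size l = r.+1 ->
     all (fun v => [&& (a <= v.1)%N, (v.1 <= a + p)%N, (b <= v.2)%N &
                       (v.2 + p <= b + r)%N]) l -> f l = g l) ->
  path_sum r p a b f = path_sum r p a b g.
Proof.
elim: r p a b f g => [|r IH] [|p] a b f g e //=.
- by apply: e => //=; rewrite !leqnn addn0 leqnn.
- rewrite !add0r; congr (_ *~ _); apply: IH => l sl al.
  apply: e; first by rewrite /= sl.
  rewrite /=; apply/andP; split; first lia.
  by apply/allP => v /(allP al); lia.
congr (_ + _ *~ _).
  apply: IH => l sl al; have [pr|pr] := leqP p r.
    apply: e; first by rewrite /= sl.
    rewrite /=; apply/andP; split; first lia.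
    by apply/allP => v /(allP al); lia.
  by case: l sl al => //= v l _ /andP[]; lia.
apply: IH => l sl al; have [pr|pr] := leqP p.+1 r.
  apply: e; first by rewrite /= sl.
  rewrite /=; apply/andP; split; first lia.
  by apply/allP => v /(allP al); lia.
by case: l sl al => //= v l _ /andP[]; lia.
Qed.

Lemma eq_path_sum' r p a b f g : f =1 g -> path_sum r p a b f = path_sum r p a b g.
Proof. by move=> e; apply: eq_path_sum. Qed.

Lemma path_sum_small r p a b f : (r < p)%N -> path_sum r p a b f = 0.
Proof.
elim: r p a b f => [|r IH] [|p] a b f //= rp.
by rewrite !IH ?mul0rz ?addr0//; lia.
Qed.

Lemma path_sumB r p a b f g :
  path_sum r p a b (fun l => f l - g l) = path_sum r p a b f - path_sum r p a b g.
Proof.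
elim: r p a b f g => [|r IH] [|p] a b f g //=; rewrite ?subr0//.
  by rewrite IH mulrzBl !add0r.
by rewrite !IH mulrzBl !opprD !addrA; congr (_ + _); rewrite addrAC.
Qed.

Lemma path_sum_bump_x r p a b f c : (c <= a)%N ->
  path_sum r p a b (fun l => f (map (bump_x c) l)) = path_sum r p a.+1 b f.
Proof.
elim: r p a b f => [|r IH] [|p] a b f ca //=; rewrite /bump_x /= /bump ca ?add1n//.
  by rewrite (IH 0%N a b.+1 (fun l => f ((a.+1, b) :: l)))//.
rewrite (IH p a.+1 b (fun l => f ((a.+1, b) :: l))); last by rewrite leqW.
by rewrite (IH p.+1 a b.+1 (fun l => f ((a.+1, b) :: l))).
Qed.

Lemma path_sum_bump_y r p a b f c : (c <= b)%N ->
  path_sum r p a b (fun l => f (map (bump_y c) l)) = path_sum r p a b.+1 f.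
Proof.
elim: r p a b f => [|r IH] [|p] a b f ca //=; rewrite /bump_y /= /bump ca ?add1n//.
  by rewrite (IH 0%N a b.+1 (fun l => f ((a, b.+1) :: l)))// leqW.
rewrite (IH p a.+1 b (fun l => f ((a, b.+1) :: l)))//.
by rewrite (IH p.+1 a b.+1 (fun l => f ((a, b.+1) :: l)))// leqW.
Qed.

(** The faces of the first factor: such a path has one horizontal step fewer, and there is nothing
    to sum when the first factor is a vertex. *)
Definition hor_boundary r p a b f : G :=
  if p is p'.+1 then
    \sum_(i < p.+1) path_sum r p' a b (fun l => f (map (bump_x (a + i)) l)) *~ (-1) ^+ i
  else 0.

Lemma hor_boundaryS r p a b f : hor_boundary r p.+1 a b f =
  \sum_(i < p.+2) path_sum r p a b (fun l => f (map (bump_x (a + i)) l)) *~ (-1) ^+ i.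
Proof. by []. Qed.

Definition ver_boundary r p a b f : G :=
  (\sum_(j < (r.+1 - p).+1)
     path_sum r p a b (fun l => f (map (bump_y (b + j)) l)) *~ (-1) ^+ j) *~ (-1) ^+ p.

Lemma path_sum_bump_xS r p a b f i :
  path_sum r.+1 p a b (fun l => f (map (bump_x (a + i.+1)) l)) =
  (if p is p'.+1 then path_sum r p' a.+1 b (fun l => f ((a, b) :: map (bump_x (a.+1 + i)) l)) else 0)
     + path_sum r p a b.+1 (fun l => f ((a, b) :: map (bump_x (a + i.+1)) l)) *~ (-1) ^+ p.
Proof.
have e : bump_x (a + i.+1) (a, b) = (a, b).
  by rewrite /bump_x /bump /= leqNgt addnS ltnS leq_addr.
by case: p => [|p] /=; rewrite e ?addSnnS.
Qed.

Lemma path_sum_bump_yS r p a b f j :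
  path_sum r.+1 p a b (fun l => f (map (bump_y (b + j.+1)) l)) =
  (if p is p'.+1 then path_sum r p' a.+1 b (fun l => f ((a, b) :: map (bump_y (b + j.+1)) l)) else 0)
     + path_sum r p a b.+1 (fun l => f ((a, b) :: map (bump_y (b.+1 + j)) l)) *~ (-1) ^+ p.
Proof.
have e : bump_y (b + j.+1) (a, b) = (a, b).
  by rewrite /bump_y /bump /= leqNgt addnS ltnS leq_addr.
by case: p => [|p] /=; rewrite e ?addSnnS.
Qed.

(** The Leibniz rule for shuffles. Deleting a corner of a path gives the same list as deleting the
    opposite corner of the unit square, with the opposite sign; the deletions that survive are the
    faces of the two factors. The induction follows the first step. *)
Lemma path_sum_boundary r p a b f :
  path_sum r.+1 p a b (list_boundary f) = hor_boundary r p a b f + ver_boundary r p a b f.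
Proof.
elim: r p a b f => [|r IH] p a b f.
  case: p => [|[|p]] /=.
  - rewrite /ver_boundary subn0 !big_ord_recl big_ord0 /= !mulr1z !add0r.
    by rewrite /bump_y /= /bump !addn0 leqnn leqNgt addn1 ltnSn /= subr0 !addr0 add1n mulrN1z.
  - rewrite /ver_boundary subnn !big_ord_recl !big_ord0 /= !mul0rz !addr0 !mulr1z.
    by rewrite /bump_x /= /bump !addn0 leqnn addn1 ltnn mul0rz addr0 subr0 mulrN1z.
  - rewrite /ver_boundary /= mul0rz addr0 big1 => [|i _]; last by rewrite mul0rz.
    by rewrite big1 ?mul0rz ?addr0 // => i _; rewrite mul0rz.
pose fv := fun l => f ((a, b) :: l).
have step : path_sum r.+2 p a b (list_boundary f) =
  (if p is p'.+1 then path_sum r.+1 p' a.+1 b f -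
      (hor_boundary r p' a.+1 b fv + ver_boundary r p' a.+1 b fv) else 0)
  + (path_sum r.+1 p a b.+1 f -
     (hor_boundary r p a b.+1 fv + ver_boundary r p a b.+1 fv)) *~ (-1) ^+ p.
  by rewrite -IH; case: p => [|p]; rewrite -?IH -!path_sumB.
rewrite {}step.
(* The face [j = 0] moves the whole path to [b.+1]. The other faces fix the first vertex and split
   according to the first step. *)
have hV : ver_boundary r.+1 p a b f =
   (path_sum r.+1 p a b.+1 f - ver_boundary r p a b.+1 fv) *~ (-1) ^+ p
   - (if p is p'.+1 then \sum_(j < (r.+2 - p))
        path_sum r p' a.+1 b (fun l => fv (map (bump_y (b + j.+1)) l)) *~ (-1) ^+ j else 0)
       *~ (-1) ^+ p.
  rewrite {1}/ver_boundary big_ord_recl addn0 mulr1z path_sum_bump_y// -mulrzBl.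
  congr (_ *~ _); move: (path_sum r.+1 p a b.+1 f) => A0.
  rewrite -[RHS]addrA; congr (_ + _).
  rewrite (eq_bigr (fun j : 'I_(r.+2 - p) =>
     - ((if p is p'.+1 then path_sum r p' a.+1 b (fun l => fv (map (bump_y (b + j.+1)) l)) else 0)
        *~ (-1) ^+ j) - path_sum r p a b.+1 (fun l => fv (map (bump_y (b.+1 + j)) l)) *~ (-1) ^+ j
          *~ (-1) ^+ p)); last first.
    move=> j _; rewrite lift0 mulrz_signS path_sum_bump_yS mulrzDl opprD.
    by rewrite !mulrz_signM [(p + j)%N]addnC.
  rewrite big_split /= addrC; congr (_ + _).
    rewrite sumrN -mulrz_suml; congr (- _); rewrite /ver_boundary.
    have [pr|pr] := leqP p r.+1; first by rewrite subSn.
    rewrite !big1 //= => j _; by rewrite path_sum_small ?mul0rz//; lia.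
  rewrite sumrN; congr (- _); case: p => [|p]//.
  by rewrite big1// => j _; rewrite mul0rz.
rewrite hV; clear hV.
case: p => [|p].
  by rewrite /= !add0r mulr1z mul0rz subr0.
have -> : hor_boundary r.+1 p.+1 a b f = path_sum r.+1 p a.+1 b f
   - hor_boundary r p a.+1 b fv
   - (\sum_(i < p.+1) path_sum r p a b.+1 (fun l => fv (map (bump_x (a + i.+1)) l))
         *~ (-1) ^+ i) *~ (-1) ^+ p.
  rewrite hor_boundaryS big_ord_recl addn0 mulr1z path_sum_bump_x//.
  move: (path_sum r.+1 p a.+1 b f) => A0; rewrite -[RHS]addrA; congr (_ + _).
  rewrite (eq_bigr (fun i : 'I_p.+1 =>
     - ((if p is p'.+1 then path_sum r p' a.+1 b (fun l => fv (map (bump_x (a.+1 + i)) l)) else 0)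
        *~ (-1) ^+ i) - path_sum r p a b.+1 (fun l => fv (map (bump_x (a + i.+1)) l)) *~ (-1) ^+ i
          *~ (-1) ^+ p)); last first.
    move=> i _; rewrite lift0 mulrz_signS path_sum_bump_xS mulrzDl opprD.
    by rewrite !mulrz_signM [(p + i)%N]addnC.
  rewrite big_split /= !sumrN -mulrz_suml; congr (- _ - _).
  by case: p => [|p] //=; rewrite big1// => i _; rewrite mul0rz.
have -> : hor_boundary r p.+1 a b.+1 fv = path_sum r p a.+1 b.+1 fv
   - \sum_(i < p.+1) path_sum r p a b.+1 (fun l => fv (map (bump_x (a + i.+1)) l))
         *~ (-1) ^+ i.
  rewrite hor_boundaryS big_ord_recl addn0 mulr1z path_sum_bump_x//.
  move: (path_sum r p a.+1 b.+1 fv) => A0; congr (_ + _).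
  by rewrite -sumrN; apply: eq_bigr => i _; rewrite lift0 mulrz_signS.
have -> : ver_boundary r p a.+1 b fv = (path_sum r p a.+1 b.+1 fv
   - \sum_(j < r.+2 - p.+1) path_sum r p a.+1 b (fun l => fv (map (bump_y (b + j.+1)) l))
         *~ (-1) ^+ j) *~ (-1) ^+ p.
  rewrite /ver_boundary big_ord_recl addn0 mulr1z path_sum_bump_y//.
  move: (path_sum r p a.+1 b.+1 fv) => A0; congr ((_ + _) *~ _).
  by rewrite -sumrN; apply: eq_bigr => i _; rewrite lift0 mulrz_signS.
rewrite !mulrz_signS !(mulrzBl, mulrzDl).
(* [A3] sums over the paths that jump from [(a, b)] to [(a.+1, b.+1)]. The missing corner arises
   from either first step, and the two contributions cancel. *)
have aux (A1 A2 A3 A4 A6 S U : G) : A1 - (A2 + (A3 - A4)) + - (A6 - (A3 - S + U)) =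
    A1 - A2 - S + (- (A6 - U) - - A4).
  rewrite !(opprD, opprB, opprK) !addrA.
  by rewrite [LHS](ACl (1*2*6*7*8*3*(5*4))) /= subrr addr0.
exact: aux.
Qed.

End LatticePaths.

Section ShuffleSum.
Local Close Scope classical_set_scope.
Variable G : zmodType.

(** Peeling off the first step lets the shuffles of the cross product, which are sets, follow the
    recursion of [path_sum]. *)
Definition set_cons (r : nat) (c : bool) (S : {set 'I_r}) : {set 'I_r.+1} :=
  [set j | if unlift ord0 j is Some j' then j' \in S else c].

Lemma in_set_cons0 r c (S : {set 'I_r}) : (ord0 \in set_cons c S) = c.
Proof. by rewrite inE unlift_none. Qed.

Lemma in_set_consS r c (S : {set 'I_r}) j : (lift ord0 j \in set_cons c S) = (j \in S).
Proof. by rewrite inE liftK. Qed.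

Definition inE_set_cons := (in_set_cons0, in_set_consS).

Lemma set_consC r c (S : {set 'I_r}) : ~: set_cons c S = set_cons (~~ c) (~: S).
Proof.
apply/setP => j; rewrite inE; case: (unliftP ord0 j) => [j' ->|->];
  by rewrite !inE_set_cons ?inE.
Qed.

Lemma card_ord_set r (P : pred 'I_r) : #|[set j in P]| = (\sum_(j < r) P j)%N.
Proof.
rewrite -sum1_card big_mkcond /=; apply: eq_bigr => j _.
by rewrite inE unfold_in; case: (P j).
Qed.

Definition below r (S : {set 'I_r}) (k : nat) : nat := #|[set j in S | (j < k)%N]|.

Lemma belowE r (S : {set 'I_r}) k :
  below S k = (\sum_(j < r) ((j \in S) && (j < k)))%N.
Proof.
rewrite /below -(@card_ord_set r [pred j | (j \in S) && (j < k)%N]).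
by apply: eq_card => j; rewrite !inE.
Qed.

Lemma below_cons r c (S : {set 'I_r}) k :
  below (set_cons c S) k.+1 = (c + below S k)%N.
Proof.
rewrite !belowE big_ord_recl inE_set_cons /= andbT; congr (_ + _)%N.
by apply: eq_bigr => j _; rewrite inE_set_cons.
Qed.

Lemma below0 r (S : {set 'I_r}) : below S 0 = 0%N.
Proof. by rewrite belowE big1// => j _; rewrite ltn0 andbF. Qed.

Lemma card_below r (S : {set 'I_r}) : #|S| = below S r.
Proof. by apply: eq_card => j; rewrite !inE ltn_ord andbT. Qed.

Lemma card_set_cons r c (S : {set 'I_r}) : #|set_cons c S| = (c + #|S|)%N.
Proof. by rewrite !card_below below_cons. Qed.

Definition inversions r (S : {set 'I_r}) : nat :=
  #|[set ij : 'I_r * 'I_r | [&& ij.1 \in S, ij.2 \notin S & (ij.2 < ij.1)%N]]|.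

Lemma inversionsE r (S : {set 'I_r}) : inversions S =
  (\sum_(i < r) \sum_(j < r) [&& i \in S, j \notin S & (j < i)%N])%N.
Proof.
rewrite /inversions -sum1_card big_mkcond /= pair_big /=; apply: eq_bigr => -[i j] _.
by rewrite inE /=; case: ifP.
Qed.

(** A vertical first step precedes every horizontal one and forms an inversion with each; this is
    the sign [(-1) ^+ p] in [path_sum]. *)
Lemma inversions_cons r c (S : {set 'I_r}) :
  inversions (set_cons c S) = ((if c then 0 else #|S|) + inversions S)%N.
Proof.
rewrite !inversionsE big_ord_recl big1 ?add0n; last by move=> j _; rewrite ltn0 !andbF.
under eq_bigr do rewrite big_ord_recl inE_set_cons.
rewrite big_split /=; congr (_ + _)%N.
  rewrite inE_set_cons card_below belowE; case: c => /=.
    by rewrite big1// => j _; rewrite andbF.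
  by apply: eq_bigr => j _; rewrite ltn_ord !andbT.
apply: eq_bigr => i _; apply: eq_bigr => j _.
by rewrite inE_set_cons.
Qed.

Definition lattice_path r (S : {set 'I_r}) (a b : nat) : seq (nat * nat) :=
  [seq ((a + below S k)%N, (b + below (~: S) k)%N) | k <- iota 0 r.+1].

Lemma lattice_path_cons r c (S : {set 'I_r}) a b :
  lattice_path (set_cons c S) a b = (a, b) :: lattice_path S (a + c) (b + ~~ c).
Proof.
rewrite /lattice_path.
have -> : iota 0 r.+2 = 0%N :: map (addn 1) (iota 0 r.+1) by rewrite -iotaDl.
rewrite map_cons !below0 !addn0; congr (_ :: _); rewrite -map_comp; apply: eq_map => k /=.
by rewrite add1n set_consC !below_cons !addnA.
Qed.

Lemma sum_set_cons r (F : {set 'I_r.+1} -> G) :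
  \sum_S F S = \sum_(S : {set 'I_r}) F (set_cons true S) +
               \sum_(S : {set 'I_r}) F (set_cons false S).
Proof.
pose h (x : bool * {set 'I_r}) := set_cons x.1 x.2.
have bij : bijective h.
  exists (fun S : {set 'I_r.+1} => (ord0 \in S, [set j : 'I_r | lift ord0 j \in S])).
    move=> [c S]; rewrite /h /= inE_set_cons; congr (_, _).
    by apply/setP => j; rewrite inE inE_set_cons.
  move=> S; apply/setP => j; rewrite /h.
  by case: (unliftP ord0 j) => [j' ->|->]; rewrite inE_set_cons ?inE.
rewrite (reindex h) /=; last exact: onW_bij.
rewrite -(pair_big xpredT xpredT (fun c S => F (set_cons c S))) /=.
by rewrite big_bool.
Qed.

Lemma shuffle_path_sum r p a b (f : seq (nat * nat) -> G) :
  \sum_(S : {set 'I_r} | #|S| == p) f (lattice_path S a b) *~ (-1) ^+ inversions S =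
  path_sum r p a b f.
Proof.
rewrite big_mkcond /=; elim: r p a b f => [|r IH] p a b f.
  rewrite (big_pred1 finset.set0) => [|S]; last first.
    by apply/esym/eqP/setP => -[].
  rewrite cards0 /lattice_path /= !below0 !addn0.
  have -> : inversions (finset.set0 : {set 'I_0}) = 0%N.
    by apply/eqP; rewrite cards_eq0; apply/eqP/setP => -[[]].
  by case: p.
rewrite sum_set_cons /=; congr (_ + _).
  case: p => [|p].
    by rewrite big1// => S _; rewrite card_set_cons.
  rewrite -IH; apply: eq_bigr => S _; rewrite card_set_cons eqSS.
  by rewrite lattice_path_cons inversions_cons addn1 addn0.
rewrite -IH mulrz_suml; apply: eq_bigr => S _; rewrite card_set_cons add0n.
case: eqP => [Sp|_]; last by rewrite mul0rz.
by rewrite lattice_path_cons inversions_cons addn0 addn1 Sp mulrz_signM addnC.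
Qed.

End ShuffleSum.

Section Shuffles.
Variable R : realType.
Variables X Y : topologicalType.

Definition lattice_simplex r p q (s : singular R p X) (t : singular R q Y)
    (l : seq (nat * nat)) : singular R r (X * Y)%type :=
  cts_pair
    (cts_comp s (simplex_map R (fun k : 'I_r.+1 => inord (nth (0, 0) l k).1%N)))
    (cts_comp t (simplex_map R (fun k : 'I_r.+1 => inord (nth (0, 0) l k).2%N))).

(* The cross product of simplices; keeping the dimension [r] of the result apart
   from [p + q] avoids transports along equations such as
   [p.+1 + q = p + q.+1]. *)
Definition shuffle r p q (s : singular R p X) (t : singular R q Y) :
    chain R r (X * Y)%type :=
  path_sum r p 0 0 (fun l => gen (lattice_simplex r s t l)).

Lemma simplex_map_eq m n (v w : 'I_m.+1 -> 'I_n.+1) : v =1 w ->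
  simplex_map R v = simplex_map R w.
Proof. by move=> e; congr simplex_map; apply/funext. Qed.

Lemma shuffle_signE p q (S : {set 'I_(p + q)}) :
  shuffle_sign S = (-1) ^+ inversions S.
Proof.
rewrite /shuffle_sign /inversions; congr (_ ^+ _); apply: eq_card => ij.
rewrite finset.inE; apply/idP/idP => [|h]; first by move/set_mem.
exact/mem_set.
Qed.

Lemma simplex_crossE p q (s : singular R p X) (t : singular R q Y) :
  simplex_cross s t = shuffle (p + q) s t.
Proof.
rewrite /simplex_cross /shuffle -shuffle_path_sum; apply: eq_bigr => S _.
rewrite scale_intz shuffle_signE; congr (<< _ >> *~ _).
rewrite /lattice_simplex; congr cts_pair; congr cts_comp; apply: simplex_map_eq => k;
  by rewrite (nth_map 0%N) ?size_iota// nth_iota// !add0n.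
Qed.

Lemma simplex_mapM m n k (v : 'I_m.+1 -> 'I_n.+1) (w : 'I_n.+1 -> 'I_k.+1) :
  cts_comp (simplex_map R w) (simplex_map R v) = simplex_map R (w \o v).
Proof.
apply: cts_eq => t; apply: val_inj; apply/rowP => j; rewrite !mxE /=.
rewrite [RHS](partition_big v (fun i => w i == j)) //=.
apply: eq_bigr => i /eqP wi; rewrite mxE; apply: eq_bigl => l.
by case: eqP => [->|]; rewrite ?wi ?eqxx ?andbF.
Qed.

Lemma additive_path_sum (G H : zmodType) (h : {additive G -> H}) r p a b f :
  h (path_sum r p a b f) = path_sum r p a b (h \o f).
Proof.
elim: r p a b f => [|r IH] [|p] a b f //=; rewrite ?raddf0//.
  by rewrite raddfD raddfMz /= raddf0 IH.
by rewrite raddfD raddfMz /= !IH.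
Qed.

Definition delete (k : nat) (l : seq (nat * nat)) := take k l ++ drop k.+1 l.

Lemma list_boundaryE G (f : seq (nat * nat) -> G) l :
  list_boundary f l = \sum_(k < size l) f (delete k l) *~ (-1) ^+ k.
Proof.
elim: l f => [|v l IH] f /=; first by rewrite big_ord0.
rewrite big_ord_recl mulr1z /delete /= drop0; congr (_ + _).
rewrite IH -sumrN; apply: eq_bigr => k _.
by rewrite -mulrz_signS.
Qed.

Lemma nth_delete k l j : (k < size l)%N -> (j < (size l).-1)%N ->
  nth (0, 0)%N (delete k l) j = nth (0, 0)%N l (bump k j).
Proof.
move=> kl jl; rewrite /delete nth_cat size_takel; last exact: ltnW.
rewrite /bump; case: ltnP => kj /=.
  by rewrite nth_take// leqNgt kj add0n.
by rewrite nth_drop; congr nth; lia.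
Qed.

Lemma face_cts_pair n (s : singular R n.+1 X) (t : singular R n.+1 Y) k :
  face k (cts_pair s t) = cts_pair (face k s) (face k t).
Proof. exact: cts_eq. Qed.

Lemma face_comp_map (Z : topologicalType) n m (s : singular R n Z)
    (v : 'I_m.+2 -> 'I_n.+1) k :
  face k (cts_comp s (simplex_map R v) : singular R m.+1 Z) =
  cts_comp s (cts_comp (simplex_map R v) (simplex_map R (lift k))).
Proof. exact: cts_eq. Qed.

Lemma face_comp_mapl (Z : topologicalType) n m (s : singular R n.+1 Z)
    (v : 'I_m.+1 -> 'I_n.+1) k :
  cts_comp (face k s) (simplex_map R v) =
  cts_comp s (cts_comp (simplex_map R (lift k)) (simplex_map R v)).
Proof. exact: cts_eq. Qed.

Lemma face_lattice_simplex r p q (s : singular R p X) (t : singular R q Y) l (k : 'I_r.+2) :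
  size l = r.+2 ->
  face k (lattice_simplex r.+1 s t l) = lattice_simplex r s t (delete k l).
Proof.
move=> sl; rewrite /lattice_simplex.
rewrite face_cts_pair !face_comp_map !simplex_mapM.
by congr cts_pair; congr cts_comp; apply: simplex_map_eq => j /=; rewrite nth_delete ?sl.
Qed.

Lemma boundary_shuffle r p q (s : singular R p X) (t : singular R q Y) :
  boundary (shuffle r.+1 s t) =
  path_sum r.+1 p 0 0 (list_boundary (fun l => gen (lattice_simplex r s t l))).
Proof.
rewrite /shuffle additive_path_sum; apply: eq_path_sum => l sl _.
rewrite -[LHS]/(boundary (gen (lattice_simplex r.+1 s t l))) boundaryU list_boundaryE sl; apply: eq_bigr => k _.
by rewrite face_lattice_simplex.
Qed.

Lemma hor_boundary_shuffle r p q (s : singular R p.+1 X) (t : singular R q Y) :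
  hor_boundary r p.+1 0 0 (fun l => gen (lattice_simplex r s t l)) =
  \sum_(i < p.+2) shuffle r (face i s) t *~ (-1) ^+ i.
Proof.
rewrite hor_boundaryS; apply: eq_bigr => i _; congr (_ *~ _).
rewrite add0n; apply: eq_path_sum => l sl al; congr (<< _ >>).
rewrite /lattice_simplex face_comp_mapl simplex_mapM.
congr cts_pair; congr cts_comp; apply: simplex_map_eq => k /=; last first.
  by rewrite (nth_map (0, 0)%N) ?sl.
rewrite (nth_map (0, 0)%N) ?sl// /bump_x /=.
(* The vertex lies in the rectangle of the path, so [inord] does not truncate and commutes with
   [bump]. *)
have /(allP al) : nth (0, 0)%N l k \in l by rewrite mem_nth ?sl.
move=> /and4P[_ h _ _]; apply: val_inj => /=.
by rewrite !inordK // /bump; lia.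
Qed.

Lemma ver_boundary_shuffle r p q (s : singular R p X) (t : singular R q.+1 Y) :
  r.+1 = (p + q.+1)%N ->
  ver_boundary r p 0 0 (fun l => gen (lattice_simplex r s t l)) =
  (\sum_(i < q.+2) shuffle r s (face i t) *~ (-1) ^+ i) *~ (-1) ^+ p.
Proof.
move=> er; rewrite /ver_boundary.
have -> : (r.+1 - p = q.+1)%N by rewrite er addKn.
congr (_ *~ _); apply: eq_bigr => i _; congr (_ *~ _).
rewrite add0n; apply: eq_path_sum => l sl al; congr (<< _ >>).
rewrite /lattice_simplex face_comp_mapl simplex_mapM.
congr cts_pair; congr cts_comp; apply: simplex_map_eq => k /=.
  by rewrite (nth_map (0, 0)%N) ?sl.
rewrite (nth_map (0, 0)%N) ?sl// /bump_y /=.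
have /(allP al) : nth (0, 0)%N l k \in l by rewrite mem_nth ?sl.
move=> /and4P[_ _ _ h]; apply: val_inj => /=.
by rewrite !inordK // /bump; lia.
Qed.

Lemma boundaryB (Z : topologicalType) n (c d : chain R n Z) :
  boundary (c - d) = boundary c - boundary d.
Proof. exact: raddfB. Qed.

Definition shuffle_chain r p q (c : chain R p X) (d : chain R q Y) :
    chain R r (X * Y)%type :=
  evaluate (fun s => evaluate (fun t => shuffle r s t) d) c.

Lemma chain_crossE p q (c : chain R p X) (d : chain R q Y) :
  chain_cross c d = shuffle_chain (p + q) c d.
Proof.
rewrite /chain_cross fglift_evaluate; apply: eq_evaluate => s.
rewrite fglift_evaluate; apply: eq_evaluate => t.
exact: simplex_crossE.
Qed.

Lemma shuffle_chainBl r p q (c c' : chain R p X) (d : chain R q Y) :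
  shuffle_chain r (c - c') d = shuffle_chain r c d - shuffle_chain r c' d.
Proof. exact: evaluate_chainB. Qed.

Lemma shuffle_chainBr r p q (c : chain R p X) (d d' : chain R q Y) :
  shuffle_chain r c (d - d') = shuffle_chain r c d - shuffle_chain r c d'.
Proof.
rewrite /shuffle_chain -evaluateN -evaluateD; apply: eq_evaluate => s.
exact: evaluate_chainB.
Qed.

Lemma shuffle_chain0l r p q (d : chain R q Y) : shuffle_chain r (0 : chain R p X) d = 0.
Proof. exact: raddf0. Qed.

Lemma shuffle_chain0r r p q (c : chain R p X) : shuffle_chain r c (0 : chain R q Y) = 0.
Proof. by rewrite -(subrr 0) shuffle_chainBr subrr. Qed.

Lemma shuffle_chainU r p q (s : singular R p X) (t : singular R q Y) :
  shuffle_chain r (gen s)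
     (gen t) = shuffle r s t.
Proof. by rewrite /shuffle_chain !evaluateU. Qed.

Lemma boundary_shuffle_simplex r p q (s : singular R p X) (t : singular R q Y) :
  r.+1 = (p + q)%N ->
  boundary (shuffle r.+1 s t) =
  shuffle_chain r (boundary (gen s)) (gen t)
  + shuffle_chain r (gen s)
      (boundary (gen t)) *~ (-1) ^+ p.
Proof.
move=> er; rewrite boundary_shuffle path_sum_boundary; congr (_ + _).
  case: p s er => [|p] s er; first by rewrite /= shuffle_chain0l.
  rewrite hor_boundary_shuffle /shuffle_chain evaluate_boundary evaluateU.
  by apply: eq_bigr => i _; rewrite evaluateU.
case: q t er => [|q] t er.
  (* For [q = 0] the vertical sum still has one summand, but [r < p] leaves no path. *)
  rewrite [boundary _]/= shuffle_chain0r mul0rz /ver_boundary big1 ?mul0rz// => i _.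
  by rewrite path_sum_small ?mul0rz//; lia.
rewrite ver_boundary_shuffle// /shuffle_chain evaluateU evaluate_boundary evaluateU.
by [].
Qed.

Lemma boundary_shuffle_chain r p q (c : chain R p X) (d : chain R q Y) :
  r.+1 = (p + q)%N ->
  boundary (shuffle_chain r.+1 c d) =
  shuffle_chain r (boundary c) d + shuffle_chain r c (boundary d) *~ (-1) ^+ p.
Proof.
move=> er; elim/chain_ind: c => [|s|c c' IH IH']; last 2 first.
- elim/chain_ind: d => [|t|d d' IH IH']; last 2 first.
  + by rewrite shuffle_chainU boundary_shuffle_simplex.
  + rewrite !(shuffle_chainBr, boundaryB) IH IH' mulrzBl opprD !addrA.
    by rewrite [LHS](ACl (1*3*2*4)).
  + by rewrite !(shuffle_chain0r, raddf0) mul0rz addr0.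
- rewrite !(shuffle_chainBl, boundaryB) IH IH' mulrzBl opprD !addrA.
  by rewrite [LHS](ACl (1*3*2*4)).
by rewrite !(shuffle_chain0l, raddf0) mul0rz addr0.
Qed.

End Shuffles.

Section ProductMaps.
Variables X Y X' Y' : topologicalType.

Lemma fst_cts_subproof : continuous (fst : X * Y -> X).
Proof. by move=> x; exact: cvg_fst. Qed.
Lemma snd_cts_subproof : continuous (snd : X * Y -> Y).
Proof. by move=> x; exact: cvg_snd. Qed.
Definition cts_fst : continuousType (X * Y)%type X := mkcts fst_cts_subproof.
Definition cts_snd : continuousType (X * Y)%type Y := mkcts snd_cts_subproof.

Definition cts_prod (f : continuousType X X') (g : continuousType Y Y') :
  continuousType (X * Y)%type (X' * Y')%type :=
  cts_pair (cts_comp f cts_fst) (cts_comp g cts_snd).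
End ProductMaps.

Section CrossHomology.
Variable R : realType.

Lemma boundaryMz (Z : topologicalType) n (c : chain R n Z) k :
  boundary (c *~ k) = boundary c *~ k.
Proof. exact: raddfMz. Qed.

Lemma shuffle_cycle X Y r p q (c : chain R p X) (d : chain R q Y) :
  r = (p + q)%N -> c \in @Defs.cycle R X p -> d \in @Defs.cycle R Y q ->
  shuffle_chain r c d \in @Defs.cycle R (X * Y)%type r.
Proof.
move=> er /eqP hc /eqP hd; case: r er => [|r] er; first exact: (introT eqP erefl).
by apply/eqP; rewrite boundary_shuffle_chain// hc hd shuffle_chain0l shuffle_chain0r
  mul0rz addr0.
Qed.

Lemma shuffle_boundaryl X Y p q (u : chain R p.+1 X) (d : chain R q Y) :
  d \in @Defs.cycle R Y q ->
  shuffle_chain (p + q) (boundary u) d = boundary (shuffle_chain (p + q).+1 u d).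
Proof.
by move=> /eqP hd; rewrite boundary_shuffle_chain// hd shuffle_chain0r mul0rz addr0.
Qed.

Lemma shuffle_boundaryr X Y p q (c : chain R p X) (u : chain R q.+1 Y) :
  c \in @Defs.cycle R X p ->
  shuffle_chain (p + q) c (boundary u) =
  boundary (shuffle_chain (p + q).+1 c u *~ (-1) ^+ p).
Proof.
move=> /eqP hc; rewrite boundaryMz.
by rewrite boundary_shuffle_chain ?addnS// hc shuffle_chain0l add0r mulrz_signK.
Qed.

Lemma shuffle_push (X Y X' Y' : topologicalType) (f : continuousType X X')
    (g : continuousType Y Y') r p q (c : chain R p X) (d : chain R q Y) :
  chain_push (cts_prod f g) (shuffle_chain r c d) =
  shuffle_chain r (chain_push f c) (chain_push g d).
Proof.
elim/chain_ind: c => [|s|c c' IH IH']; last 2 first.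
- elim/chain_ind: d => [|t|d d' IH IH']; last 2 first.
  + rewrite !chain_pushU !shuffle_chainU /shuffle additive_path_sum.
    apply: eq_path_sum' => l.
    rewrite -[LHS]/(chain_push (cts_prod f g)
      (gen (lattice_simplex r s t l))).
    by rewrite chain_pushU; congr (<< _ >>); apply: cts_eq.
  + by rewrite !(shuffle_chainBr, raddfB) /= IH IH'.
  + by rewrite !(shuffle_chain0r, raddf0).
- by rewrite !(shuffle_chainBl, raddfB) /= IH IH'.
by rewrite !(shuffle_chain0l, raddf0).
Qed.

Lemma pairing_cross X Y p q G
    (a : cohomology R (X * Y)%type G (p + q)) (b : homology R X p) (c : homology R Y q) :
  pairing a (cross b c) =
  evaluate (sq_repr a) (shuffle_chain (p + q) (sq_repr b) (sq_repr c)).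
Proof.
rewrite /cross pairing_classr ?chain_crossE// shuffle_cycle//; exact: sq_repr_in.
Qed.

Lemma pairing_cross_class X Y p q G
    (a : cohomology R (X * Y)%type G (p + q)) (c : chain R p X) (d : chain R q Y) :
  c \in @Defs.cycle R X p -> d \in @Defs.cycle R Y q ->
  pairing a (cross (sq_class (@Defs.cycle R X p) (@bounding R X p) c)
                   (sq_class (@Defs.cycle R Y q) (@bounding R Y q) d)) =
  evaluate (sq_repr a) (shuffle_chain (p + q) c d).
Proof.
move=> hc hd; rewrite pairing_cross.
set c' := sq_repr (sq_class _ _ c); set d' := sq_repr (sq_class _ _ d).
have hd' : d' \in @Defs.cycle R Y q by exact: sq_repr_in.
have ha : sq_repr a \in @cocycle R (X * Y)%type G (p + q) by exact: sq_repr_in.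
have /asboolP[u eu] : c' - c \in @bounding R X p by exact: sq_repr_class.
have /asboolP[w ew] : d' - d \in @bounding R Y q by exact: sq_repr_class.
apply: (@etrans _ _ (evaluate (sq_repr a) (shuffle_chain (p + q) c d')));
  apply/eqP; rewrite -subr_eq0 -evaluate_chainB.
  by rewrite -shuffle_chainBl eu shuffle_boundaryl// cocycle_boundary.
by rewrite -shuffle_chainBr ew shuffle_boundaryr// cocycle_boundary.
Qed.

Lemma cross_push (X Y X' Y' : topologicalType) (f : continuousType X X')
    (g : continuousType Y Y') p q G
    (a : cohomology R (X' * Y')%type G (p + q)) (b : homology R X p) (c : homology R Y q) :
  pairing a (cross (push f b) (push g c)) = pairing (pull (cts_prod f g) a) (cross b c).
Proof.
rewrite pairing_pull /push pairing_cross_class; last 2 first.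
- by apply: push_cycle; exact: sq_repr_in.
- by apply: push_cycle; exact: sq_repr_in.
rewrite -shuffle_push evaluate_push.
have h : chain_cross (sq_repr b) (sq_repr c) \in @Defs.cycle R (X * Y)%type (p + q).
  by rewrite chain_crossE shuffle_cycle//; exact: sq_repr_in.
rewrite -[sq_class _ _ (chain_push _ (sq_repr (cross b c)))]/(push (cts_prod f g) (cross b c)).
by rewrite -pairing_pull /pull /cross pairing_class// ?chain_crossE//
  pull_cocycle// sq_repr_in.
Qed.

Variables (A : zmodType) (K : EM_space R A).

(** It is enough to exhibit one class with the defining property. On cochains the slant product
    sends [t] to the value of [a] on the image of [z * t] under the multiplication; it is a cocycle
    because, [z] being a cycle, [z] times a boundary is a boundary. *)
Lemma slantP G p q (a : cohomology R K G (p + q)) (b : homology R K p)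
    (c : homology R K q) : pairing (slant a b) c = pairing a (pontrjagin b c).
Proof.
pose z := sq_repr b.
have hz : z \in @Defs.cycle R K p by exact: sq_repr_in.
pose sl : cochain R K G q := fun t => evaluate (sq_repr a) (chain_push (em_mul K)
  (shuffle_chain (p + q) z (gen t))).
have slE d : evaluate sl d = evaluate (sq_repr a) (chain_push (em_mul K)
    (shuffle_chain (p + q) z d)).
  elim/chain_ind: d => [|t|d d' IH IH'].
  - by rewrite shuffle_chain0r !raddf0.
  - by rewrite evaluateU.
  - by rewrite shuffle_chainBr chain_push_is_additive !evaluate_chainB IH IH'.
have ha : sq_repr a \in @cocycle R K G (p + q) by exact: sq_repr_in.
have hsl : sl \in @cocycle R K G q.
  apply/asboolP => d; rewrite slE shuffle_boundaryr// -boundary_push.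
  exact: cocycle_boundary.
have ex : [set s : cohomology R K G q |
    forall c, pairing s c = pairing a (pontrjagin b c)]
    (sq_class (@cocycle R K G q) (@cobounding R K G q) sl).
  move=> /= d; rewrite pairing_classl// slE /pontrjagin -pairing_pull pairing_cross.
  rewrite evaluate_push; apply/eqP; rewrite eq_sym -subr_eq0 -evaluateB.
  rewrite (@cobounding_cycle _ _ _ _
    (sq_repr (pull (em_mul K) a) - (fun s => sq_repr a (cts_comp (em_mul K) s))))//.
    by rewrite sq_repr_class// pull_cocycle.
  by rewrite shuffle_cycle// sq_repr_in.
by rewrite /slant; case: xgetP => [s _ h|/(_ _ ex)]//; exact: h.
Qed.

Lemma pairing_slant_push X Y (f : continuousType X K)
    (g : continuousType Y K) G p q (a : cohomology R K G (p + q))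
    (b : homology R X p) (c : homology R Y q) :
  pairing (slant a (push f b)) (push g c) =
  pairing (pull (cts_comp (em_mul K) (cts_prod f g)) a) (cross b c).
Proof.
by rewrite slantP /pontrjagin -pairing_pull cross_push -pull_comp.
Qed.

End CrossHomology.

(** * Geometry of simplices *)

Section SimplexGeometry.
Variable R : realType.

Definition crd n (t : simplex R n) (i : 'I_n.+1) : R := val t ord0 i.

Lemma crd_ge0 n (t : simplex R n) i : 0 <= crd t i.
Proof. by have [h _] := set_valP t; exact: h. Qed.

Lemma crd_sum n (t : simplex R n) : \sum_i crd t i = 1.
Proof. by have [_ h] := set_valP t. Qed.

Lemma crd_le1 n (t : simplex R n) i : crd t i <= 1.
Proof.
rewrite -(crd_sum t) (bigD1 i)//= lerDl.
by apply: sumr_ge0 => j _; exact: crd_ge0.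
Qed.

Lemma simplex_eq n (t u : simplex R n) : crd t =1 crd u -> t = u.
Proof. by move=> e; apply: val_inj; apply/rowP => i; exact: e. Qed.

Lemma vertex_subproof n (i : 'I_n.+1) :
  @simplex_set R n (\row_j (i == j)%:R).
Proof.
split=> [j|]; first by rewrite mxE ler0n.
rewrite (bigD1 i)//= mxE eqxx big1 ?addr0// => j ji.
by rewrite mxE eq_sym (negbTE ji).
Qed.
Definition vertex n (i : 'I_n.+1) : simplex R n :=
  exist (fun x => x \in @simplex_set R n) _ (mem_set (vertex_subproof i)).

Lemma crd_vertex n (i j : 'I_n.+1) : crd (vertex i) j = (i == j)%:R.
Proof. by rewrite /crd /= mxE. Qed.

(* Coordinates that do not describe a point of the simplex give a vertex. *)
Definition to_simplex n (f : 'I_n.+1 -> R) : simplex R n :=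
  if pselect (@simplex_set R n (\row_i f i)) is left h
  then exist (fun x => x \in @simplex_set R n) _ (mem_set h) else vertex ord0.

Lemma crd_to_simplex n (f : 'I_n.+1 -> R) i :
  (forall j, 0 <= f j) -> \sum_j f j = 1 -> crd (to_simplex f) i = f i.
Proof.
move=> f0 f1; rewrite /to_simplex; case: pselect => [h|[]]; first by rewrite /crd /= mxE.
by split=> [j|]; rewrite ?mxE// -f1; apply: eq_bigr => j _; rewrite mxE.
Qed.

Lemma crd_continuous n (i : 'I_n.+1) : continuous (fun t : simplex R n => crd t i).
Proof.
move=> u; apply: (@continuous_comp _ _ _ (val : simplex R n -> _)
                           (fun M : 'rV[R]_n.+1 => M ord0 i)).
  exact: initial_continuous.
exact: coord_continuous.
Qed.

Lemma simplex_continuous Y n (f : Y -> simplex R n) :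
  (forall i, continuous (fun y => crd (f y) i)) -> continuous f.
Proof.
move=> crdf; apply: continuous_comp_initial => t P [B B_nbhs BP].
have : nbhs t [set u | forall j, B ord0 j (val (f u) ord0 j)].
  apply: (@filter_forall _ _
    (fun j u => B ord0 j (val (f u) ord0 j)) (nbhs t) (nbhs_filter t)).
  by move=> j; exact: (crdf j t _ (B_nbhs ord0 j)).
by apply: filterS => u hu; apply: BP => i j; rewrite ord1; exact: hu.
Qed.

Lemma continuous_sumr Y (I : finType) (P : pred I) (F : I -> Y -> R) :
  (forall i, continuous (F i)) -> continuous (fun y => \sum_(i | P i) F i y).
Proof.
move=> cF; apply: (continuous_big (op := +%R)) => [x|i _ y]; last exact: cF.
exact: add_continuous.
Qed.

Definition affine_fun m n (p : 'I_m.+1 -> simplex R n) (t : simplex R m) : simplex R n :=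
  to_simplex (fun j => \sum_i crd t i * crd (p i) j).

Lemma crd_affine m n (p : 'I_m.+1 -> simplex R n) t j :
  crd (affine_fun p t) j = \sum_i crd t i * crd (p i) j.
Proof.
rewrite crd_to_simplex// => [k|].
  by apply: sumr_ge0 => i _; rewrite mulr_ge0 ?crd_ge0.
rewrite exchange_big /= -[RHS](crd_sum t); apply: eq_bigr => i _.
by rewrite -mulr_sumr crd_sum mulr1.
Qed.

Lemma affine_fun_continuous m n (p : 'I_m.+1 -> simplex R n) :
  continuous (affine_fun p).
Proof.
apply: simplex_continuous => j.
under eq_fun do rewrite crd_affine.
apply: continuous_sumr => i t; apply: continuousM; first exact: crd_continuous.
exact: cst_continuous.
Qed.

Definition affine m n (p : 'I_m.+1 -> simplex R n) :
  continuousType (simplex R m) (simplex R n) := mkcts (@affine_fun_continuous m n p).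

Lemma crd_simplex_map m n (v : 'I_m.+1 -> 'I_n.+1) t j :
  crd (simplex_map R v t) j = \sum_(i | v i == j) crd t i.
Proof. by rewrite /crd /= mxE. Qed.

Lemma affine_vertex m n (v : 'I_m.+1 -> 'I_n.+1) :
  affine (fun i => vertex (v i)) = simplex_map R v.
Proof.
apply: cts_eq => t; apply: simplex_eq => j.
rewrite crd_simplex_map [LHS]crd_affine [RHS]big_mkcond; apply: eq_bigr => i _.
by rewrite crd_vertex; case: eqP => _; rewrite ?mulr1 ?mulr0.
Qed.

Lemma affine_vertex_id n : affine (@vertex n) = idfun.
Proof.
apply: cts_eq => t; apply: simplex_eq => j.
rewrite [LHS]crd_affine (bigD1 j)//= crd_vertex eqxx mulr1 big1 ?addr0// => i ij.
by rewrite crd_vertex (negbTE ij) mulr0.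
Qed.

Lemma affineM k m n (p : 'I_m.+1 -> simplex R n) (q : 'I_k.+1 -> simplex R m) :
  cts_comp (affine p) (affine q) = affine (fun i => affine p (q i)).
Proof.
apply: cts_eq => t; apply: simplex_eq => j; rewrite /cts_comp /= !crd_affine.
under eq_bigr do rewrite crd_affine mulr_suml.
rewrite exchange_big /=; apply: eq_bigr => i _; rewrite crd_affine mulr_sumr.
by apply: eq_bigr => l _; rewrite mulrA.
Qed.

Lemma affine_map k m n (p : 'I_m.+1 -> simplex R n) (v : 'I_k.+1 -> 'I_m.+1) :
  cts_comp (affine p) (simplex_map R v) = affine (p \o v).
Proof.
rewrite -affine_vertex affineM; congr affine; apply/funext => i /=.
apply: simplex_eq => j; rewrite crd_affine (bigD1 (v i))//= crd_vertex eqxx mul1r.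
by rewrite big1 ?addr0// => l li; rewrite crd_vertex eq_sym (negbTE li) mul0r.
Qed.

Lemma affine_at_vertex m n (p : 'I_m.+1 -> simplex R n) i : affine p (vertex i) = p i.
Proof.
apply: simplex_eq => j; rewrite [LHS]crd_affine (bigD1 i)//= crd_vertex eqxx mul1r.
by rewrite big1 ?addr0// => l li; rewrite crd_vertex eq_sym (negbTE li) mul0r.
Qed.

Lemma simplex_map_vertex m n (v : 'I_m.+1 -> 'I_n.+1) i :
  simplex_map R v (vertex i) = vertex (v i).
Proof. by rewrite -affine_vertex affine_at_vertex. Qed.

Lemma simplex0_eq (t u : simplex R 0) : t = u.
Proof.
apply: simplex_eq => i; rewrite ord1.
by have := crd_sum t; have := crd_sum u; rewrite !big_ord1 => -> ->.
Qed.

Lemma ord2P (i : 'I_2) : i = ord0 \/ i = ord_max.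
Proof. by case: i => [[|[|//]] h]; [left|right]; exact: val_inj. Qed.

Lemma ord2_lift : lift ord0 ord0 = ord_max :> 'I_2.
Proof. exact: val_inj. Qed.

Lemma simplex1_crd (t : simplex R 1) : crd t ord0 = 1 - crd t ord_max.
Proof. by rewrite -(crd_sum t) !big_ord_recl big_ord0 addr0 ord2_lift addrK. Qed.

Definition pair_fun (T : Type) (x y : T) : 'I_2 -> T := fun i => if i == ord0 then x else y.
Definition triple_fun (T : Type) (x y z : T) : 'I_3 -> T :=
  fun i => if i == ord0 then x else if i == ord_max then z else y.

Definition v0 : simplex R 1 := vertex ord0.
Definition v1 : simplex R 1 := vertex ord_max.

Lemma pair_fun_vertex : @vertex 1 = pair_fun v0 v1.
Proof.
by apply/funext => i; have [->|->] := ord2P i.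
Qed.

Lemma crd_affine_pair n (p q : simplex R n) t j :
  crd (affine (pair_fun p q) t) j = (1 - crd t ord_max) * crd p j + crd t ord_max * crd q j.
Proof. by rewrite crd_affine !big_ord_recl big_ord0 addr0 ord2_lift simplex1_crd. Qed.

Lemma affine_const n (q : simplex R n) t : affine (pair_fun q q) t = q.
Proof. by apply: simplex_eq => j; rewrite crd_affine_pair -mulrDl subrK mul1r. Qed.

Lemma affine_v01 t : affine (pair_fun v0 v1) t = t.
Proof. by rewrite -pair_fun_vertex affine_vertex_id. Qed.

Section Segments.
Variables (X : topologicalType) (n : nat) (g : continuousType (simplex R n) X).
Definition segment (p q : simplex R n) : singular R 1 X :=
  cts_comp g (affine (pair_fun p q)).
Definition triangle (p q r : simplex R n) : singular R 2 X :=
  cts_comp g (affine (triple_fun p q r)).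

Lemma face_triangle0 p q r : face ord0 (triangle p q r) = segment q r.
Proof.
apply: cts_eq => t; rewrite /face /cts_comp /=; congr (g _).
rewrite -[LHS]/(cts_comp (affine _) (simplex_map R _) t) affine_map.
congr (affine _ t); apply/funext => -[[|[|//]] h] //=.
Qed.

Lemma face_triangle1 p q r : face (lift ord0 ord0) (triangle p q r) = segment p r.
Proof.
apply: cts_eq => t; rewrite /face /cts_comp /=; congr (g _).
rewrite -[LHS]/(cts_comp (affine _) (simplex_map R _) t) affine_map.
congr (affine _ t); apply/funext => -[[|[|//]] h] //=.
Qed.

Lemma face_triangle2 p q r : face ord_max (triangle p q r) = segment p q.
Proof.
apply: cts_eq => t; rewrite /face /cts_comp /=; congr (g _).
rewrite -[LHS]/(cts_comp (affine _) (simplex_map R _) t) affine_map.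
congr (affine _ t); apply/funext => -[[|[|//]] h] //=.
Qed.
End Segments.

Lemma segment_id X (s : singular R 1 X) : segment s v0 v1 = s.
Proof.
rewrite /segment -pair_fun_vertex affine_vertex_id; exact: cts_eq.
Qed.

Lemma segment_start X n (g : continuousType (simplex R n) X) p q :
  segment g p q v0 = g p.
Proof. exact: (congr1 g (affine_at_vertex _ _)). Qed.

Lemma segment_end X n (g : continuousType (simplex R n) X) p q :
  segment g p q v1 = g q.
Proof. exact: (congr1 g (affine_at_vertex _ _)). Qed.

End SimplexGeometry.

(** * Cocycles of degree one *)

Section DegreeOne.
Variables (R : realType) (X : topologicalType) (G : zmodType).
Variable phi : cochain R X G 1.
Hypothesis hphi : phi \in @cocycle R X G 1.

Lemma cocycle1 (T : singular R 2 X) :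
  phi (face (lift ord0 ord0) T) = phi (face ord_max T) + phi (face ord0 T).
Proof.
have /cocycleP/(_ T) := hphi.
rewrite !big_ord_recl big_ord0 /= addr0 mulr1z expr1 mulrN1z.
rewrite -[_ ^+ _]/((-1) ^+ 2) sqrrN expr1n mulr1z.
have -> : lift ord0 (lift ord0 ord0) = ord_max :> 'I_3 by apply: val_inj.
by move=> e; apply/eqP; rewrite -subr_eq0 -oppr_eq0 -e opprB -addrA addrC addrA.
Qed.

Lemma cocycle_triangle n (g : continuousType (simplex R n) X) p q r :
  phi (segment g p r) = phi (segment g p q) + phi (segment g q r).
Proof. by rewrite -(face_triangle1 g p q r) cocycle1 face_triangle0 face_triangle2. Qed.

Lemma cocycle_point n (g : continuousType (simplex R n) X) p :
  phi (segment g p p) = 0.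
Proof. by apply: (addIr (phi (segment g p p))); rewrite add0r -cocycle_triangle. Qed.

Lemma cocycle_rev n (g : continuousType (simplex R n) X) p q :
  phi (segment g q p) = - phi (segment g p q).
Proof.
apply/eqP; rewrite -addr_eq0 addrC -cocycle_triangle; exact/eqP/cocycle_point.
Qed.

Lemma cocycle_cst (s : singular R 1 X) x : (forall t, s t = x) -> phi s = 0.
Proof.
move=> e; rewrite -(cocycle_point s (v0 R)); congr phi; apply: cts_eq => t.
by rewrite /segment /cts_comp /= !e.
Qed.

End DegreeOne.

Section Continuity.
Variables (R : realType) (Y : topologicalType).
Implicit Types f g : Y -> R.

Lemma ctsD f g : continuous f -> continuous g -> continuous (fun y => f y + g y).
Proof. by move=> cf cg y; apply: continuousD; [exact: cf|exact: cg]. Qed.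
Lemma ctsB f g : continuous f -> continuous g -> continuous (fun y => f y - g y).
Proof. by move=> cf cg y; apply: continuousB; [exact: cf|exact: cg]. Qed.
Lemma ctsN f : continuous f -> continuous (fun y => - f y).
Proof. by move=> cf y; apply: continuousN; exact: cf. Qed.
Lemma ctsM f g : continuous f -> continuous g -> continuous (fun y => f y * g y).
Proof. by move=> cf cg y; apply: continuousM; [exact: cf|exact: cg]. Qed.
Lemma ctsV f : (forall y, f y != 0) -> continuous f -> continuous (fun y => (f y)^-1).
Proof. by move=> f0 cf y; apply: continuousV => //; exact: cf. Qed.
Lemma cts_max f g : continuous f -> continuous g -> continuous (fun y => Num.max (f y) (g y)).
Proof. by move=> cf cg y; apply: (@continuous_max R Y f g); [exact: cf|exact: cg]. Qed.
Lemma cts_min f g : continuous f -> continuous g -> continuous (fun y => Num.min (f y) (g y)).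
Proof. by move=> cf cg y; apply: (@continuous_min R Y f g); [exact: cf|exact: cg]. Qed.
Lemma cts_cst (c : R) : continuous (fun _ : Y => c).
Proof. exact: cst_continuous. Qed.
Lemma cts_crd n (h : Y -> simplex R n) i : continuous h -> continuous (fun y => crd (h y) i).
Proof.
move=> ch y; apply: (@continuous_comp _ _ _ h (fun t => crd t i)); first exact: ch.
exact: crd_continuous.
Qed.
End Continuity.

(** A name that hides the quantifier of [continuous], so that [cts_step] can match on the shape of
    the function. *)
Definition is_cts (R : realType) Y (f : Y -> R) : Prop := continuous f.

Lemma is_ctsP (R : realType) Y (f : Y -> R) : is_cts f -> continuous f.
Proof. by []. Qed.

Ltac cts_leaf :=
  solve [assumption | move=> ?; exact: cvg_id | move=> ?; exact: cvg_fst
        | move=> ?; exact: cvg_snd | exact: crd_continuous | exact: cts_fun].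
Ltac cts_step := lazymatch goal with
  | |- is_cts (fun y => ((@?f y) - (@?g y))%R) => refine (@ctsB _ _ f g _ _); apply: is_ctsP
  | |- is_cts (fun y => ((@?f y) + (@?g y))%R) => refine (@ctsD _ _ f g _ _); apply: is_ctsP
  | |- is_cts (fun y => (- (@?f y))%R) => refine (@ctsN _ _ f _); apply: is_ctsP
  | |- is_cts (fun y => ((@?f y) * (@?g y))%R) => refine (@ctsM _ _ f g _ _); apply: is_ctsP
  | |- is_cts (fun y => Order.max (@?f y) (@?g y)) =>
      refine (@cts_max _ _ f g _ _); apply: is_ctsP
  | |- is_cts (fun y => Order.min (@?f y) (@?g y)) =>
      refine (@cts_min _ _ f g _ _); apply: is_ctsP
  | |- is_cts (fun y => \sum_(i | _) _) => refine (@continuous_sumr _ _ _ _ _ _) => ?; apply: is_ctsP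
  | |- is_cts (fun y => crd (@?h y) ?i) =>
      first [refine (@cts_crd _ _ _ h i _); cts_leaf | exact: cts_cst]
  | |- is_cts (fun y => _) => exact: cts_cst
  end.

Ltac cts := apply: is_ctsP; repeat (first [assumption | cts_step | cts_leaf]).

Section ClosedContinuity.
Variables X Y : topologicalType.

(* Continuity of the restriction of [f] to a closed set [S]. *)
Definition closed_cont (S : set X) (f : X -> Y) : Prop :=
  forall Z, closed Z -> closed (S `&` f @^-1` Z).

Lemma closed_cont_continuous (f : X -> Y) : closed_cont setT f -> continuous f.
Proof. by move=> h; apply/continuous_closedP => Z /h; rewrite setTI. Qed.

Lemma continuous_closed_cont (S : set X) (f : X -> Y) :
  closed S -> continuous f -> closed_cont S f.
Proof.
by move=> cS /continuous_closedP cf Z cZ; apply: closedI => //; exact: cf.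
Qed.

Lemma closed_contU (S T : set X) (f : X -> Y) :
  closed_cont S f -> closed_cont T f -> closed_cont (S `|` T) f.
Proof. by move=> hS hT Z cZ; rewrite setIUl; apply: closedU; [exact: hS|exact: hT]. Qed.

Lemma closed_cont_bigcup (I : finType) (S : I -> set X) (f : X -> Y) :
  (forall i, closed_cont (S i) f) -> closed_cont [set x | exists i, S i x] f.
Proof.
move=> h Z cZ.
rewrite (_ : _ `&` _ = \bigcup_(i in [set: I]) (S i `&` f @^-1` Z)).
  by apply: closed_bigcup => [|i _]; [exact: finite_finset|exact: h].
apply/seteqP; split=> [x [[i Sx] Zx]|x [i _ [Sx Zx]]]; first by exists i.
by split=> //; exists i.
Qed.

Lemma eq_closed_cont (S : set X) (f g : X -> Y) :
  (forall x, S x -> f x = g x) -> closed_cont S g -> closed_cont S f.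
Proof.
move=> e h Z cZ; rewrite (_ : _ `&` _ = S `&` g @^-1` Z); first exact: h.
by apply/seteqP; split=> x [Sx]; rewrite /preimage /= ?e// => zx; split=> //=; rewrite ?e.
Qed.

Lemma closed_cont_sub (S T : set X) (f : X -> Y) :
  closed T -> T `<=` S -> closed_cont S f -> closed_cont T f.
Proof.
move=> cT TS h Z cZ; rewrite (_ : _ `&` _ = T `&` (S `&` f @^-1` Z)).
  by apply: closedI => //; exact: h.
by apply/seteqP; split=> x; [case=> ? ?; split=> //; split=> //; exact: TS|case=> ? []].
Qed.

End ClosedContinuity.

Lemma closed_cont_comp (X Y Z : topologicalType) (S : set X) (T : set Y) (f : Y -> Z) (c : X -> Y) :
  closed S -> continuous c -> (forall x, S x -> T (c x)) ->
  closed_cont T f -> closed_cont S (f \o c).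
Proof.
move=> cS /continuous_closedP cc ST h; apply: (@closed_cont_sub _ _ (c @^-1` T)) => // W cW.
by rewrite comp_preimage -preimage_setI; apply: cc; exact: h.
Qed.

Section Interval.
Variable R : realType.

Definition clamp (s : R) : R := Num.max 0 (Num.min 1 s).

Lemma clamp_bounds s : 0 <= clamp s <= 1.
Proof. by rewrite /clamp le_max lexx /= ge_max ler01 ge_min lexx. Qed.

Lemma clamp_id s : 0 <= s <= 1 -> clamp s = s.
Proof. by move=> /andP[s0 s1]; rewrite /clamp min_r// max_r. Qed.

Lemma clamp0 : clamp 0 = 0.
Proof. by rewrite clamp_id// lexx ler01. Qed.

Lemma clamp1 : clamp 1 = 1.
Proof. by rewrite clamp_id// lexx ler01. Qed.

Lemma clamp_continuous Y (f : Y -> R) :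
  continuous f -> continuous (fun y => clamp (f y)).
Proof. by move=> cf; rewrite /clamp; cts. Qed.

(** Clamping makes the parametrisation of the 1-simplex total and continuous on the whole line, so
    that arithmetic on parameters needs no subtype. *)
Definition interval_point (s : R) : simplex R 1 :=
  to_simplex (fun i => if i == ord0 then 1 - clamp s else clamp s).

Lemma crd_interval_point s i :
  crd (interval_point s) i = if i == ord0 then 1 - clamp s else clamp s.
Proof.
have /andP[c0 c1] := clamp_bounds s.
rewrite crd_to_simplex// => [j|]; first by case: ifP; rewrite ?subr_ge0.
by rewrite !big_ord_recl big_ord0 /=; ring.
Qed.

Lemma interval_point_continuous Y (f : Y -> R) :
  continuous f -> continuous (fun y => interval_point (f y)).
Proof.
move=> cf; apply: simplex_continuous => i.
under eq_fun do rewrite crd_interval_point.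
by case: eqP => _; have := clamp_continuous cf => cl; cts.
Qed.

Lemma interval_point0 : interval_point 0 = v0 R.
Proof.
apply: simplex_eq => i; rewrite crd_interval_point crd_vertex clamp0 subr0.
by case: (i =P ord0) => [->|/eqP]; rewrite ?eqxx// eq_sym => /negbTE ->.
Qed.

Lemma interval_pointK (t : simplex R 1) : interval_point (crd t ord_max) = t.
Proof.
apply: simplex_eq => i; rewrite crd_interval_point clamp_id ?crd_ge0 ?crd_le1//.
case: eqP => [->|i0]; first by rewrite simplex1_crd.
by have [e|->] := ord2P i.
Qed.

Lemma interval_point1 : interval_point 1 = v1 R.
Proof. by rewrite -[RHS]interval_pointK crd_vertex eqxx. Qed.

Lemma segment_interval X (s : singular R 1 X) (a b : R) t :
  0 <= a <= 1 -> 0 <= b <= 1 ->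
  segment s (interval_point a) (interval_point b) t =
  s (interval_point (a + crd t ord_max * (b - a))).
Proof.
move=> ha hb; rewrite /segment /cts_comp /=; congr (s _).
apply: simplex_eq => i; rewrite crd_affine_pair !crd_interval_point !clamp_id//; last first.
  move: (crd_ge0 t ord_max) (crd_le1 t ord_max) ha hb => t0 t1 /andP[a0 a1] /andP[b0 b1].
  by nra.
by case: eqP => _; ring.
Qed.

End Interval.

Section Squares.
Variable R : realType.

Lemma crd_face_lift n (i : 'I_n.+2) (t : simplex R n) j :
  crd (simplex_map R (lift i) t) (lift i j) = crd t j.
Proof.
rewrite crd_simplex_map (bigD1 j)//= big1 ?addr0// => k /andP[/eqP/lift_inj -> /eqP].
by [].
Qed.

Lemma crd_face0 n (i : 'I_n.+2) (t : simplex R n) :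
  crd (simplex_map R (lift i) t) i = 0.
Proof.
by rewrite crd_simplex_map big1// => k /eqP h; have := neq_lift i k; rewrite h eqxx.
Qed.

Section SegmentsInSquare.
Variables (X : topologicalType) (n m : nat).
Variable H : continuousType (simplex R n * simplex R m)%type X.
Implicit Types p q r : (simplex R n * simplex R m)%type.

Definition segment2 p q : singular R 1 X :=
  cts_comp H (cts_pair (affine (pair_fun p.1 q.1)) (affine (pair_fun p.2 q.2))).
Definition triangle2 p q r : singular R 2 X :=
  cts_comp H (cts_pair (affine (triple_fun p.1 q.1 r.1)) (affine (triple_fun p.2 q.2 r.2))).

Lemma affine_face2 k (p q r : simplex R k) (i : 'I_3) t :
  affine (triple_fun p q r) (simplex_map R (lift i) t) =
  affine (triple_fun p q r \o lift i) t.
Proof. by rewrite -affine_map. Qed.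

Lemma face_triangle2_aux p q r a b i :
  triple_fun p.1 q.1 r.1 \o lift i = pair_fun a.1 b.1 ->
  triple_fun p.2 q.2 r.2 \o lift i = pair_fun a.2 b.2 ->
  face i (triangle2 p q r) = segment2 a b.
Proof.
move=> e1 e2; apply: cts_eq => t; rewrite /face /triangle2 /segment2 /cts_comp /=.
congr (H (_, _)).
  by rewrite -[LHS]/(affine _ (simplex_map R (lift i) t)) affine_face2 e1.
by rewrite -[LHS]/(affine _ (simplex_map R (lift i) t)) affine_face2 e2.
Qed.

Variables (G : zmodType) (phi : cochain R X G 1).
Hypothesis hphi : phi \in @cocycle R X G 1.

Lemma cocycle_triangle2 p q r :
  phi (segment2 p r) = phi (segment2 p q) + phi (segment2 q r).
Proof.
rewrite -(@face_triangle2_aux p q r q r ord0); last 2 first.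
- by apply/funext => -[[|[|//]] h].
- by apply/funext => -[[|[|//]] h].
rewrite -(@face_triangle2_aux p q r p q ord_max); last 2 first.
- by apply/funext => -[[|[|//]] h].
- by apply/funext => -[[|[|//]] h].
rewrite -(cocycle1 hphi); congr phi; apply/esym/face_triangle2_aux;
  by apply/funext => -[[|[|//]] h].
Qed.

End SegmentsInSquare.

Section Contraction.
Variables (X : topologicalType) (G : zmodType) (phi : cochain R X G 1).
Hypothesis hphi : phi \in @cocycle R X G 1.

(** Both ways around the square have the value of its diagonal, and the side over [v0] is a constant
    path, on which a cocycle vanishes. *)
Lemma cocycle_contract (H : continuousType (simplex R 1 * simplex R 1)%type X) (x : X) :
  (forall t, H (v0 R, t) = x) ->
  phi (segment2 H (v0 R, v1 R) (v1 R, v1 R)) =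
  phi (segment2 H (v0 R, v0 R) (v1 R, v0 R)) + phi (segment2 H (v1 R, v0 R) (v1 R, v1 R)).
Proof.
move=> hx; rewrite -(cocycle_triangle2 H hphi) (cocycle_triangle2 H hphi (v0 R, v0 R) (v0 R, v1 R) (v1 R, v1 R)).
rewrite [X in _ = X + _](_ : _ = 0) ?add0r//.
apply: (cocycle_cst hphi (x := x)) => t.
rewrite -[RHS](hx (affine (pair_fun (v0 R) (v1 R)) t)).
apply: (congr1 (fun u => H (u, _))).
exact: affine_const.
Qed.

Lemma cone_continuous n (p : simplex R n) (c : singular R 1 (simplex R n)) :
  continuous (fun y : simplex R 1 * simplex R 1 => affine_fun (pair_fun p (c y.2)) y.1).
Proof.
apply: simplex_continuous => j; under eq_fun do rewrite crd_affine.
have c2 : continuous (fun y : simplex R 1 * simplex R 1 => c y.2).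
  by move=> y; apply: (@continuous_comp _ _ _ snd c); [exact: cvg_snd|exact: cts_fun].
apply: continuous_sumr => i; rewrite /pair_fun; case: eqP => _; cts.
Qed.

(** The cone from [p] over the path [c] is a square with one side collapsed. *)
Lemma cocycle_convex n (g : continuousType (simplex R n) X) (p : simplex R n)
    (c : singular R 1 (simplex R n)) :
  phi (segment g p (c (v1 R))) =
  phi (segment g p (c (v0 R))) + phi (cts_comp g c).
Proof.
pose H : continuousType _ _ := cts_comp g (mkcts (@cone_continuous n p c)).
have := @cocycle_contract H (g p) _.
have e1 q : segment2 H (v0 R, q) (v1 R, q) = segment g p (c q).
  apply: cts_eq => t; rewrite -[LHS]/(g (affine (pair_fun p (c (affine (pair_fun q q) t)))
    (affine (pair_fun (v0 R) (v1 R)) t))).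
  by rewrite affine_const affine_v01.
have e2 : segment2 H (v1 R, v0 R) (v1 R, v1 R) = cts_comp g c.
  apply: cts_eq => t; rewrite -[LHS]/(g (affine (pair_fun p
    (c (affine (pair_fun (v0 R) (v1 R)) t))) (affine (pair_fun (v1 R) (v1 R)) t))).
  by rewrite affine_const affine_v01; apply: (congr1 g); exact: affine_at_vertex.
rewrite !e1 e2; apply => t; rewrite /H /cts_comp /=; congr (g _).
exact: affine_at_vertex.
Qed.

End Contraction.

(** The composite path is the third edge of a singular triangle whose other two edges are [s] and
    [t]; additivity is then the cocycle condition, and no reparametrisation has to be discussed. *)
Lemma concat_paths X (s t : singular R 1 X) : s (v1 R) = t (v0 R) ->
  exists r : singular R 1 X, [/\ r (v0 R) = s (v0 R), r (v1 R) = t (v1 R) &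
    forall G (phi : cochain R X G 1), phi \in @cocycle R X G 1 ->
      phi r = phi s + phi t].
Proof.
move=> st.
(* The triangle is projected onto its two edges through the middle vertex: [a] runs from 1 to 0
   along the first and from 0 to -1 along the second. *)
pose a (x : simplex R 2) := crd x ord0 - crd x ord_max.
have ca : continuous a by rewrite /a; cts.
pose T x := if 0 <= a x then s (interval_point (1 - a x)) else t (interval_point (- a x)).
have clampT x : a x = 0 -> s (interval_point (1 - a x)) = t (interval_point (- a x)).
  by move=> ->; rewrite subr0 oppr0 interval_point1 interval_point0.
have cT : continuous T.
  apply: closed_cont_continuous.
  rewrite (_ : setT = [set x | 0 <= a x] `|` [set x | a x <= 0]); last first.
    by apply/esym/seteqP; split=> // x _ /=; case: (leP 0 (a x)) => [|/ltW]; [left|right].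
  apply: closed_contU.
    apply: (@eq_closed_cont _ _ _ _ (fun x => s (interval_point (1 - a x)))).
      by move=> x /= h; rewrite /T h.
    apply: continuous_closed_cont.
      by apply: (@preimage_closed _ _ a [set y | 0 <= y]); [move=> x _; exact: ca|exact: closed_ge].
    move=> x; apply: (@continuous_comp _ _ _ (fun x => interval_point (1 - a x)) s).
      by apply: interval_point_continuous; cts.
    exact: cts_fun.
  apply: (@eq_closed_cont _ _ _ _ (fun x => t (interval_point (- a x)))).
    move=> x /= h; rewrite /T; case: ifP => // h'; apply: clampT.
    by apply/eqP; rewrite eq_le h h'.
  apply: continuous_closed_cont.
    by apply: (@preimage_closed _ _ a [set y | y <= 0]); [move=> x _; exact: ca|exact: closed_le].
  move=> x; apply: (@continuous_comp _ _ _ (fun x => interval_point (- a x)) t).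
    by apply: interval_point_continuous; cts.
  exact: cts_fun.
pose T' : singular R 2 X := mkcts cT.
have f2 : face ord_max T' = s.
  apply: cts_eq => x; rewrite /face /cts_comp -[LHS]/(T (simplex_map R (lift ord_max) x)) /T.
  have -> : a (simplex_map R (lift ord_max) x) = crd x ord0.
    rewrite /a crd_face0 subr0 -(crd_face_lift ord_max x ord0); congr crd.
    exact: val_inj.
  by rewrite crd_ge0 simplex1_crd opprB addrC subrK interval_pointK.
have f0 : face ord0 T' = t.
  apply: cts_eq => x; rewrite /face /cts_comp -[LHS]/(T (simplex_map R (lift ord0) x)) /T.
  have e : a (simplex_map R (lift ord0) x) = - crd x ord_max.
    rewrite /a crd_face0 sub0r -(crd_face_lift ord0 x ord_max); congr (- crd _ _).
    exact: val_inj.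
  case: ifP => h; last by rewrite e opprK interval_pointK.
  rewrite clampT ?e ?opprK ?interval_pointK//.
  by apply/eqP; rewrite eq_le oppr_le0 crd_ge0 /= -e h.
exists (face (lift ord0 ord0) T'); split.
- rewrite -[LHS]/(T' (simplex_map R _ (vertex R _))) simplex_map_vertex.
  rewrite -f2 -[RHS]/(T' (simplex_map R _ (vertex R _))) simplex_map_vertex.
  by congr (T' (vertex R _)); exact: val_inj.
- rewrite -[LHS]/(T' (simplex_map R _ (vertex R _))) simplex_map_vertex.
  rewrite -f0 -[RHS]/(T' (simplex_map R _ (vertex R _))) simplex_map_vertex.
  by congr (T' (vertex R _)); exact: val_inj.
by move=> G phi hphi; rewrite (cocycle1 hphi) f2 f0.
Qed.

Lemma face10 X (s : singular R 1 X) :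
  face ord0 s = (cst (s (v1 R)) : singular R 0 X).
Proof.
apply: cts_eq => t; rewrite (simplex0_eq t (vertex R ord0)).
rewrite -[LHS]/(s (simplex_map R _ (vertex R _))) simplex_map_vertex /cst.
by congr (s (vertex R _)); exact: val_inj.
Qed.

Lemma face11 X (s : singular R 1 X) :
  face ord_max s = (cst (s (v0 R)) : singular R 0 X).
Proof.
apply: cts_eq => t; rewrite (simplex0_eq t (vertex R ord0)).
rewrite -[LHS]/(s (simplex_map R _ (vertex R _))) simplex_map_vertex /cst.
by congr (s (vertex R _)); exact: val_inj.
Qed.

Lemma boundary1U X (s : singular R 1 X) :
  boundary (gen s) =
  (gen (cst (s (v1 R)) : singular R 0 X))
  - (gen (cst (s (v0 R)) : singular R 0 X)).
Proof.
rewrite boundaryU !big_ord_recl big_ord0 addr0 mulr1z expr1 mulrN1z.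
by rewrite ord2_lift face10 face11.
Qed.

Lemma cobounding1P X G (phi : cochain R X G 1) :
  (exists chi : X -> G, forall s : singular R 1 X, phi s = chi (s (v1 R)) - chi (s (v0 R))) <->
  phi \in @cobounding R X G 1.
Proof.
split=> [[chi h]|/asboolP[psi h]].
  apply/asboolP; exists (fun s : singular R 0 X => chi (s (vertex R ord0))) => c.
  elim/chain_ind: c => [|s|c d IH IH'].
  - by rewrite !raddf0.
  - by rewrite evaluateU boundary1U evaluate_chainB !evaluateU h.
  - by rewrite (raddfB (@boundary R X 1)) !evaluate_chainB IH IH'.
exists (fun x => psi (cst x : singular R 0 X)) => s.
have := h (gen s).
by rewrite evaluateU boundary1U evaluate_chainB !evaluateU.
Qed.

Lemma cycle_loop X (s : singular R 1 X) : s (v0 R) = s (v1 R) ->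
  (gen s) \in @Defs.cycle R X 1.
Proof. by move=> e; apply/eqP; rewrite boundary1U e subrr. Qed.

Lemma pairing_hurewicz X G (a : cohomology R X G 1)
    (s : singular R 1 X) : s (v0 R) = s (v1 R) ->
  pairing a (hurewicz1 s) = sq_repr a s.
Proof. by move=> e; rewrite /hurewicz1 pairing_classr ?evaluateU// cycle_loop. Qed.

Definition joinable X :=
  forall x y : X, exists s : singular R 1 X, s (v0 R) = x /\ s (v1 R) = y.

Lemma path_connected_joinable X : path_connected R X -> joinable X.
Proof.
move=> pX x y; have [p hp] := pX x y.
have crd01 (t : simplex R 1) : crd t ord_max \in [set s : R | 0 <= s <= 1].
  by apply/mem_set; rewrite /= crd_ge0 crd_le1.
pose i (t : simplex R 1) : unit_interval R :=
    exist (fun s => s \in [set s : R | 0 <= s <= 1]) _ (crd01 t).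
have ci : continuous i.
  by apply: continuous_comp_initial => t; exact: crd_continuous.
exists (cts_comp p (mkcts ci)); split.
  by apply: (hp (i (v0 R))).1; rewrite /i /= crd_vertex.
by apply: (hp (i (v1 R))).2; rewrite /i /= crd_vertex eqxx.
Qed.

Lemma loop_through X (x0 : X) (gam : X -> singular R 1 X) :
  (forall x, gam x (v0 R) = x0 /\ gam x (v1 R) = x) ->
  forall s : singular R 1 X, exists l : singular R 1 X,
    [/\ l (v0 R) = x0, l (v1 R) = x0 &
      forall G (phi : cochain R X G 1), phi \in @cocycle R X G 1 ->
        phi l = phi (gam (s (v0 R))) + phi s - phi (gam (s (v1 R)))].
Proof.
move=> hg s.
have [r [r0 r1 hr]] := concat_paths (hg (s (v0 R))).2.
pose b := segment (gam (s (v1 R))) (v1 R) (v0 R).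
have rb : r (v1 R) = b (v0 R) by rewrite r1 segment_start (hg _).2.
have [l [l0 l1 hl]] := concat_paths rb.
exists l; split.
- by rewrite l0 r0 (hg _).1.
- by rewrite l1 segment_end (hg _).1.
by move=> G phi hphi; rewrite hl// hr// (cocycle_rev hphi) segment_id.
Qed.

(** The potential at a point is the value of [phi] on a chosen path from [x0]; closing a simplex up
    with two such paths gives a loop. *)
Lemma cocycle_vanish_loops X (x0 : X) G
    (phi : cochain R X G 1) : joinable X -> phi \in @cocycle R X G 1 ->
  (forall s : singular R 1 X, s (v0 R) = x0 -> s (v1 R) = x0 -> phi s = 0) ->
  phi \in @cobounding R X G 1.
Proof.
move=> jX hphi h; apply/cobounding1P.
have [gam hg] := choice (jX x0).
exists (fun x => phi (gam x)) => s.
have [l [l0 l1 hl]] := loop_through hg s.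
have := h l l0 l1; rewrite hl// => /eqP; rewrite subr_eq0 => /eqP <-.
by rewrite addrC addKr.
Qed.

End Squares.

Section Subdivision.
Variables (R : realType) (X : topologicalType).

Definition subsegment (s : singular R 1 X) (N k : nat) : singular R 1 X :=
  segment s (interval_point (k%:R / N.+1%:R)) (interval_point (k.+1%:R / N.+1%:R)).

Lemma frac_bounds N k : (k <= N.+1)%N -> 0 <= (k%:R / N.+1%:R : R) <= 1.
Proof.
by move=> kN; rewrite divr_ge0//= ler_pdivrMr ?ltr0n// mul1r ler_nat.
Qed.

Lemma cocycle_subdivision G (phi : cochain R X G 1) (s : singular R 1 X) N :
  phi \in @cocycle R X G 1 -> phi s = \sum_(k < N.+1) phi (subsegment s N k).
Proof.
move=> hphi.
have h m : (m <= N.+1)%N -> \sum_(k < m) phi (subsegment s N k) =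
    phi (segment s (interval_point 0) (interval_point (m%:R / N.+1%:R))).
  elim: m => [|m IH] mN; first by rewrite big_ord0 mul0r cocycle_point.
  by rewrite big_ord_recr /= IH 1?ltnW// -(cocycle_triangle hphi).
rewrite h// divff ?pnatr_eq0// interval_point0 interval_point1 segment_id.
by [].
Qed.

(** The Lebesgue number lemma, read off the near-covering form of compactness of [[0, 1]] along [N]
    tending to infinity. *)
Lemma fine_subdivision (s : singular R 1 X) (U : X -> set X) :
  (forall x, nbhs x (U x)) ->
  exists N, forall k : 'I_N.+1, exists x, forall t, U x (subsegment s N k t).
Proof.
move=> hU.
pose f (u : R) := s (interval_point u).
have cf : continuous f.
  move=> u; apply: (@continuous_comp _ _ _ (fun u => interval_point u) s); last exact: cts_fun.
  by apply: (@interval_point_continuous R R (fun u => u)) => v; exact: cvg_id.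
have /compact_near_coveringP/(_ nat \oo
  (fun N u => exists x, forall w, `|w - u| <= N.+1%:R^-1 -> U x (f w)) _) :=
    @segment_compact R 0 1.
move=> /(_ _)[|N _ hN].
  move=> u _; have /cf : nbhs (f u) (U (f u)) by exact: hU.
  move=> /nbhs_ballP[/= e e0 he].
  (* Half of [e] is for the distance of the starting point from [u], half for the length of a
     piece. *)
  have e20 : 0 < e / 2 by rewrite divr_gt0.
  exists ([set w | `|u - w| < e / 2], [set N | N.+1%:R^-1 < e / 2]); first split => /=.
  - by apply/nbhs_ballP; exists (e / 2) => //= w; rewrite /ball /=.
  - exact: (near_infty_natSinv_lt (PosNum e20)).
  move=> [w N] /= [hw hNn]; exists (f u) => v hv; apply: he.
  rewrite /ball /= (le_lt_trans (ler_distD w _ _))//.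
  rewrite (splitr e) ltrD// distrC; exact: le_lt_trans hv hNn.
exists N => k.
have /andP[k0 k1] := frac_bounds (ltnW (ltn_ord k)).
have [x hx] := hN N (leqnn N) (k%:R / N.+1%:R) (ltac:(by rewrite /= in_itv /= k0 k1)).
exists x => t; rewrite /subsegment segment_interval; last 2 first.
- by apply: frac_bounds; apply: ltnW.
- by apply: frac_bounds.
apply: hx; rewrite addrC addKr -mulrBl -natr1 addrC addKr mul1r normrM.
rewrite ger0_norm ?crd_ge0// ger0_norm ?invr_ge0//.
by rewrite ler_piMl ?invr_ge0// crd_le1.
Qed.

Lemma cocycle_small_vanish G (phi : cochain R X G 1) (U : X -> set X) :
  phi \in @cocycle R X G 1 -> (forall x, nbhs x (U x)) ->
  (forall x (s : singular R 1 X), (forall t, U x (s t)) -> phi s = 0) ->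
  forall s, phi s = 0.
Proof.
move=> hphi hU h s; have [N hN] := fine_subdivision s hU.
rewrite (cocycle_subdivision s N hphi) big1// => k _.
by have [x hx] := hN k; exact: h hx.
Qed.

End Subdivision.

(** * Filling spheres *)

Section SphereGeometry.
Variable R : realType.

Lemma divr_natK n (c : R) : (c / n.+1%:R) *+ n.+1 = c.
Proof. by rewrite -[LHS]mulr_natr mulfVK ?pnatr_eq0. Qed.

Definition min_crd n (t : simplex R n) : R := \big[Num.min/1]_i crd t i.

Lemma min_crd_le n (t : simplex R n) i : min_crd t <= crd t i.
Proof. by rewrite /min_crd (bigD1 i)//= ge_min lexx. Qed.

Lemma min_crd_attained n (t : simplex R n) : exists i, crd t i = min_crd t.
Proof.
have : min_crd t = 1 \/ exists i, crd t i = min_crd t.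
  rewrite /min_crd; elim/big_rec: _ => [|i x _ [->|[j <-]]]; first by left.
    by right; exists i; rewrite min_l ?crd_le1.
  by right; case: (leP (crd t i) (crd t j)) => _; [exists i|exists j].
case=> // m1; exists ord0; apply/eqP; rewrite eq_le min_crd_le andbT m1.
exact: crd_le1.
Qed.

Lemma min_crd_ge0 n (t : simplex R n) : 0 <= min_crd t.
Proof. by have [i <-] := min_crd_attained t; exact: crd_ge0. Qed.

Lemma min_crd_sum n (t : simplex R n) : n.+1%:R * min_crd t <= 1.
Proof.
rewrite -[leRHS](crd_sum t) mulr_natl -[X in _ *+ X]card_ord -sumr_const.
by apply: ler_sum => i _; exact: min_crd_le.
Qed.

Lemma sum_crd_min n (t : simplex R n) :
  \sum_i (crd t i - min_crd t) = 1 - n.+1%:R * min_crd t.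
Proof. by rewrite sumrB crd_sum sumr_const card_ord mulr_natl. Qed.

Lemma min_crd_eq0 n (t : simplex R n) i : crd t i = 0 -> min_crd t = 0.
Proof.
by move=> ti; apply/eqP; rewrite eq_le min_crd_ge0 andbT -ti min_crd_le.
Qed.

Lemma min_crd_continuous n : continuous (@min_crd n).
Proof.
rewrite /min_crd => t.
elim: (index_enum _) => [|i l IH].
  by under [X in continuous_at _ X]eq_fun do rewrite big_nil; exact: cst_continuous.
under [X in continuous_at _ X]eq_fun do rewrite big_cons.
apply: (@continuous_min R _ (fun t => crd t i)); last exact: IH.
exact: crd_continuous.
Qed.

Lemma cts_min_crd Y n (h : Y -> simplex R n) :
  continuous h -> continuous (fun y => min_crd (h y)).
Proof.
move=> ch y; apply: (@continuous_comp _ _ _ h (@min_crd n)); first exact: ch.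
exact: min_crd_continuous.
Qed.

(** A left inverse of the face inclusion. Spreading coordinate [i] evenly over the others makes it
    continuous on the whole simplex; only its values on the face matter in the gluing. *)
Definition drop_crd n (i : 'I_n.+2) (t : simplex R n.+1) : simplex R n :=
  to_simplex (fun j => crd t (lift i j) + crd t i / n.+1%:R).

Lemma crd_drop n (i : 'I_n.+2) t j :
  crd (drop_crd i t) j = crd t (lift i j) + crd t i / n.+1%:R.
Proof.
rewrite crd_to_simplex// => [k|]; first by rewrite addr_ge0 ?divr_ge0 ?crd_ge0.
rewrite big_split /= sumr_const card_ord divr_natK.
by rewrite -[RHS](crd_sum t) (bigD1_ord i) //= addrC.
Qed.

Lemma crd_drop0 n (i : 'I_n.+2) t j : crd t i = 0 ->
  crd (drop_crd i t) j = crd t (lift i j).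
Proof. by move=> ti; rewrite crd_drop ti mul0r addr0. Qed.

Lemma drop_face n (i : 'I_n.+2) t : drop_crd i (simplex_map R (lift i) t) = t.
Proof. by apply: simplex_eq => j; rewrite crd_drop0 ?crd_face0// crd_face_lift. Qed.

Lemma face_drop n (i : 'I_n.+2) t : crd t i = 0 ->
  simplex_map R (lift i) (drop_crd i t) = t.
Proof.
move=> ti; apply: simplex_eq => j; case: (unliftP i j) => [k ->|->].
  by rewrite crd_face_lift crd_drop0.
by rewrite crd_face0.
Qed.

Lemma drop_crd_continuous n (i : 'I_n.+2) : continuous (@drop_crd n i).
Proof.
apply: simplex_continuous => j; under eq_fun do rewrite crd_drop.
by cts.
Qed.

(** The gauge of the simplex around its barycentre: 0 there and 1 on the boundary. *)
Definition simplex_radius n (t : simplex R n) : R := 1 - n.+1%:R * min_crd t.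

Lemma radius_ge0 n (t : simplex R n) : 0 <= simplex_radius t.
Proof. by rewrite subr_ge0 min_crd_sum. Qed.

Lemma max_half_gt0 (r : R) : 0 < Num.max r (1/2).
Proof. by rewrite lt_max divr_gt0 ?orbT. Qed.

(* The radial expansion from the barycentre by the factor [1 / r] if the radius
   [r] is at least [1/2], and by the factor 2 otherwise. *)
Definition spread n (t : simplex R n) : simplex R n :=
  to_simplex (fun i => (crd t i - min_crd t) / Num.max (simplex_radius t) (1/2)
    + (1 - Num.min 1 (2 * simplex_radius t)) / n.+1%:R).

Lemma crd_spread n (t : simplex R n) i :
  crd (spread t) i = (crd t i - min_crd t) / Num.max (simplex_radius t) (1/2)
    + (1 - Num.min 1 (2 * simplex_radius t)) / n.+1%:R.
Proof.
rewrite crd_to_simplex// => [j|].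
  rewrite addr_ge0// divr_ge0 ?subr_ge0 ?min_crd_le ?(ltW (max_half_gt0 _))//.
  by rewrite ge_min lexx.
rewrite big_split /= -mulr_suml sum_crd_min -/(simplex_radius t) sumr_const card_ord.
rewrite divr_natK.
case: (leP (simplex_radius t) (1/2)) => h.
  rewrite min_r; last lra.
  by field.
rewrite min_l; last lra.
rewrite divff ?subrr ?addr0//; lra.
Qed.

Lemma spread_continuous n : continuous (@spread n).
Proof.
have cm := @min_crd_continuous n.
have cr : continuous (@simplex_radius n) by rewrite /simplex_radius; cts.
have cv : continuous (fun t : simplex R n => (Num.max (simplex_radius t) (1/2))^-1).
  by apply: ctsV => [t|]; [rewrite gt_eqF// max_half_gt0|cts].
apply: simplex_continuous => j; under eq_fun do rewrite crd_spread.
by cts.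
Qed.

Lemma spread_id n (t : simplex R n) : min_crd t = 0 -> spread t = t.
Proof.
move=> t0; apply: simplex_eq => i; rewrite crd_spread /simplex_radius t0 mulr0 !subr0.
by rewrite max_l ?min_l; [rewrite divr1 subrr mul0r addr0|lra..].
Qed.

Lemma spread_boundary n (t : simplex R n) : 1/2 <= simplex_radius t ->
  exists i, crd (spread t) i = 0.
Proof.
move=> h; have [i ti] := min_crd_attained t; exists i.
by rewrite crd_spread ti subrr mul0r add0r min_l ?subrr ?mul0r//; lra.
Qed.

Section Collars.
Variables (n : nat) (v : 'I_n.+2).

(** The straight contraction to [v]. It preserves every face through [v], hence the part of the
    boundary sphere made of these faces. *)
Definition star_collar (s : R) (t : simplex R n.+1) : simplex R n.+1 :=
  affine (pair_fun t (vertex R v)) (interval_point s).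

Lemma crd_star_collar s t i :
  crd (star_collar s t) i = (1 - clamp s) * crd t i + clamp s * (v == i)%:R.
Proof.
by rewrite crd_affine_pair crd_interval_point crd_vertex.
Qed.

(** A latitude on the deformed face: 1 at the barycentre and [- clamp s] on the boundary. Points of
    nonnegative height stay in the face opposite to [v], the others are placed on the faces through
    [v]. *)
Definition face_height (s : R) (x : simplex R n) : R :=
  - clamp s + (1 + clamp s) * (n.+1%:R * min_crd x).

Definition face_scale (s : R) (x : simplex R n) : R :=
  Num.min (1 + clamp s) ((1 + face_height s x) / Num.max (simplex_radius x) (1/2)).

Lemma face_height_bounds s x : -1 <= face_height s x <= 1.
Proof.
have /andP[c0 c1] := clamp_bounds s.
have m0 : 0 <= n.+1%:R * min_crd x by rewrite mulr_ge0// min_crd_ge0.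
have m1 := min_crd_sum x; rewrite /face_height.
by apply/andP; split; nra.
Qed.

Lemma face_scale_ge0 s x : 0 <= face_scale s x.
Proof.
have /andP[c0 c1] := clamp_bounds s; have /andP[h0 h1] := face_height_bounds s x.
rewrite /face_scale le_min addr_ge0//= divr_ge0//; first lra.
exact: ltW (max_half_gt0 _).
Qed.

(** This identity makes the coordinates of [face_collar] add up to 1. Below height 0, [1 < 1 -
    face_height s x = (1 + clamp s) * simplex_radius x] and [clamp s <= 1] force a radius above
    [1/2]; hence the cutoff at [1/2], which only prevents a division by zero at the barycentre. *)
Lemma face_scale_radius s x :
  face_scale s x * simplex_radius x = 1 - `|face_height s x|.
Proof.
have /andP[c0 c1] := clamp_bounds s; have /andP[h0 h1] := face_height_bounds s x.
have r0 := radius_ge0 x.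
have eh : 1 - face_height s x = (1 + clamp s) * simplex_radius x.
  by rewrite /face_height /simplex_radius; ring.
rewrite /face_scale; case: (leP 0 (face_height s x)) => hh.
  rewrite (ger0_norm hh) min_l ?eh// ler_pdivlMr ?max_half_gt0//.
  by case: (leP (simplex_radius x) (1/2)) => hr; nra.
have hr : 1/2 < simplex_radius x by nra.
rewrite (ltr0_norm hh) max_l ?(ltW hr)// min_r.
  by rewrite divfK ?opprK//; lra.
by rewrite ler_pdivrMr; [lra|lra].
Qed.

Definition face_coord (s : R) (x : simplex R n) (j : 'I_n.+2) : R :=
  if unlift v j is Some i
  then face_scale s x * (crd x i - min_crd x) + Num.max (face_height s x) 0 / n.+1%:R
  else Num.max (- face_height s x) 0.

(* With the face opposite to [v] in polar coordinates around its barycentre, the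
   homotopy stretches it, from the identity at [s = 0], until at [s = 1] it
   wraps around the whole boundary, with its own boundary at the vertex [v]. *)
Definition face_collar (s : R) (x : simplex R n) : simplex R n.+1 :=
  to_simplex (face_coord s x).

Let face_collar_good s x (f := face_coord s x) :
  (forall j, 0 <= f j) /\ \sum_j f j = 1.
Proof.
split=> [j|].
  rewrite /f /face_coord; case: unlift => [i|]; last by rewrite le_max lexx orbT.
  rewrite addr_ge0 ?divr_ge0 ?le_max ?lexx ?orbT//.
  by rewrite mulr_ge0 ?face_scale_ge0// subr_ge0 min_crd_le.
rewrite (bigD1_ord v) //= {1}/f /face_coord unlift_none.
under eq_bigr do rewrite /f /face_coord liftK.
rewrite big_split /= -mulr_sumr sum_crd_min -/(simplex_radius x) face_scale_radius.
rewrite sumr_const card_ord divr_natK.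
case: (leP 0 (face_height s x)) => hh.
  by rewrite (ger0_norm hh) ?(max_l hh) max_r ?oppr_le0//; lra.
by rewrite (ltr0_norm hh) ?(max_r (ltW hh)) max_l ?oppr_ge0 ?(ltW hh)//; lra.
Qed.

Lemma crd_face_collar_lift s x i : crd (face_collar s x) (lift v i) =
  face_scale s x * (crd x i - min_crd x) + Num.max (face_height s x) 0 / n.+1%:R.
Proof. by have [h0 h1] := face_collar_good s x; rewrite crd_to_simplex// /face_coord liftK. Qed.

Lemma crd_face_collar_v s x : crd (face_collar s x) v = Num.max (- face_height s x) 0.
Proof. by have [h0 h1] := face_collar_good s x; rewrite crd_to_simplex// /face_coord unlift_none. Qed.

Lemma face_collar_continuous Y (s : Y -> R) (x : Y -> simplex R n) :
  continuous s -> continuous x -> continuous (fun y => face_collar (s y) (x y)).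
Proof.
move=> cs cx.
have cc := clamp_continuous cs; have cm := cts_min_crd cx.
have ch : continuous (fun y => face_height (s y) (x y)) by rewrite /face_height; cts.
have cr : continuous (fun y => simplex_radius (x y)) by rewrite /simplex_radius; cts.
have cv : continuous (fun y => (Num.max (simplex_radius (x y)) (1/2))^-1).
  by apply: ctsV => [t|]; [rewrite gt_eqF// max_half_gt0|cts].
have ck : continuous (fun y => face_scale (s y) (x y)) by rewrite /face_scale; cts.
apply: simplex_continuous => j; case: (unliftP v j) => [i ->|->].
  by under eq_fun do rewrite crd_face_collar_lift; cts.
by under eq_fun do rewrite crd_face_collar_v; cts.
Qed.

Lemma star_collar_continuous Y (s : Y -> R) (x : Y -> simplex R n.+1) :
  continuous s -> continuous x -> continuous (fun y => star_collar (s y) (x y)).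
Proof.
move=> cs cx; have cc := clamp_continuous cs.
apply: simplex_continuous => j; under eq_fun do rewrite crd_star_collar.
by cts.
Qed.

Lemma face_collar_boundary s x : exists j, crd (face_collar s x) j = 0.
Proof.
case: (leP 0 (face_height s x)) => hh.
  by exists v; rewrite crd_face_collar_v max_r// oppr_le0.
have [i xi] := min_crd_attained x; exists (lift v i).
by rewrite crd_face_collar_lift xi subrr mulr0 add0r max_r ?mul0r// ltW.
Qed.

Lemma face_collar1_boundary x : min_crd x = 0 -> face_collar 1 x = vertex R v.
Proof.
move=> x0.
have h1 : face_height 1 x = -1 by rewrite /face_height clamp1 x0 !mulr0 addr0.
have k0 : face_scale 1 x = 0.
  by rewrite /face_scale h1 subrr mul0r min_r// clamp1; lra.
apply: simplex_eq => j; rewrite crd_vertex; case: (unliftP v j) => [i ->|->].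
  rewrite crd_face_collar_lift k0 mul0r add0r h1 (negbTE (neq_lift v i)).
  by rewrite max_r ?mul0r// lerN10.
by rewrite crd_face_collar_v h1 eqxx opprK max_l ?ler01.
Qed.

Lemma face_collar0 x : face_collar 0 x = simplex_map R (lift v) x.
Proof.
have m0 := min_crd_ge0 x; have m1 := min_crd_sum x.
have h0 : face_height 0 x = n.+1%:R * min_crd x.
  by rewrite /face_height clamp0 oppr0 add0r addr0 mul1r.
have hh : 0 <= face_height 0 x by rewrite h0 mulr_ge0.
have k1 : face_scale 0 x = 1.
  rewrite /face_scale clamp0 addr0 min_l// ler_pdivlMr ?max_half_gt0// [leLHS]mul1r.
  by rewrite ge_max /simplex_radius h0; apply/andP; split; nra.
apply: simplex_eq => j; case: (unliftP v j) => [i ->|->].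
  rewrite crd_face_collar_lift k1 mul1r max_l// h0 crd_face_lift.
  by rewrite [_ * min_crd x]mulrC mulfK ?subrK// pnatr_eq0.
by rewrite crd_face_collar_v crd_face0 max_r// oppr_le0.
Qed.

Lemma star_collar0 t : star_collar 0 t = t.
Proof.
apply: simplex_eq => i; rewrite crd_star_collar clamp0.
by rewrite subr0 mul1r mul0r addr0.
Qed.

Lemma star_collar1 t : star_collar 1 t = vertex R v.
Proof.
apply: simplex_eq => i; rewrite crd_star_collar clamp1.
by rewrite subrr mul0r add0r mul1r crd_vertex.
Qed.

(** The two collars agree on the common boundary of the face opposite to [v] and of the faces
    through [v], so they glue to a deformation of the whole sphere. *)
Lemma star_face_collar s t i : crd t v = 0 -> i != v -> crd t i = 0 ->
  star_collar s t = face_collar s (drop_crd v t).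
Proof.
move=> tv iv ti; have /andP[c0 c1] := clamp_bounds s.
move: (iv); rewrite eq_sym => /unlift_some[i' ei _].
have m0 : min_crd (drop_crd v t) = 0 by apply: (@min_crd_eq0 _ _ i'); rewrite crd_drop0// -ei.
have h0 : face_height s (drop_crd v t) = - clamp s.
  by rewrite /face_height m0 !mulr0 addr0.
have k0 : face_scale s (drop_crd v t) = 1 - clamp s.
  rewrite /face_scale h0 /simplex_radius m0 mulr0 subr0 max_l; last lra.
  by rewrite divr1 min_r//; lra.
apply: simplex_eq => j; rewrite crd_star_collar; case: (unliftP v j) => [k ->|->].
  rewrite crd_face_collar_lift k0 m0 subr0 h0 max_r ?oppr_le0// mul0r addr0.
  by rewrite crd_drop0// (negbTE (neq_lift v k)) mulr0 addr0.
by rewrite crd_face_collar_v h0 opprK eqxx tv mulr0 add0r mulr1 max_l.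
Qed.

End Collars.
End SphereGeometry.

Section Filling.
Variable R : realType.
Variables (K : topologicalType) (pt : K) (n : nat).
Variable s : 'I_n.+2 -> singular R n K.
Hypothesis hs : forall (t : simplex R n.+1) i j, crd t i = 0 -> crd t j = 0 ->
  s i (drop_crd i t) = s j (drop_crd j t).

(** By [hs] the choice of a face that contains [t] is immaterial; the value [pt] is only taken in
    the interior. *)
Definition sphere_map (t : simplex R n.+1) : K :=
  if [pick i | crd t i == 0] is Some i then s i (drop_crd i t) else pt.

Lemma sphere_mapE t i : crd t i = 0 -> sphere_map t = s i (drop_crd i t).
Proof.
move=> ti; rewrite /sphere_map; case: pickP => [j /eqP tj|/(_ i)]; first exact: hs.
by rewrite ti eqxx.
Qed.

Lemma closed_crd0 (i : 'I_n.+2) : closed [set t : simplex R n.+1 | crd t i = 0].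
Proof.
apply: (@preimage_closed _ _ (fun t : simplex R n.+1 => crd t i) [set y | y = 0]).
  by move=> x _; exact: crd_continuous.
exact: closed_eq.
Qed.

Lemma sphere_map_closed_cont :
  closed_cont [set t | exists i, crd t i = 0] sphere_map.
Proof.
apply: closed_cont_bigcup => i.
apply: (@eq_closed_cont _ _ _ _ (fun t => s i (drop_crd i t))).
  by move=> t; exact: sphere_mapE.
apply: continuous_closed_cont; first exact: closed_crd0.
move=> t; apply: (@continuous_comp _ _ _ (drop_crd i) (s i)); first exact: drop_crd_continuous.
exact: cts_fun.
Qed.

Variable v : 'I_n.+2.
Hypothesis hv : sphere_map (vertex R v) = pt.

Lemma wrapped_continuous : continuous (fun x : simplex R n => sphere_map (face_collar v 1 x)).
Proof.
apply: closed_cont_continuous.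
apply: (@closed_cont_comp _ _ _ _ [set t | exists i, crd t i = 0]
   sphere_map (face_collar v 1)).
- exact: closedT.
- by apply: (@face_collar_continuous R n v _ (fun _ => 1) id) => [|x]; [exact: cst_continuous|exact: cvg_id].
- by move=> x _; exact: face_collar_boundary.
exact: sphere_map_closed_cont.
Qed.

(* The sphere, deformed so that all the faces through [v] go to the base point. *)
Definition wrapped_sphere : singular R n K := mkcts wrapped_continuous.

Lemma wrapped_spheroid : spheroid pt wrapped_sphere.
Proof.
move=> x [i xi]; rewrite -[LHS]/(sphere_map (face_collar v 1 x)).
by rewrite face_collar1_boundary ?hv// (@min_crd_eq0 _ _ _ i).
Qed.

Hypothesis hnull : spheroid_homotopic wrapped_sphere (cst pt).

Lemma unit_interval_subproof (c : R) : clamp c \in [set c : R | 0 <= c <= 1].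
Proof. by apply/mem_set; exact: clamp_bounds. Qed.

Definition unit_point (c : R) : unit_interval R :=
  exist (fun c => c \in [set c : R | 0 <= c <= 1]) _ (unit_interval_subproof c).

Lemma unit_point_continuous Y (f : Y -> R) :
  continuous f -> continuous (fun y => unit_point (f y)).
Proof. by move=> cf; apply: continuous_comp_initial; exact: clamp_continuous. Qed.

(** The projection from [v] to the opposite face, as long as the coordinate at [v] is at most [1/2].
    Beyond that it is only kept continuous, which is impossible for the true projection at [v]. *)
Definition cone_base (t : simplex R n.+1) : simplex R n :=
  to_simplex (fun j => crd t (lift v j) / Num.max (1 - crd t v) (1/2)
     + (1 - (1 - crd t v) / Num.max (1 - crd t v) (1/2)) / n.+1%:R).

Lemma crd_cone_base t j : crd (cone_base t) j =
  crd t (lift v j) / Num.max (1 - crd t v) (1/2)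
     + (1 - (1 - crd t v) / Num.max (1 - crd t v) (1/2)) / n.+1%:R.
Proof.
have m0 := max_half_gt0 (1 - crd t v).
rewrite crd_to_simplex// => [k|].
  rewrite addr_ge0 ?divr_ge0 ?crd_ge0 ?(ltW m0)// subr_ge0.
  by rewrite ler_pdivrMr// [leRHS]mul1r le_max lexx.
rewrite big_split /= sumr_const card_ord divr_natK -mulr_suml.
have -> : \sum_(i < n.+1) crd t (lift v i) = 1 - crd t v.
  by rewrite -[X in _ = X - _](crd_sum t) (bigD1_ord v) //= addrAC subrr add0r.
by rewrite addrC subrK.
Qed.

Lemma cone_base_continuous : continuous cone_base.
Proof.
have cv : continuous (fun t : simplex R n.+1 => (Num.max (1 - crd t v) (1/2))^-1).
  by apply: ctsV => [t|]; [rewrite gt_eqF// max_half_gt0|cts].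
by apply: simplex_continuous => j; under eq_fun do rewrite crd_cone_base; cts.
Qed.

(** The null-homotopy of the wrapped sphere, read as a cone with apex [v], fills the inner half of
    the simplex; in the outer half the two collars undo the wrapping and lead back to the given
    faces. *)
Lemma filling : exists T : singular R n.+1 K, forall i, face i T = s i.
Proof.
have [H hH] := hnull.
(* At doubled speed the null-homotopy has reached [pt] when the coordinate at [v] is [1/2], so the
   cutoff in [cone_base] is never felt. *)
pose G (t : simplex R n.+1) := H (cone_base t, unit_point (2 * crd t v)).
have cG : continuous G.
  move=> t; apply: (@continuous_comp _ _ _
    (fun t => (cone_base t, unit_point (2 * crd t v))) H); last exact: cts_fun.
  have cu : continuous (fun t : simplex R n.+1 => unit_point (2 * crd t v)).
    by apply: unit_point_continuous; cts.
  exact: (@cts_fun _ _ (cts_pair (mkcts cone_base_continuous) (mkcts cu))).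
have Gface t : crd t v = 0 -> G t = wrapped_sphere (drop_crd v t).
  move=> tv; rewrite /G; have [h _ _] := hH (cone_base t) (unit_point (2 * crd t v)).
  rewrite h; last by rewrite /= tv mulr0 clamp0.
  congr (wrapped_sphere _); apply: simplex_eq => j.
  rewrite crd_cone_base crd_drop0// tv subr0 max_l; last lra.
  by rewrite divr1 divff ?oner_eq0// subrr mul0r addr0.
have Gstar t i : i != v -> crd t i = 0 -> G t = pt.
  move=> iv ti; rewrite /G.
  have [_ h1 hb] := hH (cone_base t) (unit_point (2 * crd t v)).
  case: (leP (1/2) (crd t v)) => htv.
    apply: h1; rewrite /= /clamp min_l; last lra.
    by rewrite max_r// ler01.
  have cb : simplex_boundary (cone_base t).
    move: (iv); rewrite eq_sym => /unlift_some[i' ei _].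
    exists i'; rewrite -[LHS]/(crd (cone_base t) i') crd_cone_base -ei ti mul0r add0r.
    rewrite max_l; last lra.
    by rewrite divff ?subrr ?mul0r//; lra.
  by rewrite hb//; exact: wrapped_spheroid.
pose om := @spread R n.+1; pose r := @simplex_radius R n.+1.
(* The time of the collars: 1 at radius [1/2], where the sphere is wrapped, and 0 on the boundary.
   There [om] is the radial projection to the boundary, whereas inside radius [1/2] it doubles the
   simplex. *)
pose c t := 2 - 2 * r t.
have cr : continuous r.
  by have := @min_crd_continuous R n.+1 => cm; rewrite /r /simplex_radius; cts.
have com : continuous om by exact: spread_continuous.
have cc : continuous c by rewrite /c; cts.
pose star t := [exists j : 'I_n.+2, (j != v) && (crd (om t) j == 0)].
pose E t := if r t <= 1/2 then G (om t)
  else if star t then sphere_map (star_collar v (c t) (om t))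
  else sphere_map (face_collar v (c t) (drop_crd v (om t))).
have EA t : r t <= 1/2 -> E t = G (om t) by rewrite /E => ->.
have EB t j : 1/2 <= r t -> j != v -> crd (om t) j = 0 ->
    E t = sphere_map (star_collar v (c t) (om t)).
  move=> rt jv tj; rewrite /E; case: ifP => rt'.
    have rt1 : r t = 1/2 by apply/eqP; rewrite eq_le rt rt'.
    have -> : c t = 1 by rewrite /c rt1; lra.
    by rewrite star_collar1 hv (Gstar _ j).
  by rewrite ifT//; apply/existsP; exists j; rewrite jv tj eqxx.
have EC t : 1/2 <= r t -> crd (om t) v = 0 ->
    E t = sphere_map (face_collar v (c t) (drop_crd v (om t))).
  move=> rt tv; case: (boolP (star t)) => [/existsP[j /andP[jv /eqP tj]]|nst].
    by rewrite (EB t j)// -(@star_face_collar _ _ _ _ _ j).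
  rewrite /E (negbTE nst); case: ifP => // rt'.
  have rt1 : r t = 1/2 by apply/eqP; rewrite eq_le rt rt'.
  have -> : c t = 1 by rewrite /c rt1; lra.
  by rewrite Gface.
have closed_r1 : closed [set t | r t <= 1/2].
  by apply: (@preimage_closed _ _ r [set y | y <= 1/2]); [move=> x _; exact: cr|exact: closed_le].
have closed_r2 : closed [set t | 1/2 <= r t].
  by apply: (@preimage_closed _ _ r [set y | 1/2 <= y]); [move=> x _; exact: cr|exact: closed_ge].
have closed_om i : closed [set t | crd (om t) i = 0].
  by apply: (@preimage_closed _ _ om [set t | crd t i = 0]); [move=> x _; exact: com|exact: closed_crd0].
have cE : continuous E.
  apply: closed_cont_continuous.
  rewrite (_ : setT = [set t | r t <= 1/2] `|`
     ([set t | exists j, ([set t | 1/2 <= r t] `&` [set t | j != v /\ crd (om t) j = 0]) t] `|`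
      ([set t | 1/2 <= r t] `&` [set t | crd (om t) v = 0]))); last first.
    apply/esym/seteqP; split=> // t _.
    case: (leP (r t) (1/2)) => [|/ltW rt]; first by left.
    right; have [i ti] := spread_boundary rt.
    by have [iv|iv] := eqVneq i v; [right; rewrite -iv|left; exists i].
  apply: closed_contU; last apply: closed_contU.
  - apply: (@eq_closed_cont _ _ _ _ (G \o om)); first exact: EA.
    apply: continuous_closed_cont => // t.
    by apply: continuous_comp; [exact: com|exact: cG].
  - apply: closed_cont_bigcup => j.
    apply: (@eq_closed_cont _ _ _ _ (sphere_map \o (fun t => star_collar v (c t) (om t)))).
      by move=> t [rt [jv tj]]; exact: (EB t j).
    have [jv|jv] := boolP (j == v).
      rewrite (_ : _ `&` _ = set0); last by apply/seteqP; split=> t // [_ []].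
      by move=> Z _; rewrite set0I; exact: closed0.
    rewrite (_ : [set t | _ /\ _] = [set t | crd (om t) j = 0]); last first.
      by apply/seteqP; split=> t //; case.
    apply: (@closed_cont_comp _ _ _ _ [set t | exists i, crd t i = 0]).
    + exact: closedI.
    + exact: star_collar_continuous.
    + move=> t [_ tj]; exists j; rewrite crd_star_collar tj mulr0 add0r.
      by rewrite eq_sym (negbTE jv) mulr0.
    + exact: sphere_map_closed_cont.
  - apply: (@eq_closed_cont _ _ _ _ (sphere_map \o
      (fun t => face_collar v (c t) (drop_crd v (om t))))).
      by move=> t [rt tv]; exact: EC.
    apply: (@closed_cont_comp _ _ _ _ [set t | exists i, crd t i = 0]).
    + exact: closedI.
    + apply: face_collar_continuous => // t.
      by apply: (@continuous_comp _ _ _ om (drop_crd v)); [exact: com|exact: drop_crd_continuous].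
    + by move=> t _; exact: face_collar_boundary.
    + exact: sphere_map_closed_cont.
pose T : singular R n.+1 K := mkcts cE.
exists T => i; apply: cts_eq => x.
pose t : simplex R n.+1 := simplex_map R (lift i) x.
rewrite -[LHS]/(E t).
have ti : crd t i = 0 by rewrite /t crd_face0.
have m0 : min_crd t = 0 by apply: (@min_crd_eq0 _ _ _ i).
have omt : om t = t by exact: spread_id.
have rt : r t = 1 by rewrite /r /simplex_radius m0 mulr0 subr0.
have ct : c t = 0 by rewrite /c rt; lra.
have -> : s i x = sphere_map t by rewrite (sphere_mapE ti) /t drop_face.
have [iv|iv] := eqVneq i v.
  rewrite EC ?omt -?iv//; last by rewrite rt; lra.
  by rewrite ct face_collar0 face_drop.
by rewrite (EB t i) ?omt// ?rt; [rewrite ct star_collar0|lra].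
Qed.

End Filling.

(** * Spheres in an Eilenberg-Mac Lane space *)

Section EMFilling.
Variables (R : realType) (A : zmodType) (K : EM_space R A).

Definition em (s : singular R 1 K) : A := sq_repr (em_class K) s.

Lemma em_cocycle : (em : cochain R K A 1) \in @cocycle R K A 1.
Proof. exact: sq_repr_in. Qed.

Lemma pairing_em (s : singular R 1 K) : s (v0 R) = s (v1 R) ->
  pairing (em_class K) (hurewicz1 s) = em s.
Proof. exact: pairing_hurewicz. Qed.

Lemma boundary_v0 : @simplex_boundary R 1 (v0 R).
Proof. by exists ord_max; rewrite -[LHS]/(crd (v0 R) ord_max) crd_vertex. Qed.

Lemma boundary_v1 : @simplex_boundary R 1 (v1 R).
Proof. by exists ord0; rewrite -[LHS]/(crd (v1 R) ord0) crd_vertex. Qed.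

Lemma loop_spheroid X (x : X) (s : singular R 1 X) :
  s (v0 R) = x -> s (v1 R) = x -> spheroid x s.
Proof.
move=> s0 s1 t [i ti]; rewrite -[val t ord0 i]/(crd t i) in ti.
have [i0|i0] := eqVneq i ord0.
  have -> // : t = v1 R; rewrite -interval_point1 -(interval_pointK t).
  by congr interval_point; have := simplex1_crd t; rewrite -i0 ti => /eqP;
    rewrite eq_sym subr_eq0 => /eqP.
have -> // : t = v0 R; rewrite -interval_point0 -(interval_pointK t).
congr interval_point; rewrite -ti; congr crd.
by have [e|//] := ord2P i; rewrite e eqxx in i0.
Qed.

Lemma joinable_em : joinable R K.
Proof. exact/path_connected_joinable/em_path_connected. Qed.

(** Any path from [x] to [y] through the base point can be corrected there by a loop that carries
    the missing value. *)
Lemma em_path (x y : K) (a : A) :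
  exists s : singular R 1 K, [/\ s (v0 R) = x, s (v1 R) = y & em s = a].
Proof.
have [p [p0 p1]] := joinable_em x (em_pt K).
have [q [q0 q1]] := joinable_em (em_pt K) y.
have [l ls le] := @em_pi1_surjective R A K (a - em p - em q).
have l0 := ls _ boundary_v0; have l1 := ls _ boundary_v1.
have [r [r0 r1 hr]] := @concat_paths R K p l (etrans p1 (esym l0)).
have [w [w0 w1 hw]] := @concat_paths R K r q (etrans (etrans r1 l1) (esym q0)).
exists w; rewrite w0 r0 w1; split=> //.
rewrite (hw A em em_cocycle) (hr A em em_cocycle).
rewrite -(pairing_em (etrans l0 (esym l1))) le.
by rewrite [em p + _]addrC addrAC subrK subrK.
Qed.

Lemma em_fill_high n (s : 'I_n.+2 -> singular R n K) (v : 'I_n.+2) : (1 < n)%N ->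
  (forall (t : simplex R n.+1) i j, crd t i = 0 -> crd t j = 0 ->
    s i (drop_crd i t) = s j (drop_crd j t)) ->
  sphere_map (em_pt K) s (vertex R v) = em_pt K ->
  exists T : singular R n.+1 K, forall i, face i T = s i.
Proof.
move=> n1 hs hv; apply: (@filling R K (em_pt K) n s hs v hv); apply: em_pi_trivial => //.
exact: wrapped_spheroid.
Qed.

Lemma min_crdE n (t : simplex R n) x : (exists i, crd t i = x) ->
  (forall i, x <= crd t i) -> min_crd t = x.
Proof.
move=> [i <-] h; apply/eqP; rewrite eq_le min_crd_le /=.
by have [j <-] := min_crd_attained t.
Qed.

Definition edge n (a b : 'I_n.+1) : R -> simplex R n := fun c =>
  affine (pair_fun (vertex R a) (vertex R b)) (interval_point c).

Lemma crd_edge n (a b : 'I_n.+1) c j : 0 <= c <= 1 ->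
  crd (edge a b c) j = (1 - c) * (a == j)%:R + c * (b == j)%:R.
Proof.
by move=> hc; rewrite crd_affine_pair crd_interval_point !crd_vertex clamp_id.
Qed.

(** In dimension one the wrapped circle is explicit: a quarter of the time along an edge from [v],
    half of it along the face opposite to [v], a quarter back to [v]. The quarter is where
    [face_height 1 x = 4 * min_crd x - 1] changes sign. *)
Lemma face_collar_low (v : 'I_3) c : 0 <= c <= 1/4 ->
  face_collar v 1 (interval_point c) = edge v (lift v ord0) (4 * c).
Proof.
move=> /andP[c0 c1]; set x := interval_point c.
have x0 : crd x ord0 = 1 - c by rewrite crd_interval_point /= clamp_id//; lra.
have x1 : crd x ord_max = c by rewrite crd_interval_point /= clamp_id//; lra.
have m : min_crd x = c.
  apply: min_crdE; first by exists ord_max.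
  by move=> i; have [->|->] := ord2P i; rewrite ?x0 ?x1//; lra.
have r : simplex_radius x = 1 - 2 * c by rewrite /simplex_radius m.
have h : face_height 1 x = 4 * c - 1 by rewrite /face_height clamp1 m; ring.
have k : face_scale 1 x * (1 - 2 * c) = 4 * c.
  by rewrite -r face_scale_radius h ler0_norm; lra.
apply: simplex_eq => j; rewrite crd_edge; last lra.
case: (unliftP v j) => [i ->|->].
  rewrite crd_face_collar_lift h (negbTE (neq_lift _ _)) mulr0 add0r m max_r; last lra.
  rewrite mul0r addr0 (inj_eq lift_inj).
  have [->|->] := ord2P i; first by rewrite x0 eqxx mulr1 -k; ring.
  by rewrite x1 subrr !mulr0.
rewrite crd_face_collar_v h eqxx eq_sym (negbTE (neq_lift _ _)) max_l; last lra.
by rewrite mulr1 mulr0; ring.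
Qed.

Lemma face_collar_middle (v : 'I_3) c : 0 <= c <= 1 ->
  face_collar v 1 (interval_point (1/4 + c / 2)) = edge (lift v ord0) (lift v ord_max) c.
Proof.
move=> /andP[c0 c1]; set x := interval_point _.
have x0 : crd x ord0 = 3/4 - c/2 by rewrite crd_interval_point /= clamp_id; lra.
have x1 : crd x ord_max = 1/4 + c/2 by rewrite crd_interval_point /= clamp_id; lra.
have m : 1/4 <= min_crd x.
  have [i <-] := min_crd_attained x.
  by have [->|->] := ord2P i; rewrite ?x0 ?x1; lra.
have h : face_height 1 x = 4 * min_crd x - 1 by rewrite /face_height clamp1; ring.
have h0 : 0 <= face_height 1 x by lra.
have k : face_scale 1 x = 2.
  rewrite /face_scale clamp1 min_l// ler_pdivlMr ?max_half_gt0// /simplex_radius h.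
  rewrite -ler_pdivlMl// (_ : (1 + 1)^-1 = 1/2 :> R); last by rewrite mul1r.
  by rewrite ge_max; apply/andP; split; lra.
apply: simplex_eq => j; rewrite crd_edge; last lra.
case: (unliftP v j) => [i ->|->].
  rewrite crd_face_collar_lift h k max_l -?h// !(inj_eq lift_inj) h.
  by have [->|->] := ord2P i; rewrite ?x0 ?x1 /=; field.
rewrite crd_face_collar_v h !(eq_sym (lift _ _)) !(negbTE (neq_lift _ _)) max_r; last lra.
by rewrite !mulr0 addr0.
Qed.

Lemma face_collar_high (v : 'I_3) c : 0 <= c <= 1/4 ->
  face_collar v 1 (interval_point (3/4 + c)) = edge (lift v ord_max) v (4 * c).
Proof.
move=> /andP[c0 c1]; set x := interval_point _.
have x0 : crd x ord0 = 1/4 - c by rewrite crd_interval_point /= clamp_id; lra.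
have x1 : crd x ord_max = 3/4 + c by rewrite crd_interval_point /= clamp_id; lra.
have m : min_crd x = 1/4 - c.
  apply: min_crdE; first by exists ord0.
  by move=> i; have [->|->] := ord2P i; rewrite ?x0 ?x1//; lra.
have r : simplex_radius x = 1/2 + 2 * c by rewrite /simplex_radius m; lra.
have h : face_height 1 x = - 4 * c by rewrite /face_height clamp1 m; lra.
have k : face_scale 1 x * (1/2 + 2 * c) = 1 - 4 * c.
  by rewrite -r face_scale_radius h ler0_norm; lra.
apply: simplex_eq => j; rewrite crd_edge; last lra.
case: (unliftP v j) => [i ->|->].
  rewrite crd_face_collar_lift h (negbTE (neq_lift _ _)) mulr0 addr0 m max_r; last lra.
  rewrite mul0r addr0 (inj_eq lift_inj).
  have [->|->] := ord2P i; last by rewrite x1 eqxx mulr1 -k; field.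
  by rewrite x0 subrr !mulr0.
rewrite crd_face_collar_v h eqxx eq_sym (negbTE (neq_lift _ _)) max_l; last lra.
by rewrite mulr1 mulr0; ring.
Qed.

Section Triangle.
Variable s : 'I_3 -> singular R 1 K.
Hypothesis hs : forall (t : simplex R 2) i j, crd t i = 0 -> crd t j = 0 ->
    s i (drop_crd i t) = s j (drop_crd j t).

Lemma em_edge (f : singular R 1 K) (a b i : 'I_3) (a' b' : 'I_2) :
  a = lift i a' -> b = lift i b' ->
  (forall t, f t = sphere_map (em_pt K) s (edge a b (crd t ord_max))) ->
  em f = em (segment (s i) (vertex R a') (vertex R b')).
Proof.
move=> ea eb hf; congr em; apply: cts_eq => t; rewrite hf.
have t01 : 0 <= crd t ord_max <= 1 by rewrite crd_ge0 crd_le1.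
have e0 : crd (edge a b (crd t ord_max)) i = 0.
  rewrite crd_edge// ea eb !(eq_sym (lift _ _)) !(negbTE (neq_lift _ _)).
  by rewrite !mulr0 addr0.
rewrite (sphere_mapE (em_pt K) hs e0) /segment /cts_comp /=.
congr (s i _); apply: simplex_eq => j; rewrite crd_drop0// crd_edge// ea eb.
by rewrite crd_affine_pair !crd_vertex !(inj_eq lift_inj).
Qed.

(** The wrapped circle runs once around the triangle, so its value is the alternating sum of the
    three edges up to sign; this vanishes by hypothesis, and injectivity on the fundamental group
    contracts the circle. *)
Lemma em_fill_two (v : 'I_3) :
  sphere_map (em_pt K) s (vertex R v) = em_pt K ->
  em (s (lift ord0 ord0)) = em (s ord_max) + em (s ord0) ->
  exists T : singular R 2 K, forall i, face i T = s i.
Proof.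
move=> hv hem; apply: (@filling R K (em_pt K) 1 s hs v hv).
have ws := @wrapped_spheroid R K (em_pt K) 1 s hs v hv.
apply: em_pi1_injective => //.
have w0 := ws _ boundary_v0; have w1 := ws _ boundary_v1.
rewrite pairing_em ?w0// pairing_em// [RHS](cocycle_cst em_cocycle (x := em_pt K))//.
set w := wrapped_sphere (em_pt K) hs v.
pose p c : simplex R 1 := interval_point c.
have q1 : 0 <= (1/4 : R) <= 1 by lra.
have q3 : 0 <= (3/4 : R) <= 1 by lra.
have q00 : 0 <= (0 : R) <= 1 by lra.
have q11 : 0 <= (1 : R) <= 1 by lra.
have -> : em w = em (segment w (p 0) (p (1/4))) + em (segment w (p (1/4)) (p (3/4)))
    + em (segment w (p (3/4)) (p 1)).
  rewrite -(cocycle_triangle em_cocycle) -(cocycle_triangle em_cocycle).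
  by rewrite /p interval_point0 interval_point1 segment_id.
have eA (a' b' : 'I_2) : v = lift (lift v ord_max) a' -> lift v ord0 = lift (lift v ord_max) b' ->
    em (segment w (p 0) (p (1/4))) = em (segment (s (lift v ord_max)) (vertex R a') (vertex R b')).
  move=> ea eb; apply: em_edge ea eb _ => t; rewrite segment_interval//.
  rewrite -[LHS]/(sphere_map (em_pt K) s (face_collar v 1 (interval_point _))).
  move: (crd_ge0 t ord_max) (crd_le1 t ord_max) => t0 t1.
  by rewrite face_collar_low; [congr (sphere_map (em_pt K) s (edge _ _ _)); field|lra].
have eB : em (segment w (p (1/4)) (p (3/4))) =
    em (segment (s v) (vertex R ord0) (vertex R ord_max)).
  apply: (@em_edge _ (lift v ord0) (lift v ord_max) v) => // t; rewrite segment_interval//.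
  rewrite -[LHS]/(sphere_map (em_pt K) s (face_collar v 1 (interval_point _))).
  rewrite -(@face_collar_middle v (crd t ord_max)); last by rewrite crd_ge0 crd_le1.
  by congr (sphere_map (em_pt K) s (face_collar v 1 (interval_point _))); field.
have eC (a' b' : 'I_2) : lift v ord_max = lift (lift v ord0) a' -> v = lift (lift v ord0) b' ->
    em (segment w (p (3/4)) (p 1)) = em (segment (s (lift v ord0)) (vertex R a') (vertex R b')).
  move=> ea eb; apply: em_edge ea eb _ => t; rewrite segment_interval//.
  rewrite -[LHS]/(sphere_map (em_pt K) s (face_collar v 1 (interval_point _))).
  move: (crd_ge0 t ord_max) (crd_le1 t ord_max) => t0 t1.
  have e4 : crd t ord_max = 4 * (crd t ord_max / 4) by field.
  rewrite [in RHS]e4 -(@face_collar_high v (crd t ord_max / 4)); last lra.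
  by congr (sphere_map (em_pt K) s (face_collar v 1 (interval_point _))); field.
have seg i : segment (s i) (vertex R ord0) (vertex R ord_max) = s i by exact: segment_id.
have rev i : em (segment (s i) (vertex R ord_max) (vertex R ord0)) = - em (s i).
  by rewrite (cocycle_rev em_cocycle) seg.
rewrite eB seg; move: eA eC.
move: (em (segment w (p 0) _)) (em (segment w (p (3/4)) _)) => ea ec.
(* The position of [v] decides which edges are traversed against their orientation. *)
case: v {hv ws w0 w1 w p eB} => [[|[|[|//]]] hv] eA eC.
- rewrite (eA ord0 ord_max); [|exact: val_inj..].
  rewrite (eC ord_max ord0); [|exact: val_inj..].
  rewrite seg rev.
  have -> : lift (Ordinal hv) ord_max = ord_max by exact: val_inj.
  have -> : lift (Ordinal hv) ord0 = lift ord0 ord0 by exact: val_inj.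
  have -> : Ordinal hv = ord0 by exact: val_inj.
  by rewrite hem subrr.
- rewrite (eA ord_max ord0); [|exact: val_inj..].
  rewrite (eC ord_max ord0); [|exact: val_inj..].
  rewrite !rev.
  have -> : lift (Ordinal hv) ord_max = ord_max by exact: val_inj.
  have -> : lift (Ordinal hv) ord0 = ord0 by exact: val_inj.
  have -> : Ordinal hv = lift ord0 ord0 by exact: val_inj.
  by rewrite hem addrA addNr add0r subrr.
- rewrite (eA ord_max ord0); [|exact: val_inj..].
  rewrite (eC ord0 ord_max); [|exact: val_inj..].
  rewrite seg rev.
  have -> : lift (Ordinal hv) ord_max = lift ord0 ord0 by exact: val_inj.
  have -> : lift (Ordinal hv) ord0 = ord0 by exact: val_inj.
  have -> : Ordinal hv = ord_max by exact: val_inj.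
  by rewrite hem -addrA addNr.
Qed.
End Triangle.
End EMFilling.

(** * Maps through the nerve *)

Lemma lift_lift k (i j : 'I_k.+3) (i' j' : 'I_k.+2) : j = lift i j' -> i = lift j i' ->
  forall l, lift i (lift j' l) = lift j (lift i' l).
Proof.
move=> /(congr1 val) /= ej /(congr1 val) /= ei l; apply: val_inj => /=.
by move: ei ej; rewrite /bump; lia.
Qed.

Section Lifting.
Variables (R : realType) (A : zmodType) (K : EM_space R A).
(** [L] and [d] form a semi-simplicial set, with vertices mapped by [vtx]. On the simplices in [P]
    the map [g] is given; every other simplex of dimension at least two has a vertex at the base
    point, where a filling can start. *)
Variables (L : nat -> Type) (d : forall k, 'I_k.+2 -> L k.+1 -> L k).
Hypothesis d_lift : forall k (x : L k.+2) (i j : 'I_k.+3) (i' j' : 'I_k.+2),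
  j = lift i j' -> i = lift j i' -> d j' (d i x) = d i' (d j x).
Variable vtx : forall k, L k -> 'I_k.+1 -> K.
Hypothesis vtx_d : forall k (x : L k.+1) i j, vtx (d i x) j = vtx x (lift i j).
Variables (P : forall k, L k -> Prop) (g : forall k, L k -> singular R k K).
Hypothesis P_d : forall k (x : L k.+1) i, P x -> P (d i x).
Hypothesis g_d : forall k (x : L k.+1) i, P x -> face i (g x) = g (d i x).
Hypothesis g_vtx : forall k (x : L k) i, P x -> g x (vertex R i) = vtx x i.
Variable path1 : L 1 -> singular R 1 K.
Hypothesis path1_start : forall x, path1 x (v0 R) = vtx x ord0.
Hypothesis path1_end : forall x, path1 x (v1 R) = vtx x ord_max.
Hypothesis path1_P : forall x, P x -> path1 x = g x.
Hypothesis path1_em : forall x : L 2,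
  em (path1 (d (lift ord0 ord0) x)) = em (path1 (d ord_max x)) + em (path1 (d ord0 x)).
Hypothesis pt_vtx : forall k (x : L k.+2), ~ P x -> exists v, vtx x v = em_pt K.

(* A map of semi-simplicial sets into the singular simplices of [K] is extended
   one dimension at a time by filling spheres. *)
Fixpoint lifting k : L k -> singular R k K :=
  match k with
  | 0 => fun x => cst (vtx x ord0)
  | k'.+1 => match k' return (L k' -> singular R k' K) -> L k'.+1 -> singular R k'.+1 K with
    | 0 => fun _ => path1
    | k''.+1 => fun F x => if pselect (P x) then g x else
        xget (cst (em_pt K) : singular R k''.+2 K) [set T | forall i, face i T = F (d i x)]
    end (@lifting k')
  end.

Lemma lifting_P k (x : L k) : P x -> lifting x = g x.
Proof.
case: k x => [|[|k]] x Px /=; last by case: pselect.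
  apply: cts_eq => t; rewrite (simplex0_eq t (vertex R ord0)) g_vtx//.
exact: path1_P.
Qed.

(** Faces and vertices are treated together, since filling a sphere requires knowing that one of its
    vertices is the base point. *)
Lemma lifting_spec k : (forall (x : L k.+1) i, face i (lifting x) = lifting (d i x)) /\
  (forall (x : L k.+1) j, lifting x (vertex R j) = vtx x j).
Proof.
elim: k => [|k [IHf IHv]].
  split=> x.
    case=> -[|[|//]] hi.
      rewrite (_ : Ordinal hi = ord0); last exact: val_inj.
      rewrite face10 /= path1_end vtx_d; congr (cst (vtx x _)); exact: val_inj.
    rewrite (_ : Ordinal hi = ord_max); last exact: val_inj.
    rewrite face11 /= path1_start vtx_d; congr (cst (vtx x _)); exact: val_inj.
  case=> -[|[|//]] hi /=.
    by rewrite (_ : Ordinal hi = ord0) ?path1_start//; exact: val_inj.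
  by rewrite (_ : Ordinal hi = ord_max) ?path1_end//; exact: val_inj.
have hf (x : L k.+2) i : face i (lifting x) = lifting (d i x).
  have [Px|nPx] := pselect (P x).
    by rewrite !lifting_P//; [exact: g_d|exact: P_d].
  pose s i := lifting (d i x).
  have hs (t : simplex R k.+2) a b : crd t a = 0 -> crd t b = 0 ->
      s a (drop_crd a t) = s b (drop_crd b t).
    move=> ta tb; have [->//|ab] := eqVneq a b.
    have [b' eb _] := unlift_some ab.
    move: (ab); rewrite eq_sym => /unlift_some[a' ea _].
    have e1 : s a (drop_crd a t) = lifting (d b' (d a x)) (drop_crd b' (drop_crd a t)).
      rewrite -IHf /s -[in LHS](@face_drop _ _ b' (drop_crd a t))//.
      by rewrite crd_drop0// -eb.
    have e2 : s b (drop_crd b t) = lifting (d a' (d b x)) (drop_crd a' (drop_crd b t)).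
      rewrite -IHf /s -[in LHS](@face_drop _ _ a' (drop_crd b t))//.
      by rewrite crd_drop0// -ea.
    rewrite e1 e2 (d_lift x eb ea); congr (lifting _ _); apply: simplex_eq => l.
    rewrite !crd_drop0 ?(lift_lift eb ea)//; first by rewrite -ea.
    by rewrite -eb.
  have [v hv] := pt_vtx nPx.
  have hsv : sphere_map (em_pt K) s (vertex R v) = em_pt K.
    (* The value of the sphere at [v] is read off some face through [v]. *)
    have [i0 i0v] : exists i0 : 'I_k.+3, i0 != v.
      by exists (lift v ord0); rewrite eq_sym neq_lift.
    have [v' ev _] := unlift_some i0v.
    have vi0 : crd (vertex R v) i0 = 0 by rewrite crd_vertex eq_sym (negbTE i0v).
    rewrite (sphere_mapE (em_pt K) hs vi0) -hv [in RHS]ev -vtx_d /s -IHv; congr (lifting _ _).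
    apply: simplex_eq => l; rewrite crd_drop0// !crd_vertex.
    by rewrite [in LHS]ev (inj_eq lift_inj).
  have ex : exists T : singular R k.+2 K, forall i, face i T = s i.
    (* Circles are filled thanks to [path1_em], spheres of higher dimension because the homotopy
       groups vanish. *)
    case: k x i IHf IHv nPx @s hs v hv hsv => [|k] x i _ _ nPx s hs v hv hsv.
      by apply: (em_fill_two hs hsv); exact: path1_em.
    exact: (em_fill_high _ hs hsv).
  have -> : lifting x = xget (cst (em_pt K) : singular R k.+2 K)
      [set T | forall i, face i T = lifting (d i x)].
    by rewrite /=; case: pselect.
  by case: xgetP => [T _ hT|h]; [exact: hT|have [T hT] := ex; case: (h T)].
split=> // x j.
have [i0 i0j] : exists i0 : 'I_k.+3, i0 != j.
  by exists (lift j ord0); rewrite eq_sym neq_lift.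
have [j' ej _] := unlift_some i0j.
rewrite ej -vtx_d -IHv -hf -[RHS]/(lifting x (simplex_map R _ (vertex R _))).
by rewrite simplex_map_vertex.
Qed.

Lemma face_lifting k (x : L k.+1) i : face i (lifting x) = lifting (d i x).
Proof. exact: (lifting_spec k).1. Qed.

End Lifting.

Section Bar.
Variables (R : realType) (A : zmodType) (K : EM_space R A).

Definition em_loop (a : A) : singular R 1 K :=
  projT1 (cid (em_path (em_pt K) (em_pt K) a)).

Lemma em_loopP a : [/\ em_loop a (v0 R) = em_pt K, em_loop a (v1 R) = em_pt K & em (em_loop a) = a].
Proof. by rewrite /em_loop; case: cid. Qed.

(* Simplices of [K] with all vertices at the base point and prescribed edges: a
   semi-simplicial map to [K] from the nerve of [A], in homogeneous notation. *)
Definition bar : forall k, ('I_k.+1 -> A) -> singular R k K :=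
  @lifting R A K (fun k => 'I_k.+1 -> A) (fun k i psi j => psi (lift i j))
    (fun _ _ _ => em_pt K) (fun _ _ => False) (fun _ _ => cst (em_pt K))
    (fun psi => em_loop (psi ord_max - psi ord0)).

Lemma bar_spec k :
  (forall (psi : 'I_k.+2 -> A) i, face i (bar psi) = bar (fun j => psi (lift i j))) /\
  (forall (psi : 'I_k.+2 -> A) j, bar psi (vertex R j) = em_pt K).
Proof.
apply: lifting_spec => //.
- by move=> l x a b a' b' ea eb; apply/funext => j; rewrite (lift_lift ea eb).
- by move=> x; have [] := em_loopP (x ord_max - x ord0).
- by move=> x; have [] := em_loopP (x ord_max - x ord0).
- move=> x.
  have [_ _ ->] := em_loopP (x (lift (lift ord0 ord0) ord_max) - x (lift (lift ord0 ord0) ord0)).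
  have [_ _ ->] := em_loopP (x (lift ord_max ord_max) - x (lift ord_max ord0)).
  have [_ _ ->] := em_loopP (x (lift ord0 ord_max) - x (lift ord0 ord0)).
  have -> : lift (lift ord0 ord0) ord_max = ord_max :> 'I_3 by exact: val_inj.
  have -> : lift (lift ord0 ord0) ord0 = ord0 :> 'I_3 by exact: val_inj.
  have -> : lift ord_max ord_max = lift ord0 ord0 :> 'I_3 by exact: val_inj.
  have -> : lift ord_max ord0 = ord0 :> 'I_3 by exact: val_inj.
  have -> : lift ord0 ord_max = ord_max :> 'I_3 by exact: val_inj.
  by rewrite [RHS]addrC addrA subrK.
- by move=> l x _; exists ord0.
Qed.

Lemma face_bar k (psi : 'I_k.+2 -> A) i : face i (bar psi) = bar (fun j => psi (lift i j)).
Proof. exact: (bar_spec k).1. Qed.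

Lemma bar_vertex k (psi : 'I_k.+1 -> A) i : bar psi (vertex R i) = em_pt K.
Proof. by case: k psi i => [//|k] psi i; exact: (bar_spec k).2. Qed.

Lemma em_bar (psi : 'I_2 -> A) : em (bar psi) = psi ord_max - psi ord0.
Proof. by have [] := em_loopP (psi ord_max - psi ord0). Qed.

Lemma barSS k (psi : 'I_k.+3 -> A) : bar psi = xget (cst (em_pt K) : singular R k.+2 K)
    [set T | forall i, face i T = bar (fun j => psi (lift i j))].
Proof. by rewrite /bar /=; case: pselect. Qed.

(** Loops depend on differences of labels only. In higher dimension the filling is chosen from a
    predicate on its faces, and equal predicates lead to the same choice. *)
Lemma bar_shift k (psi psi' : 'I_k.+1 -> A) c :
  (forall i, psi' i = psi i + c) -> bar psi' = bar psi.
Proof.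
elim: k psi psi' => [//|[|k] IH] psi psi' e.
  by rewrite /bar /= !e opprD addrACA subrr addr0.
rewrite !barSS; congr xget; apply/funext => T /=; apply/propext.
have e' (i : 'I_k.+3) : bar (fun j => psi' (lift i j)) = bar (fun j => psi (lift i j)).
  by apply: IH => j; exact: e.
split=> h i; apply: (etrans (h i)); first exact: e'.
exact: esym (e' i).
Qed.

(** Labels at vertices of zero coordinate do not matter, because [t] then lies in the opposite face.
    This is what makes maps given by barycentric coordinates and labels continuous. *)
Lemma bar_agree k (psi psi' : 'I_k.+1 -> A) (c : A) (t : simplex R k) :
  (forall i, crd t i != 0 -> psi' i = psi i + c) -> bar psi' t = bar psi t.
Proof.
elim: k psi psi' t => [|k IH] psi psi' t h.
  rewrite (@bar_shift _ psi psi' c)// => i; apply: h.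
  by rewrite ord1; have := crd_sum t; rewrite big_ord1 => ->; exact: oner_neq0.
have [/existsP[i /eqP ti]|nex] := boolP [exists i, crd t i == 0].
  rewrite -(face_drop ti).
  rewrite -[LHS]/(face i (bar psi') (drop_crd i t)) -[RHS]/(face i (bar psi) (drop_crd i t)).
  by rewrite !face_bar; apply: IH => j; rewrite crd_drop0//; exact: h.
rewrite (@bar_shift _ psi psi' c)// => i; apply: h.
by apply: contraNneq nex => ti; apply/existsP; exists i; rewrite ti.
Qed.

End Bar.

(** * The homotopy between a map and its nerve map *)

Section Prism.
Variables (R : realType) (A : zmodType) (K : EM_space R A) (N : topologicalType).
Variable phi : cochain R N A 1.
Hypothesis hphi : phi \in @cocycle R N A 1.

(** The cocycle integrated from the first vertex. Passing to a face changes the labels by a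
    constant, which [bar] does not see. *)
Definition labels k (s : singular R k N) (i : 'I_k.+1) : A :=
  phi (segment s (vertex R ord0) (vertex R i)).

Lemma labels_face k (s : singular R k.+1 N) i j :
  labels (face i s) j = labels s (lift i j) - labels s (lift i ord0).
Proof.
rewrite /labels.
have -> : segment (face i s) (vertex R ord0) (vertex R j) =
    segment s (vertex R (lift i ord0)) (vertex R (lift i j)).
  apply: cts_eq => t.
  rewrite -[LHS]/(s (simplex_map R (lift i) (affine (pair_fun (vertex R ord0) (vertex R j)) t))).
  apply: (congr1 s); rewrite -affine_vertex.
  rewrite -[LHS]/(cts_comp (affine _) (affine _) t) affineM.
  congr (affine _ t); apply/funext => l; rewrite /pair_fun.
  by case: eqP => _; rewrite affine_at_vertex.
rewrite [phi (segment s (vertex R ord0) (vertex R (lift i j)))]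
  (cocycle_triangle hphi s _ (vertex R (lift i ord0))).
by rewrite addrAC subrr add0r.
Qed.

Lemma bar_labels_face k (s : singular R k.+1 N) i :
  face i (bar K (labels s)) = bar K (labels (face i s)).
Proof.
rewrite face_bar; apply: (@bar_shift _ _ _ _ _ _ (labels s (lift i ord0))) => j.
by rewrite labels_face subrK.
Qed.

Variable f : continuousType N K.
Variable chi : N -> A.
Hypothesis f_phi : forall s : singular R 1 N,
  em (cts_comp f s) = phi s + chi (s (v1 R)) - chi (s (v0 R)).

(** A simplex of the cylinder over [N], reduced to its projection and to the end at which each
    vertex lies: marked vertices belong to the nerve end, the others to the end of [f]. *)
Definition marked k : Type := (singular R k N * ('I_k.+1 -> bool))%type.
Definition marked_face k (i : 'I_k.+2) (x : marked k.+1) : marked k :=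
  (face i x.1, fun j => x.2 (lift i j)).
Definition marked_vertex k (x : marked k) (i : 'I_k.+1) : K :=
  if x.2 i then em_pt K else f (x.1 (vertex R i)).
Definition pure k (x : marked k) : Prop := forall i, x.2 i = x.2 ord0.
Definition marked_pure k (x : marked k) : singular R k K :=
  if x.2 ord0 then bar K (labels x.1) else cts_comp f x.1.
(** The potential that corrects [phi] at each end: [chi] where the map is [f], and 0 at the nerve
    end, where the edge values are exactly [phi]. Mixed edges are chosen to fit, so that triangles
    can be filled. *)
Definition marked_label k (x : marked k) (i : 'I_k.+1) : A :=
  if x.2 i then 0 else chi (x.1 (vertex R i)).
Definition marked_path (x : marked 1) : singular R 1 K :=
  if pselect (pure x) then marked_pure x else
    projT1 (cid (em_path (marked_vertex x ord0) (marked_vertex x ord_max)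
      (phi x.1 + marked_label x ord_max - marked_label x ord0))).

Definition prism : forall k, marked k -> singular R k K :=
  @lifting R A K marked marked_face marked_vertex pure marked_pure marked_path.

Lemma marked_pure_vertex k (x : marked k) i : pure x ->
  marked_pure x (vertex R i) = marked_vertex x i.
Proof.
move=> px; rewrite /marked_pure /marked_vertex px; case: (x.2 ord0) => //.
exact: bar_vertex.
Qed.

Lemma labels1 (s : singular R 1 N) : labels s ord_max - labels s ord0 = phi s.
Proof.
by rewrite /labels (cocycle_point hphi) subr0 -[RHS](congr1 phi (segment_id s)).
Qed.

Lemma marked_pathP (x : marked 1) :
  [/\ marked_path x (v0 R) = marked_vertex x ord0,
      marked_path x (v1 R) = marked_vertex x ord_max &
      em (marked_path x) = phi x.1 + marked_label x ord_max - marked_label x ord0].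
Proof.
rewrite /marked_path; case: pselect => [px|npx]; last by case: cid.
split; [exact: marked_pure_vertex|exact: marked_pure_vertex|].
rewrite /marked_pure /marked_label px; case: (x.2 ord0); last exact: f_phi.
by rewrite em_bar labels1 addr0 subr0.
Qed.

Lemma face_prism k (x : marked k.+1) i : face i (prism x) = prism (marked_face i x).
Proof.
have face_vertex n (s : singular R n.+1 N) a b : face a s (vertex R b) = s (vertex R (lift a b)).
  by rewrite -[LHS]/(s (simplex_map R _ (vertex R _))) simplex_map_vertex.
rewrite /prism face_lifting//.
- move=> {i}n y a b a' b' eb ea; rewrite /marked_face /=; congr (_, _).
    apply: cts_eq => t.
    rewrite -[LHS]/(y.1 (cts_comp (simplex_map R (lift a)) (simplex_map R (lift b')) t)).
    rewrite -[RHS]/(y.1 (cts_comp (simplex_map R (lift b)) (simplex_map R (lift a')) t)).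
    rewrite !simplex_mapM; congr (y.1 (simplex_map R _ t)); apply/funext => j /=.
    exact: lift_lift.
  by apply/funext => j; rewrite (lift_lift eb ea).
- move=> n y a b.
  rewrite -[LHS]/(if y.2 (lift a b) then em_pt K else f (face a y.1 (vertex R b))).
  by rewrite face_vertex.
- by move=> n y a py b; rewrite /= !py.
- move=> n y a py; rewrite /marked_pure -[(marked_face a y).2 ord0]/(y.2 (lift a ord0)) py.
  case: (y.2 ord0); last exact: face_comp.
  exact: bar_labels_face.
- by move=> n y a py; exact: marked_pure_vertex.
- by move=> y; have [] := marked_pathP y.
- by move=> y; have [] := marked_pathP y.
- by move=> y py; rewrite /marked_path; case: pselect.
- move=> y; have [_ _ ->] := marked_pathP (marked_face (lift ord0 ord0) y).
  have [_ _ ->] := marked_pathP (marked_face ord_max y).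
  have [_ _ ->] := marked_pathP (marked_face ord0 y).
  have lab a b : marked_label (marked_face a y) b = marked_label y (lift a b).
    rewrite -[LHS]/(if y.2 (lift a b) then 0 else chi (face a y.1 (vertex R b))).
    by rewrite face_vertex.
  rewrite !lab /= (cocycle1 hphi).
  have -> : lift (lift ord0 ord0) ord_max = ord_max :> 'I_3 by exact: val_inj.
  have -> : lift (lift ord0 ord0) ord0 = ord0 :> 'I_3 by exact: val_inj.
  have -> : lift ord_max ord_max = lift ord0 ord0 :> 'I_3 by exact: val_inj.
  have -> : lift ord_max ord0 = ord0 :> 'I_3 by exact: val_inj.
  have -> : lift ord0 ord_max = ord_max :> 'I_3 by exact: val_inj.
  rewrite !addrA; move: (phi _) (phi _) (marked_label _ _) (marked_label _ _) (marked_label _ _).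
  move=> p q a b c.
  by rewrite [RHS](ACl (1*4*5*3*(2*6))) /= subrr addr0.
(* A simplex that is not pure has a marked vertex, which goes to the base point. *)
move=> n y npy; apply: contrapT => h; apply: npy => j.
have hf l : y.2 l = false.
  by apply/negP => yl; apply: h; exists l; rewrite /marked_vertex yl.
by rewrite !hf.
Qed.

Lemma prism_false k (s : singular R k N) : prism (s, fun=> false) = cts_comp f s.
Proof. by rewrite /prism lifting_P// => [y i py|y py]; [exact: marked_pure_vertex|rewrite /marked_path; case: pselect]. Qed.

Lemma prism_true k (s : singular R k N) : prism (s, fun=> true) = bar K (labels s).
Proof. by rewrite /prism lifting_P// => [y i py|y py]; [exact: marked_pure_vertex|rewrite /marked_path; case: pselect]. Qed.

Local Notation cylinder := (simplex R 1 * N)%type.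

Definition prism_simplex k (s : singular R k cylinder) : singular R k K :=
  prism (cts_comp (@cts_snd (simplex R 1) N) s,
         fun i => (s (vertex R i)).1 == v1 R).

Lemma face_prism_simplex k (s : singular R k.+1 cylinder) i :
  face i (prism_simplex s) = prism_simplex (face i s).
Proof.
rewrite /prism_simplex face_prism; congr prism; rewrite /marked_face.
congr (_, _); first exact: face_comp.
apply/funext => j; rewrite [LHS]/=.
by rewrite -[face i s (vertex R j)]/(s (simplex_map R _ (vertex R _))) simplex_map_vertex.
Qed.

Definition prism_chain k (c : chain R k cylinder) : chain R k K :=
  evaluate (fun s => gen (prism_simplex s)) c.

Lemma boundary_prism_chain k (c : chain R k.+1 cylinder) :
  boundary (prism_chain c) = prism_chain (boundary c).
Proof.
rewrite /prism_chain evaluate_boundary.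
rewrite (evaluate_comp (@boundary R K k.+1)); apply: eq_evaluate => s.
rewrite -[LHS]/(boundary (gen (prism_simplex s))).
by rewrite boundaryU; apply: eq_bigr => i _; rewrite face_prism_simplex.
Qed.

(** With [p = 0] only the vertical path exists. *)
Lemma shuffle_vertex k (c : singular R 0 (simplex R 1)) (s : singular R k N) :
  shuffle k c s = (<< cts_pair (cst (c (vertex R ord0))) s >> :
    {freeg (singular R k cylinder) / int}).
Proof.
have path0 G r a b (F : seq (nat * nat) -> G) :
    path_sum r 0 a b F = F [seq (a, b + j)%N | j <- iota 0 r.+1].
  elim: r b F => [|r IH] b F; first by rewrite /= addn0.
  rewrite [LHS]/= add0r mulr1z IH.
  have -> : iota 0 r.+2 = 0%N :: map (addn 1) (iota 0 r.+1) by rewrite -iotaDl.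
  rewrite map_cons addn0 -map_comp; congr (F (_ :: _)); apply: eq_map => j /=.
  by rewrite add1n addSnnS.
rewrite /shuffle path0; congr (<< _ >>); rewrite /lattice_simplex.
congr cts_pair; first by apply: cts_eq => t; rewrite /cts_comp /=; congr (c _); exact: simplex0_eq.
rewrite (_ : simplex_map R _ = idfun); first exact: cts_eq.
rewrite -affine_vertex -affine_vertex_id; congr affine; apply/funext => i; congr vertex.
by rewrite (nth_map 0%N) ?size_iota// nth_iota// !add0n /= inord_val.
Qed.

(** As [z] is a cycle, the boundary of the interval times [z] is the difference of its two ends, and
    [prism] carries it to a boundary in [K], where [theta] vanishes. *)
Lemma evaluate_push_bar k G (theta : cochain R K G k) (z : chain R k N) :
  theta \in @cocycle R K G k -> z \in @Defs.cycle R N k ->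
  evaluate theta (chain_push f z) = evaluate (fun s => theta (bar K (labels s))) z.
Proof.
move=> htheta /eqP hz.
pose iota1 : singular R 1 (simplex R 1) := idfun.
pose c := (gen iota1).
have : evaluate theta (prism_chain (boundary (shuffle_chain k.+1 c z))) = 0.
  by rewrite -boundary_prism_chain cocycle_boundary.
rewrite boundary_shuffle_chain// hz shuffle_chain0r mul0rz addr0 boundary1U shuffle_chainBl.
rewrite /prism_chain evaluate_chainB evaluate_chainB.
have ev x : evaluate theta (prism_chain (shuffle_chain k
     (gen (cst x : singular R 0 (simplex R 1))) z)) =
   evaluate (fun s => theta (prism (s, fun=> x == v1 R))) z.
  rewrite /shuffle_chain evaluateU /prism_chain.
  rewrite (evaluate_comp (evaluate (fun s => gen (prism_simplex s)))).
  rewrite (evaluate_comp (evaluate theta)); apply: eq_evaluate => s.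
  rewrite -[LHS]/(evaluate theta (evaluate
    (fun s => gen (prism_simplex s)) (shuffle k (cst x) s))).
  rewrite shuffle_vertex !evaluateU; congr (theta (prism (_, _))); exact: cts_eq.
rewrite -!/(prism_chain _) !ev /iota1 /= eqxx.
have -> : (v0 R == v1 R) = false.
  apply/negP => /eqP/(congr1 (fun t => crd t ord0)); rewrite !crd_vertex /= => /eqP.
  by rewrite oner_eq0.
move=> /eqP; rewrite subr_eq0 => /eqP e.
rewrite evaluate_push.
have -> : evaluate (fun s => theta (cts_comp f s)) z =
    evaluate (fun s => theta (prism (s, fun=> false))) z.
  by apply: eq_evaluate => s; rewrite prism_false.
by rewrite -e; apply: eq_evaluate => s; rewrite prism_true.
Qed.

End Prism.

Section Uniqueness.
Variables (R : realType) (A : zmodType) (K : EM_space R A) (N : topologicalType).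

Lemma pull_em_cochain (f : continuousType N K) (phi : cochain R N A 1) :
  phi \in @cocycle R N A 1 ->
  pull f (em_class K) = sq_class (@cocycle R N A 1) (@cobounding R N A 1) phi ->
  exists chi : N -> A, forall s : singular R 1 N,
    em (cts_comp f s) = phi s + chi (s (v1 R)) - chi (s (v0 R)).
Proof.
move=> hphi e.
have hf : (fun s => em (cts_comp f s)) \in @cocycle R N A 1.
  by apply: pull_cocycle; exact: em_cocycle.
have h1 := sq_repr_class (@cobounding R N A 1) hphi.
have h2 := sq_repr_class (@cobounding R N A 1) hf.
have /cobounding1P[chi hchi] : ((fun s => em (cts_comp f s)) : cochain R N A 1) - phi
    \in @cobounding R N A 1.
  have -> : ((fun s => em (cts_comp f s)) : cochain R N A 1) - phi =
     (sq_repr (sq_class (@cocycle R N A 1) (@cobounding R N A 1) phi) - phi)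
     - (sq_repr (sq_class (@cocycle R N A 1) (@cobounding R N A 1)
         (fun s => em (cts_comp f s))) - (fun s => em (cts_comp f s))).
    by rewrite -[sq_class _ _ (fun s => em (cts_comp f s))]/(pull f (em_class K)) e
      opprB [RHS]addrC addrA subrK.
  exact: rpredB.
exists chi => s; rewrite -addrA -hchi.
by rewrite -[(_ - phi) s]/(em (cts_comp f s) - phi s) addrC subrK.
Qed.

(* Maps to [K] with the same class in degree one agree on cohomology: both are
   chain homotopic to the map through the nerve given by a common cocycle. *)
Lemma pull_em_inj (f g : continuousType N K) k G (a : cohomology R K G k)
    (c : homology R N k) : pull f (em_class K) = pull g (em_class K) ->
  pairing (pull f a) c = pairing (pull g a) c.
Proof.
move=> e.
pose phi := sq_repr (pull f (em_class K)).
have hphi : phi \in @cocycle R N A 1 by exact: sq_repr_in.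
have [chi hf] := @pull_em_cochain f phi hphi (esym (sq_reprK _)).
have [chi' hg] := @pull_em_cochain g phi hphi (etrans (esym e) (esym (sq_reprK _))).
have ha : sq_repr a \in @cocycle R K G k by exact: sq_repr_in.
have hc : sq_repr c \in @Defs.cycle R N k by exact: sq_repr_in.
rewrite !pairing_pull /push !pairing_classr ?push_cycle//.
by rewrite (evaluate_push_bar hphi hf ha hc) (evaluate_push_bar hphi hg ha hc).
Qed.

End Uniqueness.

(** * Manifolds and classifying maps *)

Section SimpleOpens.
Variables (R : realType) (X : topologicalType).

Definition inside n (V : set X) (s : singular R n X) : Prop := forall t, V (s t).

(* The only properties of coordinate balls that matter. *)
Record simple_open (V : set X) : Prop := SimpleOpen {
  simple_openP : open V;
  simple_join : forall x y, V x -> V y ->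
    exists s : singular R 1 X, [/\ inside V s, s (v0 R) = x & s (v1 R) = y];
  simple_potential : forall G (phi : cochain R X G 1),
    phi \in @cocycle R X G 1 -> exists psi : X -> G,
    forall s : singular R 1 X, inside V s -> phi s = psi (s (v1 R)) - psi (s (v0 R))
}.

Lemma finite_subcover (U : X -> set X) : compact [set: X] -> (forall x, nbhs x (U x)) ->
  exists s : seq X, forall z, exists2 y, y \in s & U y z.
Proof.
move=> /compact_near_coveringP cX hU.
pose F := filter_from [set: seq X] (fun s0 : seq X => [set s : seq X | {subset s0 <= s}]).
have FF : Filter F.
  apply: filter_from_filter; first by exists [::].
  move=> s1 s2 _ _; exists (s1 ++ s2) => // s ss /=; split=> x xs; apply: ss;
    by rewrite mem_cat xs ?orbT.
have [|s0 _ hs0] := cX _ F (fun s z => exists2 y, y \in s & U y z) FF.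
  move=> x _; exists (U x, [set s : seq X | x \in s]); first split => /=.
  - exact: hU.
  - by exists [:: x] => // s ss /=; apply: ss; rewrite mem_seq1.
  by move=> [z s] [/= Uz xs]; exists x.
by exists s0 => z; exact: (hs0 s0).
Qed.

End SimpleOpens.

Section ChartBalls.
Variables (R : realType) (d : nat) (X : topologicalType).
Variable c : chart R d X.
Variable x : X.
Hypothesis cx : chart_dom c x.
Let y0 := chart_fun c x.

Definition chart_ball (r : R) : set X :=
  [set z | chart_dom c z /\ `|chart_fun c z - y0| < r].

Variable e : R.
Hypothesis e0 : 0 < e.
Hypothesis he : forall y, `|y - y0| < e -> chart_img c y.

Lemma chart_ball_open r : open (chart_ball r).
Proof.
rewrite openE => z [dz hz]; apply: filterI.
  by apply: open_nbhs_nbhs; split => //; exact: chart_dom_open.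
have h : nbhs (chart_fun c z) (ball y0 r).
  apply: open_nbhs_nbhs; split; first exact: ball_open.
  by rewrite -ball_normE /ball_ /= distrC.
apply: (@filterS _ (nbhs z) _ (chart_fun c @^-1` ball y0 r)).
  by move=> w; rewrite /preimage /= -ball_normE /ball_ /= distrC.
exact: (chart_fun_continuous dz h).
Qed.

Lemma chart_inv_ball r y : r <= e -> `|y - y0| < r -> chart_ball r (chart_inv c y).
Proof.
move=> re yr; have yi : chart_img c y by apply: he; exact: lt_le_trans yr re.
by have [dy fy] := chart_invP yi; split=> //; rewrite fy.
Qed.

Lemma chart_path_continuous Y (f : Y -> 'rV[R]_d) :
  continuous f -> (forall y, `|f y - y0| < e) -> continuous (fun y => chart_inv c (f y)).
Proof.
move=> cf hf y; apply: continuous_comp; first exact: cf.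
by apply: chart_inv_continuous; exact: he.
Qed.

Lemma convex_ball (a b : 'rV[R]_d) r (u : R) : `|a - y0| < r -> `|b - y0| < r ->
  0 <= u <= 1 -> `|(1 - u) *: a + u *: b - y0| < r.
Proof.
move=> ha hb /andP[u0 u1].
have -> : (1 - u) *: a + u *: b - y0 = (1 - u) *: (a - y0) + u *: (b - y0).
  by rewrite !scalerBr addrACA -opprD -scalerDl subrK scale1r.
apply: le_lt_trans (ler_normD _ _) _; rewrite !normrZ ger0_norm ?subr_ge0// ger0_norm//.
have [->|un] := eqVneq u 0; first by rewrite subr0 mul1r mul0r addr0.
have u0' : 0 < u by rewrite lt_neqAle eq_sym un u0.
by nra.
Qed.

Lemma chart_segment_continuous Y (a b : Y -> 'rV[R]_d) (u : Y -> R) :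
  continuous a -> continuous b -> continuous u ->
  continuous (fun y => (1 - u y) *: a y + u y *: b y).
Proof.
move=> ca cb cu y; apply: cvgD; apply: cvgZ; [|exact: ca|exact: cu|exact: cb].
by apply: cvgB; [exact: cvg_cst|exact: cu].
Qed.

(** Balls are convex in the chart: straight segments join points, and the potential at a point is
    the value of [phi] on the radius to it. *)
Lemma chart_ball_simple r : 0 < r <= e -> simple_open R (chart_ball r).
Proof.
move=> /andP[r0 re]; split; first exact: chart_ball_open.
  move=> z w [dz hz] [dw hw].
  pose f (t : simplex R 1) := (1 - crd t ord_max) *: chart_fun c z + crd t ord_max *: chart_fun c w.
  have cf : continuous f.
    by apply: chart_segment_continuous; [exact: cst_continuous|exact: cst_continuous|exact: crd_continuous].
  have hf t : `|f t - y0| < r by apply: convex_ball => //; rewrite crd_ge0 crd_le1.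
  have cif := chart_path_continuous cf (fun t => lt_le_trans (hf t) re).
  pose s : singular R 1 X := mkcts cif.
  exists s; split.
  - by move=> t; exact: chart_inv_ball.
  - rewrite -[LHS]/(chart_inv c (f (v0 R))) /f crd_vertex subr0 scale1r scale0r addr0.
    exact: (chart_funP dz).2.
  - rewrite -[LHS]/(chart_inv c (f (v1 R))) /f crd_vertex eqxx subrr scale0r scale1r add0r.
    exact: (chart_funP dw).2.
move=> G phi hphi.
pose rf z (t : simplex R 1) := (1 - crd t ord_max) *: y0 + crd t ord_max *: chart_fun c z.
have crf z : continuous (rf z).
  by apply: chart_segment_continuous; [exact: cst_continuous|exact: cst_continuous|exact: crd_continuous].
have y0r : `|y0 - y0| < r by rewrite subrr normr0.
have hrf z t : chart_ball r z -> `|rf z t - y0| < e.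
  move=> [_ hz]; apply: lt_le_trans re.
  by apply: convex_ball => //; rewrite crd_ge0 crd_le1.
pose rad z : singular R 1 X :=
  if pselect (chart_ball r z) is left h
  then mkcts (chart_path_continuous (crf z) (fun t => hrf z t h)) else cst x.
exists (fun z => phi (rad z)) => s hs.
(* The cone over [s] from the centre, a square whose side over [v0] is collapsed. *)
pose hf (y : simplex R 1 * simplex R 1) := rf (s y.2) y.1.
have chf : continuous hf.
  apply: chart_segment_continuous.
  - exact: cst_continuous.
  - move=> y; apply: (@continuous_comp _ _ _ (fun y => s y.2) (chart_fun c)).
      by apply: (@continuous_comp _ _ _ snd s); [exact: cvg_snd|exact: cts_fun].
    by apply: chart_fun_continuous; have [] := hs y.2.
  - by move=> y; apply: (@continuous_comp _ _ _ fst (fun t => crd t ord_max)); [exact: cvg_fst|exact: crd_continuous].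
have hhf y : `|hf y - y0| < e by have := hrf (s y.2) y.1 (hs y.2).
pose H : continuousType _ X := mkcts (chart_path_continuous chf hhf).
have H0 t : H (v0 R, t) = x.
  rewrite -[LHS]/(chart_inv c (rf (s t) (v0 R))) /rf crd_vertex subr0 scale1r scale0r addr0.
  exact: (chart_funP cx).2.
have side q : segment2 H (v0 R, q) (v1 R, q) = rad (s q).
  apply: cts_eq => t; rewrite -[LHS]/(chart_inv c (rf (s (affine (pair_fun q q) t))
    (affine (pair_fun (v0 R) (v1 R)) t))) affine_const affine_v01 /rad.
  by case: pselect => // -[]; exact: hs.
have top : segment2 H (v1 R, v0 R) (v1 R, v1 R) = s.
  apply: cts_eq => t; rewrite -[LHS]/(chart_inv c (rf (s (affine (pair_fun (v0 R) (v1 R)) t))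
    (affine (pair_fun (v1 R) (v1 R)) t))) affine_const affine_v01 /rf crd_vertex eqxx subrr scale0r add0r scale1r.
  by apply: (chart_funP _).2; have [] := hs t.
have := cocycle_contract hphi H0; rewrite !side top => ->.
by rewrite addrAC subrr add0r.
Qed.

(** The set is a compact image in a Hausdorff space, hence closed in [X] and not merely in the chart
    domain; this lets a bump function be extended by zero. *)
Lemma chart_closed_ball_closed r : hausdorff_space X -> 0 < r < e ->
  closed [set z | chart_dom c z /\ `|chart_fun c z - y0| <= r].
Proof.
move=> hX /andP[r0 re].
rewrite (_ : [set z | _ /\ _] = chart_inv c @` closed_ball_ Num.norm y0 r); last first.
  apply/seteqP; split=> [z [dz hz]|z [y hy <-]].
    exists (chart_fun c z); first by rewrite /closed_ball_ /= distrC.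
    exact: (chart_funP dz).2.
  rewrite /closed_ball_ /= distrC in hy.
  have yi : chart_img c y by apply: he; exact: le_lt_trans hy re.
  by have [dy fy] := chart_invP yi; split=> //; rewrite fy.
apply: compact_closed => //; apply: continuous_compact.
  apply: continuous_in_subspaceT => y /set_mem; rewrite /closed_ball_ /= distrC => hy.
  by apply: chart_inv_continuous; apply: he; exact: le_lt_trans hy re.
apply: bounded_closed_compact; last exact: closed_closed_ball_.
exists (`|y0| + r); split; first by rewrite num_real.
move=> M hM y; rewrite /closed_ball_ /= => hy; apply: ltW; apply: le_lt_trans hM.
rewrite -[y](subrK y0) addrC (le_trans (ler_normD _ _))// lerD2l distrC.
exact: hy.
Qed.

End ChartBalls.

Section ManifoldTopology.
Variables (R : realType) (d : nat) (X : topologicalType).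
Hypothesis hX : closed_manifold R d X.

Lemma small_chart_ball x (O : set X) : nbhs x O ->
  exists c : chart R d X, chart_dom c x /\ exists e : R, [/\ 0 < e,
    forall y, `|y - chart_fun c x| < e -> chart_img c y & chart_ball c x e `<=` O].
Proof.
move=> xO; have [c cx] := manifold_locally_euclidean hX x; exists c; split=> //.
have [yi xi] := chart_funP cx.
have n1 : nbhs (chart_fun c x) (chart_img c).
  by apply: open_nbhs_nbhs; split=> //; exact: chart_img_open.
have n2 : nbhs (chart_fun c x) (chart_inv c @^-1` O).
  by apply: (chart_inv_continuous yi); rewrite xi.
have : nbhs (chart_fun c x) (chart_img c `&` chart_inv c @^-1` O) by exact: filterI.
move=> /nbhs_ballP[/= e e0 he].
exists e; split=> // [y hy|z [dz hz]].
  by have [] : (chart_img c `&` chart_inv c @^-1` O) y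
    by apply: he; rewrite -ball_normE /ball_ /= distrC.
have [_] : (chart_img c `&` chart_inv c @^-1` O) (chart_fun c z).
  by apply: he; rewrite -ball_normE /ball_ /= distrC.
by rewrite /preimage /= (chart_funP dz).2.
Qed.

Lemma simple_basis x (O : set X) : nbhs x O ->
  exists V, [/\ simple_open R V, V x & V `<=` O].
Proof.
move=> /small_chart_ball[c [cx [e [e0 he hO]]]].
exists (chart_ball c x e); split=> //; first by apply: (chart_ball_simple cx he); rewrite e0 lexx.
by split=> //; rewrite subrr normr0.
Qed.

Lemma manifold_bump x : exists V (lam : X -> R) C,
  [/\ simple_open R V, continuous lam /\ (forall z, 0 <= lam z), 0 < lam x, closed C &
      C `<=` V /\ forall z, ~ C z -> lam z = 0].
Proof.
have [c [cx [e [e0 he _]]]] := small_chart_ball (filterT : nbhs x setT).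
pose V := chart_ball c x e; pose r := e / 2.
have r0 : 0 < r by rewrite divr_gt0.
have re : r < e by rewrite ltr_pdivrMr// ltr_pMr// ltr1n.
pose C := [set z | chart_dom c z /\ `|chart_fun c z - chart_fun c x| <= r].
pose bmp z : R := Num.max 0 (r - `|chart_fun c z - chart_fun c x|).
pose lam z : R := if pselect (V z) then bmp z else 0.
have cC : closed C by apply: (chart_closed_ball_closed he (manifold_hausdorff hX)); rewrite r0 re.
have CV : C `<=` V by move=> z [dz hz]; split=> //; exact: le_lt_trans hz re.
have lam0 z : ~ C z -> lam z = 0.
  rewrite /lam; case: pselect => // -[dz hz] nC; rewrite /bmp max_l// subr_le0 leNgt.
  by apply/negP => h; apply: nC; split=> //; exact: ltW.
have sV : simple_open R V by apply: (chart_ball_simple cx he); rewrite e0 lexx.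
exists V, lam, C; split=> //.
  split; last by move=> z; rewrite /lam; case: pselect => [h|h] //; rewrite le_max lexx.
  move=> z; have [Vz|nVz] := pselect (V z).
    have cb : {for z, continuous bmp}.
      apply: (@continuous_max R X (fun _ => 0) (fun z => r - `|chart_fun c z - chart_fun c x|)).
        exact: cst_continuous.
      apply: continuousB; first exact: cst_continuous.
      apply: (@continuous_comp _ _ _ (fun z => chart_fun c z - chart_fun c x) Num.norm).
        apply: continuousB; last exact: cst_continuous.
        by apply: chart_fun_continuous; case: Vz.
      exact: norm_continuous.
    have e1 : lam z = bmp z by rewrite /lam; case: pselect.
    rewrite /continuous_at e1; apply: cvg_trans cb; apply: near_eq_cvg.
    have : nbhs z V by apply: open_nbhs_nbhs; split=> //; exact: (simple_openP sV).
    by apply: filterS => w Vw; rewrite /lam; case: pselect.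
  have nCz : ~ C z by move=> /CV.
  rewrite /continuous_at (lam0 _ nCz); apply: cvg_near_cst.
  have : nbhs z (~` C) by apply: open_nbhs_nbhs; split=> //; exact: closed_openC.
  by apply: filterS => w /lam0.
rewrite /lam; case: pselect => [h|[]]; first by rewrite /bmp subrr normr0 subr0 lt_max r0 orbT.
by split=> //; rewrite subrr normr0.
Qed.

Lemma manifold_joinable : connected [set: X] -> joinable R X.
Proof.
move=> cX x y.
pose B := [set z | exists s : singular R 1 X, s (v0 R) = x /\ s (v1 R) = z].
have join_step z w V : simple_open R V -> V z -> V w -> B z -> B w.
  move=> sV Vz Vw [s [s0 s1]]; have [t [_ t0 t1]] := simple_join sV Vz Vw.
  have [u [u0 u1 _]] := concat_paths (etrans s1 (esym t0)).
  by exists u; rewrite u0 s0 u1.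
have oB : open B.
  rewrite openE => z Bz; have [V [sV Vz _]] := simple_basis (filterT : nbhs z setT).
  apply: (@filterS _ (nbhs z) _ V); first by move=> w Vw; exact: join_step sV Vz Vw Bz.
  by apply: open_nbhs_nbhs; split=> //; exact: (simple_openP sV).
have oC : open (~` B).
  rewrite openE => z Bz; have [V [sV Vz _]] := simple_basis (filterT : nbhs z setT).
  apply: (@filterS _ (nbhs z) _ V); first by move=> w Vw Bw; apply: Bz; exact: join_step sV Vw Vz Bw.
  by apply: open_nbhs_nbhs; split=> //; exact: (simple_openP sV).
suff e : B = setT by rewrite -[_ _]/(B y) e.
apply: cX.
- by exists x, (cst x : singular R 1 X).
- by exists B; rewrite ?setTI.
- by exists B; rewrite ?setTI// -[B]setCK; exact: open_closedC.
Qed.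

End ManifoldTopology.

Section ClassifyingMap.
Variables (R : realType) (A : zmodType) (K : EM_space R A).

Lemma coboundary_cocycle X (chi : X -> A) :
  (fun s : singular R 1 X => chi (s (v1 R)) - chi (s (v0 R))) \in @cocycle R X A 1.
Proof.
apply/cocycleP => T.
have fv i j : face i T (vertex R j) = T (vertex R (lift i j)).
  by rewrite -[LHS]/(T (simplex_map R _ (vertex R _))) simplex_map_vertex.
rewrite !big_ord_recl big_ord0 addr0 mulr1z expr1 mulrN1z.
rewrite -[_ ^+ _]/((-1) ^+ 2) sqrrN expr1n mulr1z /v0 /v1 !fv.
have -> : lift ord0 (lift ord0 ord0) = ord_max :> 'I_3 by exact: val_inj.
have -> : lift (lift ord0 ord0) ord_max = ord_max :> 'I_3 by exact: val_inj.
have -> : lift (lift ord0 ord0) ord0 = ord0 :> 'I_3 by exact: val_inj.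
have -> : lift ord_max ord_max = lift ord0 ord0 :> 'I_3 by exact: val_inj.
have -> : lift ord_max ord0 = ord0 :> 'I_3 by exact: val_inj.
have -> : lift ord0 ord_max = ord_max :> 'I_3 by exact: val_inj.
by rewrite opprB !addrA [LHS](ACl ((1*4)*(5*2)*(3*6))) /= !subrr !addr0.
Qed.

(** An edge that misses some vertex lies in the opposite face, so the induction ends with the
    1-simplex and its orientation. *)
Lemma em_bar_edge k (psi : 'I_k.+1 -> A) (a b : 'I_k.+1) :
  em (segment (bar K psi) (vertex R a) (vertex R b)) = psi b - psi a.
Proof.
elim: k psi a b => [|k IH] psi a b.
  by rewrite [a]ord1 [b]ord1 subrr (cocycle_point (@em_cocycle R A K)).
have [->|ab] := eqVneq a b; first by rewrite subrr (cocycle_point (@em_cocycle R A K)).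
have [/existsP[j /andP[ja jb]]|] := boolP [exists j : 'I_k.+2, (j != a) && (j != b)].
  have [a' ea _] := unlift_some ja.
  have [b' eb _] := unlift_some jb.
  rewrite ea eb -(IH (fun i => psi (lift j i))) -face_bar; congr em.
  apply: cts_eq => t.
  rewrite -[RHS]/(bar K psi (simplex_map R (lift j)
     (affine (pair_fun (vertex R a') (vertex R b')) t))).
  apply: (congr1 (bar K psi)); rewrite -affine_vertex.
  rewrite -[RHS]/(cts_comp (affine _) (affine _) t) affineM.
  congr (affine _ t); apply/funext => l; rewrite /pair_fun.
  by case: eqP => _; rewrite affine_at_vertex.
case: k psi a b {IH} ab => [|k] psi a b ab nex; last first.
  case/negP: nex; have : (2 < #|'I_k.+3|)%N by rewrite card_ord.
  have := cardsC [set a; b]%SET; rewrite cards2 ab => <-; rewrite -addn1 leq_add2l card_gt0.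
  case/set0Pn => j; rewrite !finset.inE negb_or => h; apply/existsP; by exists j.
have emx := em_cocycle K.
have edgeE : em (segment (bar K psi) (vertex R ord0) (vertex R ord_max)) =
    psi ord_max - psi ord0.
  by rewrite -(em_bar K) -[RHS](congr1 (@em R A K) (segment_id _)).
move: ab; have [->|->] := ord2P a; have [->|->] := ord2P b; rewrite ?eqxx// => _.
by rewrite (cocycle_rev emx) edgeE opprB.
Qed.

Variables (d : nat) (X : topologicalType).
Hypothesis hX : closed_manifold R d X.
Variable phi : cochain R X A 1.
Hypothesis hphi : phi \in @cocycle R X A 1.

(* A partition of unity [lam] subordinate to coordinate balls, with potentials
   [psi] of [phi] on them, is a map to the nerve of [A]: up to a constant, the
   labels [psi] are locally constant where [lam] does not vanish. *)
Lemma classifying_cochain : exists f : continuousType X K,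
  pull f (em_class K) = sq_class (@cocycle R X A 1) (@cobounding R X A 1) phi.
Proof.
have embed (f : continuousType X K) :
    (exists chi : X -> A, forall s : singular R 1 X,
       em (cts_comp f s) - phi s = chi (s (v1 R)) - chi (s (v0 R))) ->
    pull f (em_class K) = sq_class (@cocycle R X A 1) (@cobounding R X A 1) phi.
  move=> h; apply: sq_class_eq => //; first by apply: pull_cocycle; exact: em_cocycle.
  exact/cobounding1P.
have [V /choice[lam /choice[C hb]]] := choice (manifold_bump hX).
have hU x : nbhs x [set z | 0 < lam x z].
  have [_ [cl _] lx _ _] := hb x.
  apply: open_nbhs_nbhs; split=> //.
  by move/continuousP : cl => /(_ [set y | 0 < y]); apply; exact: open_gt.
have [s hs] := finite_subcover (manifold_compact hX) hU.
(* An empty cover means that [X] is empty; otherwise the list is nonempty and its length is the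
   number of vertices of a simplex. *)
case: s hs => [|x0 s] hs.
  exists (cst (em_pt K) : continuousType X K); apply: embed; exists (fun=> 0) => t.
  by have [] := hs (t (v0 R)).
pose n := size s; pose c (i : 'I_n.+1) := nth x0 (x0 :: s) i.
pose L i := lam (c i).
have covL z : exists i, 0 < L i z.
  have [y ys yz] := hs z; have iy : (index y (x0 :: s) < n.+1)%N by rewrite index_mem.
  by exists (Ordinal iy); rewrite /L /c nth_index.
have L0 i z : 0 <= L i z by have [_ [_ h] _ _ _] := hb (c i); exact: h.
have cL i : continuous (L i) by have [_ [h _] _ _ _] := hb (c i).
pose S z := \sum_i L i z.
have S0 z : 0 < S z.
  have [i hi] := covL z; rewrite /S (bigD1 i)//= ltr_pwDl//.
  by apply: sumr_ge0 => j _.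
have cS : continuous (fun z => (S z)^-1).
  by apply: ctsV => [z|]; [rewrite gt_eqF|exact: continuous_sumr].
pose Lam z : simplex R n := to_simplex (fun i => L i z / S z).
have crdLam z i : crd (Lam z) i = L i z / S z.
  rewrite crd_to_simplex// => [j|]; first by rewrite divr_ge0// ltW.
  by rewrite -mulr_suml -[\sum_i _]/(S z) divff// gt_eqF.
have cLam : continuous Lam.
  by apply: simplex_continuous => i; under eq_fun do rewrite crdLam; have cLi := cL i; cts.
have [psi hpsi] := choice (fun i => simple_potential (let: And5 h _ _ _ _ := hb (c i) in h) hphi).
(* With this sign the pulled back class is that of [phi] and not of its opposite. *)
pose lab z (i : 'I_n.+1) : A := - psi i z.
pose f0 z : K := bar K (lab z) (Lam z).
(* Near [x] a weight can be nonzero only if its closed support [C] contains [x], and then the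
   neighbourhood lies in the domain [V] of the corresponding potential. *)
have local x : exists W, [/\ simple_open R W, W x, forall z i, W z -> L i z != 0 -> C (c i) x
    & forall z i, W z -> C (c i) x -> V (c i) z].
  pose O := [set z | forall i : 'I_n.+1, (if pselect (C (c i) x) then V (c i) else ~` C (c i)) z].
  have xO : nbhs x O.
    apply: (@filter_forall _ _
      (fun i z => (if pselect (C (c i) x) then V (c i) else ~` C (c i)) z) (nbhs x) (nbhs_filter x)) => i.
    have [sV _ _ cC [CV _]] := hb (c i); apply: open_nbhs_nbhs.
    case: pselect => h; split=> //; [exact: (simple_openP sV)|exact: CV|exact: closed_openC].
  have [W [sW Wx WO]] := simple_basis hX xO.
  exists W; split=> // z i Wz.
    move=> Lz; have := WO z Wz i; case: pselect => // h nC.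
    have [_ _ _ _ [_ h0]] := hb (c i).
    by move: Lz; rewrite /L h0// eqxx.
  by move=> Cx; have := WO z Wz i; case: pselect.
have [W hW] := choice local.
(* Two points of [W x] are joined inside it, and all the relevant potentials change by the value of
   [phi] on the joining path. *)
have [shift hshift] : exists sh : X -> X -> X -> A, forall x z w i,
    W x z -> W x w -> C (c i) x -> lab w i = lab z i - sh x z w.
  have /choice[sh hsh] : forall y : X * X * X, exists a : A, forall i,
      W y.1.1 y.1.2 -> W y.1.1 y.2 -> C (c i) y.1.1 -> lab y.2 i = lab y.1.2 i - a.
    move=> [[x z] w] /=; have [sW Wx _ hV] := hW x.
    have [[Wz Ww]|nW] := pselect (W x z /\ W x w); last first.
      by exists 0 => i Wz Ww; case: nW.
    have [t [tW t0 t1]] := simple_join sW Wz Ww.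
    exists (phi t) => i _ _ Cx; rewrite (hpsi i t) ?t0 ?t1; last by move=> u; apply: hV.
    by rewrite /lab opprB addrA addNr add0r.
  by exists (fun x z w => sh (x, z, w)) => x z w i; exact: (hsh (x, z, w)).
have agree x z (t : simplex R n) : W x z -> (forall i, crd t i != 0 -> C (c i) x) ->
    bar K (lab z) t = bar K (lab x) t.
  move=> Wz ht; have [sW Wx _ _] := hW x.
  by apply: (@bar_agree _ _ _ _ _ _ (- shift x x z)) => i /ht; exact: hshift.
have Lam_supp x z i : W x z -> crd (Lam z) i != 0 -> C (c i) x.
  move=> Wz; have [_ _ h _] := hW x; rewrite crdLam => LS; apply: (h z) => //.
  by apply: contraNneq LS => ->; rewrite mul0r.
have f0E x z : W x z -> f0 z = bar K (lab x) (Lam z).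
  by move=> Wz; apply: agree => // i; exact: Lam_supp Wz.
have Wn x : nbhs x (W x).
  by have [sW Wx _ _] := hW x; apply: open_nbhs_nbhs; split=> //; exact: (simple_openP sW).
have cf0 : continuous f0.
  move=> x; have [sW Wx _ _] := hW x.
  rewrite /continuous_at (f0E x x Wx).
  have : {for x, continuous (fun z => bar K (lab x) (Lam z))}.
    by apply: (@continuous_comp _ _ _ Lam (bar K (lab x))); [exact: cLam|exact: cts_fun].
  apply: cvg_trans; apply: near_eq_cvg; apply: (@filterS _ (nbhs x) _ (W x)); last exact: Wn.
  by move=> z Wz; rewrite (f0E x z Wz).
pose f : continuousType X K := mkcts cf0.
exists f; apply: embed.
have emx := em_cocycle K.
(* By [chiE] any vertex may replace [ord0]; near [x] an index relevant there is taken, whose label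
   changes as the potential does. *)
pose chi z := em (segment (bar K (lab z)) (vertex R ord0) (Lam z)) + lab z ord0.
exists chi.
have chiE z i : chi z = em (segment (bar K (lab z)) (vertex R i) (Lam z)) + lab z i.
  rewrite /chi (cocycle_triangle emx _ _ (vertex R i)) em_bar_edge.
  by rewrite addrAC subrK addrC.
pose kap : cochain R X A 1 :=
  (fun t => em (cts_comp f t)) - phi - (fun t => chi (t (v1 R)) - chi (t (v0 R))).
have hkap : kap \in @cocycle R X A 1.
  apply: rpredB; last exact: coboundary_cocycle.
  by apply: rpredB => //; apply: pull_cocycle; exact: emx.
suff h t : kap t = 0 by move=> t; apply/eqP; rewrite -subr_eq0; apply/eqP; exact: h.
apply: (cocycle_small_vanish hkap (U := W)) => // x {}t tW.
have [sW Wx hC hV] := hW x.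
have [i hi] : exists i, C (c i) x.
  by have [i hi] := covL x; exists i; apply: (hC x) => //; rewrite gt_eqF.
have segE z : W x z -> segment (bar K (lab z)) (vertex R i) (Lam z) =
    segment (bar K (lab x)) (vertex R i) (Lam z).
  move=> Wz; apply: cts_eq => u; apply: (agree x z) => // j.
  rewrite crd_affine_pair crd_vertex => hj.
  have [<-//|ij] := eqVneq i j; apply: (Lam_supp x z) => //.
  by apply: contraNneq hj => ->; rewrite (negbTE ij) !mulr0 addr0.
have e1 : cts_comp f t = cts_comp (bar K (lab x)) (cts_comp (mkcts cLam) t).
  by apply: cts_eq => u; exact: (f0E x).
have := cocycle_convex emx (bar K (lab x)) (vertex R i) (cts_comp (mkcts cLam) t).
rewrite -e1 -[_ (v1 R)]/(Lam (t (v1 R))) -[_ (v0 R)]/(Lam (t (v0 R))).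
rewrite -!segE; [|exact: tW|exact: tW] => e2.
rewrite -[kap t]/(em (cts_comp f t) - phi t - (chi (t (v1 R)) - chi (t (v0 R)))).
rewrite (chiE _ i) (chiE (t (v0 R)) i) e2.
rewrite (hpsi i t); last by move=> u; apply: hV.
have aux (E a b u : A) : E - (a - b) - (u + E - a - (u - b)) = 0.
  rewrite !(opprD, opprK) !addrA.
  by rewrite [LHS](ACl ((1*5)*(6*2)*(3*8)*(7*4))) /= !subrr !addr0.
exact: aux.
Qed.

End ClassifyingMap.

(** * Products *)

Section ProductClasses.
Variable R : realType.

Lemma segment_prod X Y (s : singular R 1 X) (t : singular R 1 Y) :
  segment2 (cts_prod s t) (v0 R, v0 R) (v1 R, v1 R) = cts_pair s t.
Proof.
apply: cts_eq => u.
rewrite -[LHS]/(s (affine (pair_fun (v0 R) (v1 R)) u), t (affine (pair_fun (v0 R) (v1 R)) u)).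
by rewrite -pair_fun_vertex affine_vertex_id.
Qed.

Lemma joinable_prod X Y : joinable R X -> joinable R Y ->
  joinable R (X * Y)%type.
Proof.
move=> jX jY [x y] [x' y']; have [s [s0 s1]] := jX x x'; have [t [t0 t1]] := jY y y'.
exists (cts_pair s t : singular R 1 (X * Y)%type); split.
  by rewrite -[LHS]/(s (v0 R), t (v0 R)) s0 t0.
by rewrite -[LHS]/(s (v1 R), t (v1 R)) s1 t1.
Qed.

Lemma cobounding_empty X G (phi : cochain R X G 1) :
  ~ (exists x : X, True) -> phi \in @cobounding R X G 1.
Proof.
by move=> h; apply/cobounding1P; exists (fun=> 0) => s; case: h; exists (s (v0 R)).
Qed.

(** The two classes are the restrictions to the axes through a base point. A loop is the diagonal of
    the square spanned by its projections, and the cocycle splits it into two sides, which lie on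
    the axes. *)
Lemma kunneth1 X Y G (a : cohomology R (X * Y)%type G 1) :
  joinable R X -> joinable R Y -> exists b c,
  a = pull (cts_fst X Y) b + pull (cts_snd X Y) c.
Proof.
move=> jX jY; pose phi := sq_repr a.
have hphi : phi \in @cocycle R (X * Y)%type G 1 by exact: sq_repr_in.
have [[[x0 y0] _]|nXY] := pselect (exists x : X * Y, True); last first.
  exists 0, 0; rewrite !raddf0 addr0 -(sq_reprK a) -(sq_reprK 0).
  by apply: sq_class_eq; rewrite ?sq_repr_in//; exact: cobounding_empty.
pose i1 : continuousType X (X * Y)%type := cts_pair idfun (cst y0).
pose i2 : continuousType Y (X * Y)%type := cts_pair (cst x0) idfun.
pose phi1 : cochain R X G 1 := fun s => phi (cts_comp i1 s).
pose phi2 : cochain R Y G 1 := fun s => phi (cts_comp i2 s).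
have h1 : phi1 \in @cocycle R X G 1 by exact: pull_cocycle.
have h2 : phi2 \in @cocycle R Y G 1 by exact: pull_cocycle.
have p1 : (fun s => phi1 (cts_comp (cts_fst X Y) s)) \in @cocycle R (X * Y)%type G 1.
  exact: pull_cocycle.
have p2 : (fun s => phi2 (cts_comp (cts_snd X Y) s)) \in @cocycle R (X * Y)%type G 1.
  exact: pull_cocycle.
exists (sq_class (@cocycle R X G 1) (@cobounding R X G 1) phi1).
exists (sq_class (@cocycle R Y G 1) (@cobounding R Y G 1) phi2).
rewrite !pull_class//; apply/eqP; rewrite -subr_eq; apply/eqP.
rewrite -(sq_reprK a) -sq_classB//; apply: sq_class_eq => //; first exact: rpredB.
apply: (@cocycle_vanish_loops _ _ (x0, y0)); first exact: joinable_prod.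
  by apply: rpredB => //; exact: rpredB.
move=> s s0 s1.
pose al : singular R 1 X := cts_comp (cts_fst X Y) s.
pose be : singular R 1 Y := cts_comp (cts_snd X Y) s.
have es : s = cts_pair al be by apply: cts_eq => t; exact: surjective_pairing.
rewrite -[LHS]/(phi s - phi2 be - phi1 al) es -segment_prod.
rewrite (cocycle_triangle2 _ hphi _ (v1 R, v0 R)).
have -> : segment2 (cts_prod al be) (v0 R, v0 R) (v1 R, v0 R) = cts_comp i1 al.
  apply: cts_eq => t.
  rewrite -[LHS]/(al (affine (pair_fun (v0 R) (v1 R)) t), be (affine (pair_fun (v0 R) (v0 R)) t)).
  by rewrite affine_const affine_v01 -[be _]/((s (v0 R)).2) s0.
have -> : segment2 (cts_prod al be) (v1 R, v0 R) (v1 R, v1 R) = cts_comp i2 be.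
  apply: cts_eq => t.
  rewrite -[LHS]/(al (affine (pair_fun (v1 R) (v1 R)) t), be (affine (pair_fun (v0 R) (v1 R)) t)).
  by rewrite affine_const affine_v01 -[al _]/((s (v1 R)).1) s1.
by rewrite -/(phi1 al) -/(phi2 be) addrK subrr.
Qed.

Variables (A : zmodType) (K : EM_space R A).

(** Classes of degree one are compared on loops at the base point, where [em_mul_pi1] gives the
    values. *)
Lemma em_mul_class : pull (em_mul K) (em_class K) =
  pull (cts_fst K K) (em_class K) + pull (cts_snd K K) (em_class K).
Proof.
have emx := em_cocycle K.
have h0 : (fun s => em (cts_comp (em_mul K) s)) \in @cocycle R (K * K)%type A 1.
  exact: pull_cocycle.
have h1 : (fun s => em (cts_comp (cts_fst K K) s)) \in @cocycle R (K * K)%type A 1.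
  exact: pull_cocycle.
have h2 : (fun s => em (cts_comp (cts_snd K K) s)) \in @cocycle R (K * K)%type A 1.
  exact: pull_cocycle.
apply/eqP; rewrite -subr_eq; apply/eqP.
rewrite /pull -sq_classB//; apply: sq_class_eq => //; first exact: rpredB.
apply: (@cocycle_vanish_loops _ _ (em_pt K, em_pt K)).
- by apply: joinable_prod; exact: joinable_em.
- by apply: rpredB => //; exact: rpredB.
move=> s s0 s1.
pose al : singular R 1 K := cts_comp (cts_fst K K) s.
pose be : singular R 1 K := cts_comp (cts_snd K K) s.
have es : s = cts_pair al be by apply: cts_eq => t; exact: surjective_pairing.
have a0 : al (v0 R) = em_pt K by rewrite -[al _]/((s (v0 R)).1) s0.
have a1 : al (v1 R) = em_pt K by rewrite -[al _]/((s (v1 R)).1) s1.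
have b0 : be (v0 R) = em_pt K by rewrite -[be _]/((s (v0 R)).2) s0.
have b1 : be (v1 R) = em_pt K by rewrite -[be _]/((s (v1 R)).2) s1.
rewrite -[LHS]/(em (cts_comp (em_mul K) s) - em be - em al) es.
have := em_mul_pi1 (loop_spheroid a0 a1) (loop_spheroid b0 b1).
rewrite !pairing_em ?a0 ?a1 ?b0 ?b1//.
  by move=> ->; rewrite addrK subrr.
rewrite -[LHS]/(em_mul K (al (v0 R), be (v0 R))) -[RHS]/(em_mul K (al (v1 R), be (v1 R))).
by rewrite a0 a1 b0 b1.
Qed.

Lemma classifying_map_exists (N : topologicalType) (nu : cohomology R N A 1) :
  (exists f : continuousType N K, pull f (em_class K) = nu) ->
  pull (classifying_map K nu) (em_class K) = nu.
Proof.
by move=> [f hf]; rewrite /classifying_map; case: xgetP => [g _ //|/(_ f)] /(_ hf).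
Qed.

Lemma classifying_mapP d (N : topologicalType) (hN : closed_manifold R d N)
    (nu : cohomology R N A 1) : pull (classifying_map K nu) (em_class K) = nu.
Proof.
apply: classifying_map_exists.
have hnu : sq_repr nu \in @cocycle R N A 1 by exact: sq_repr_in.
by have [f hf] := classifying_cochain K hN hnu; exists f; rewrite hf sq_reprK.
Qed.

(** The product map [g] has the required class, so a classifying map exists on [W * W'], and by
    [pull_em_inj] it may be replaced by [g] in the pairing. *)
Lemma integrand_product d d' (W W' : topologicalType)
    (hW : closed_manifold R d W) (hW' : closed_manifold R d' W') p q G
    (theta : cohomology R K G (p + q)) (c : homology R W p) (c' : homology R W' q)
    (nu : cohomology R W A 1) (nu' : cohomology R W' A 1) :
  pairing (pull (classifying_map K
      (pull (cts_fst W W') nu + pull (cts_snd W W') nu')) theta) (cross c c') =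
  pairing (pull (classifying_map K nu')
      (slant theta (push (classifying_map K nu) c))) c'.
Proof.
set n := pull _ nu + _; pose f := classifying_map K nu; pose f' := classifying_map K nu'.
pose g := cts_comp (em_mul K) (cts_prod f f').
have hg : pull g (em_class K) = n.
  rewrite pull_comp em_mul_class raddfD /= -!pull_comp.
  have -> : cts_comp (cts_fst K K) (cts_prod f f') = cts_comp f (cts_fst W W').
    exact: cts_eq.
  have -> : cts_comp (cts_snd K K) (cts_prod f f') = cts_comp f' (cts_snd W W').
    exact: cts_eq.
  by rewrite !pull_comp (classifying_mapP hW) (classifying_mapP hW').
have hn : pull (classifying_map K n) (em_class K) = n.
  by apply: classifying_map_exists; exists g.
rewrite (@pull_em_inj _ _ K _ _ g) ?hn ?hg// /g -pairing_slant_push.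
by rewrite [RHS]pairing_pull.
Qed.

End ProductClasses.

(** * Countability of degree one homology *)

Lemma basis_sequence X : @second_countable X ->
  exists b : nat -> set X, (forall i, open (b i)) /\
    forall x O, nbhs x O -> exists i, b i x /\ b i `<=` O.
Proof.
move=> [U /countable_injP[f finj] [Uo Ub]].
pose b i := xget set0 [set V | U V /\ f V = i].
have bE V : U V -> b (f V) = V.
  move=> UV; rewrite /b; case: xgetP => [V' _ [UV' fV]|/(_ V)[]//].
  by apply: finj; rewrite ?inE.
exists b; split=> [i|x O xO].
  by rewrite /b; case: xgetP => [V _ [/Uo]|_]; [|exact: open0].
by have [V [UV Vx] VO] := Ub x O xO; exists (f V); rewrite bE.
Qed.

Section PathCodes.
Variables (R : realType) (d : nat) (X : topologicalType).
Hypothesis hX : closed_manifold R d X.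

(** One simple open set is chosen between any two members of a countable basis, whenever there is
    one. *)
Lemma countable_simple_basis : exists B : nat * nat -> set X, forall x O, nbhs x O ->
  exists i, [/\ simple_open R (B i), B i x & B i `<=` O].
Proof.
have [b [bo bb]] := basis_sequence (manifold_second_countable hX).
pose good (i : nat * nat) V := [/\ simple_open R V, b i.1 `<=` V & V `<=` b i.2].
exists (fun i => xget set0 (good i)) => x O xO; have [j [jx jO]] := bb x O xO.
have [V [sV Vx Vj]] := simple_basis hX (open_nbhs_nbhs (conj (bo j) jx)).
have [i [ix iV]] := bb x V (open_nbhs_nbhs (conj (simple_openP sV) Vx)).
exists (i, j); case: xgetP => [B _ [sB iB Bj]|/(_ V)[]//].
by split=> //; [exact: iB|exact: subset_trans Bj jO].
Qed.

Variable B : nat * nat -> set X.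
Hypothesis hB : forall x O, nbhs x O ->
  exists i, [/\ simple_open R (B i), B i x & B i `<=` O].

Definition path_code : countType := (nat * (seq (nat * nat) * seq (nat * nat)))%type.

Definition node (s : singular R 1 X) (N k : nat) : X :=
  s (interval_point (k%:R / N.+1%:R)).

(* The path [s], cut into [c.1.+1] pieces, runs through the sets of [B] listed in
   the first sequence, and passes from each to the next one within the sets
   listed in the second one. *)
Definition coded (c : path_code) (s : singular R 1 X) : Prop :=
  let N := c.1 in let u := nth (0, 0)%N c.2.1 in let v := nth (0, 0)%N c.2.2 in
  (forall k, (k < N.+1)%N -> simple_open R (B (u k)) /\ inside (B (u k)) (subsegment s N k)) /\
  (forall k, (k < N)%N -> [/\ simple_open R (B (v k)), B (v k) (node s N k.+1),
     B (v k) `<=` B (u k) & B (v k) `<=` B (u k.+1)]).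

Lemma subsegment_start (s : singular R 1 X) N k : subsegment s N k (v0 R) = node s N k.
Proof. exact: segment_start. Qed.

Lemma subsegment_end (s : singular R 1 X) N k : subsegment s N k (v1 R) = node s N k.+1.
Proof. exact: segment_end. Qed.

Lemma coded_exists s : exists c, coded c s.
Proof.
have [i hi] := choice (fun x => hB (filterT : nbhs x setT)).
have nU x : nbhs x (B (i x)).
  by have [sB Bx _] := hi x; apply: open_nbhs_nbhs; split=> //; exact: (simple_openP sB).
have [N hN] := fine_subdivision s nU.
have [y hy] := choice hN.
pose u0 (k : nat) : nat * nat := if insub k is Some k' then i (y k') else (0, 0)%N.
have hu k : (k < N.+1)%N -> simple_open R (B (u0 k)) /\ inside (B (u0 k)) (subsegment s N k).
  move=> hk; rewrite /u0 (insubT (fun j => j < N.+1)%N hk) /=; have [sB _ _] := hi (y (Ordinal hk)); split=> //.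
have hv (k : nat) : exists v, (k < N)%N -> [/\ simple_open R (B v), B v (node s N k.+1),
     B v `<=` B (u0 k) & B v `<=` B (u0 k.+1)].
  have [kN|_] := boolP (k < N)%N; last by exists (0, 0)%N.
  have [s1 h1] := hu k (leqW kN); have [s2 h2] := hu k.+1 kN.
  have nO : nbhs (node s N k.+1) (B (u0 k) `&` B (u0 k.+1)).
    apply: open_nbhs_nbhs; split; first by apply: openI; [exact: (simple_openP s1)|exact: (simple_openP s2)].
    by split; [rewrite -subsegment_end; exact: h1|rewrite -subsegment_start; exact: h2].
  have [v [sv vx vO]] := hB nO; exists v => _; split=> // z /vO [].
  - by [].
  - by [].
have [v0' hv0] := choice hv.
exists (N, (mkseq u0 N.+1, mkseq v0' N)); split=> /= k kN.
  by rewrite nth_mkseq//; exact: hu.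
rewrite -[[seq u0 j | j <- iota 1 N]]/(behead (mkseq u0 N.+1)) nth_behead !nth_mkseq//.
  exact: hv0.
exact: leqW.
Qed.

(** [D k j] compares the two paths at node [j] in the potential of the set [k]. Consecutive
    potentials give the same comparison, since the two nodes are joined within the intermediate set;
    the sum telescopes to the common end points. *)
Lemma coded_eq c (s t : singular R 1 X) G (phi : cochain R X G 1) :
  phi \in @cocycle R X G 1 -> coded c s -> coded c t ->
  s (v0 R) = t (v0 R) -> s (v1 R) = t (v1 R) -> phi s = phi t.
Proof.
move=> hphi; case: c => N [us vs]; set u := nth (0, 0)%N us; set v := nth (0, 0)%N vs.
move=> [hs hvs] [ht hvt] e0 e1.
have potential i : exists psi : X -> G, simple_open R (B i) ->
    forall r : singular R 1 X, inside (B i) r -> phi r = psi (r (v1 R)) - psi (r (v0 R)).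
  have [/simple_potential/(_ _ _ hphi)[p hp]|nB] := pselect (simple_open R (B i)).
    by exists p.
  by exists (fun=> 0) => /nB.
have [psi hpsi] := choice potential.
pose D k j := psi (u k) (node s N j) - psi (u k) (node t N j).
have step k : (k < N)%N -> D k k.+1 = D k.+1 k.+1.
  move=> kN; have [sv vs1 vu vu'] := hvs k kN; have [_ vt1 _ _] := hvt k kN.
  have [r [rv r0 r1]] := simple_join sv vt1 vs1.
  have [su _] := hs k (leqW kN); have [su' _] := hs k.+1 kN.
  by rewrite /D -r0 -r1 -(hpsi _ su r) ?(hpsi _ su' r)// => w; [apply: vu'|apply: vu].
have tele m : (m <= N)%N -> \sum_(k < m.+1) (phi (subsegment s N k) - phi (subsegment t N k)) =
    D m m.+1 - D 0%N 0%N.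
  have piece k : (k < N.+1)%N ->
      phi (subsegment s N k) - phi (subsegment t N k) = D k k.+1 - D k k.
    move=> kN; have [su is1] := hs k kN; have [_ it1] := ht k kN.
    rewrite (hpsi _ su _ is1) (hpsi _ su _ it1) !subsegment_start !subsegment_end /D.
    by rewrite !opprB addrACA [in RHS]addrACA [- psi _ _ + _]addrC.
  elim: m => [|m IH] mN; first by rewrite big_ord1 piece.
  rewrite big_ord_recr /= IH 1?ltnW// piece// (step m mN).
  by rewrite addrC addrA subrK.
apply/eqP; rewrite -subr_eq0 (cocycle_subdivision s N hphi) (cocycle_subdivision t N hphi).
rewrite -sumrB tele// /D /node !divff ?pnatr_eq0// !mul0r !interval_point0 !interval_point1.
by rewrite e0 e1 !subrr.
Qed.

End PathCodes.

Section CountableHomology.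
Variables (R : realType) (d : nat) (X : topologicalType).
Hypothesis hX : closed_manifold R d X.
Hypothesis jX : joinable R X.

(** Closing all simplices up at a base point changes the value on a cycle by a coboundary, that is,
    not at all. What remains is a finite list of integers and loops, and the loops matter only
    through their codes. *)
Lemma homology_code : exists (T : countType) (code : homology R X 1 -> T),
  forall c c', code c = code c' ->
  forall G (a : cohomology R X G 1), pairing a c = pairing a c'.
Proof.
have [[x0 _]|nX] := pselect (exists x : X, True); last first.
  exists unit, (fun=> tt) => c c' _ G a.
  have h (c1 : homology R X 1) : pairing a c1 = 0.
    apply: cobounding_cycle; last exact: sq_repr_in.
    exact: cobounding_empty.
  by rewrite !h.
have [B hB] := countable_simple_basis hX.
have [gam hg] := choice (jX x0).
have [loop hloop] := choice (loop_through hg).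
have [pc hpc] := choice (coded_exists hB).
exists (seq (int * path_code)%type), (fun c => [seq (coeff s (sq_repr c), pc (loop s)) | s <- dom (sq_repr c)]) => c c' ecc' G a.
pose phi := sq_repr a.
have hphi : phi \in @cocycle R X G 1 by exact: sq_repr_in.
(* The function [F] depends on the cocycle, while the code does not; [coded_eq] makes it well
   defined. *)
have [F hF] : exists F : path_code -> G, forall s, phi (loop s) = F (pc (loop s)).
  exists (fun k => xget 0 [set y | exists s, pc (loop s) = k /\ phi (loop s) = y]) => s.
  case: xgetP => [y _ [t [et <-]]|/(_ (phi (loop s)))[]]; last by exists s.
  have [l0 l1 _] := hloop s; have [t0 t1 _] := hloop t.
  apply: (coded_eq hphi (hpc (loop s))); rewrite -?et ?l0 ?l1 ?t0 ?t1//.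
suff h (c1 : homology R X 1) : pairing a c1 =
    \sum_(p <- [seq (coeff s (sq_repr c1), pc (loop s)) | s <- dom (sq_repr c1)]) F p.2 *~ p.1.
  by rewrite !h ecc'.
rewrite big_map /=.
have hz : sq_repr c1 \in @Defs.cycle R X 1 by exact: sq_repr_in.
have hc : (fun s : singular R 1 X => phi (gam (s (v1 R))) - phi (gam (s (v0 R))))
    \in @cobounding R X G 1.
  by apply/cobounding1P; exists (fun x => phi (gam x)).
have e0 := cobounding_cycle hc hz.
rewrite /pairing -/phi -[LHS]subr0 -[X in _ - X]e0 -evaluateB.
apply: eq_bigr => s _; rewrite -hF; have [_ _ ->//] := hloop s.
rewrite -[(_ - _) s]/(phi s - (phi (gam (s (v1 R))) - phi (gam (s (v0 R))))).
by rewrite opprB addrA [phi s + _]addrC.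
Qed.

End CountableHomology.

(** * Haar measure of a product *)

Section OpenMeasurable.
Variable A : topologicalZmodType.

(** [A] carries a topology but no sigma-algebra, so measurability into it is tested on open sets. *)
Definition open_measurable_fun d (T : measurableType d) (h : T -> A) : Prop :=
  forall U, open U -> measurable (h @^-1` U).

Lemma open_measurable_cst d (T : measurableType d) (a : A) :
  open_measurable_fun (fun _ : T => a).
Proof.
move=> U _; have [Ua|nUa] := pselect (U a).
  by rewrite (_ : _ @^-1` U = setT); [exact: measurableT|apply/seteqP; split].
by rewrite (_ : _ @^-1` U = set0); [exact: measurable0|apply/seteqP; split].
Qed.

Lemma open_measurable_comp d d' (T : measurableType d) (T' : measurableType d')
  (h : T -> A) (g : T' -> T) :
  open_measurable_fun h -> measurable_fun setT g -> open_measurable_fun (h \o g).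
Proof. by move=> mh mg U oU; rewrite -[_ @^-1` _]setTI; exact: (mg measurableT _ (mh _ oU)). Qed.

Hypothesis sA : @second_countable A.

(** By second countability the preimage of an open set under addition is a countable union of
    boxes. *)
Lemma open_measurableD d (T : measurableType d) (h1 h2 : T -> A) :
  open_measurable_fun h1 -> open_measurable_fun h2 ->
  open_measurable_fun (fun t => h1 t + h2 t).
Proof.
move=> m1 m2 U oU; have [b [bo bb]] := basis_sequence sA.
pose F (ij : nat * nat) : set T :=
  if `[< forall x y, b ij.1 x -> b ij.2 y -> U (x + y) >]
  then h1 @^-1` b ij.1 `&` h2 @^-1` b ij.2 else set0.
suff -> : (fun t => h1 t + h2 t) @^-1` U = \bigcup_ij F ij.
  apply: countable_bigcupT_measurable => // ij; rewrite /F; case: ifP => _.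
    by apply: measurableI; [exact: m1|exact: m2].
  exact: measurable0.
apply/seteqP; split=> [t Ut|t [ij _]]; last first.
  by rewrite /F; case: asboolP => // h [b1 b2]; exact: h.
have [[P Q] /= [nP nQ] PQ] := @add_continuous A (h1 t, h2 t) U (open_nbhs_nbhs (conj oU Ut)).
have [i [bi iP]] := bb _ _ nP; have [j [bj jQ]] := bb _ _ nQ.
exists (i, j) => //; rewrite /F; case: asboolP => //; case=> x y bx b'y.
by apply: (PQ (x, y)); split; [exact: iP|exact: jQ].
Qed.

End OpenMeasurable.

(** * Borel sets of the space of fields *)

Section MeasurableFields.
Variables (R : realType) (A : topologicalZmodType) (N : topologicalType).

Lemma evaluation_continuous (c : homology R N 1) :
  continuous (fun nu : fields R A N => (pairing nu c : A)).
Proof.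
apply/continuousP => U oU.
exists ((fun f : {ptws homology R N 1 -> A} => f c) @^-1` U) => //.
suff hc : continuous (fun f : {ptws homology R N 1 -> A} => f c).
  by move/continuousP: hc; exact.
exact: (@proj_continuous _ (fun _ : homology R N 1 => A) c).
Qed.

Lemma evaluation_measurable (c : homology R N 1) :
  open_measurable_fun (fun nu : borel_fields R A N => (pairing (nu : fields R A N) c : A)).
Proof.
move=> U oU; apply: sub_sigma_algebra.
by have /continuousP := @evaluation_continuous c; exact.
Qed.

Hypothesis sA : @second_countable A.
Variables (I : countType) (D : I -> homology R N 1).
Hypothesis hD : forall c, exists k, forall nu : cohomology R N A 1,
  pairing nu c = pairing nu (D k).

(** Finite conditions on the classes [D k], with values in a countable basis of [A], form a
    countable basis of the topology of [fields], because every evaluation agrees with one at some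
    [D k]. *)
Lemma measurable_into_fields d (T : measurableType d) (h : T -> borel_fields R A N) :
  (forall c, open_measurable_fun (fun t => (pairing (h t : fields R A N) c : A))) ->
  measurable_fun setT h.
Proof.
move=> mh; have [b [bo bb]] := basis_sequence sA.
pose cyl (s : seq (I * nat)) : set (fields R A N) :=
  [set nu | forall p, p \in s -> b p.2 (pairing nu (D p.1))].
apply: (@measurability _ _ T (borel_fields R A N) setT h (@open (fields R A N))) => // _ [U oU <-].
pose F s : set T := if `[< cyl s `<=` U >] then h @^-1` cyl s else set0.
suff -> : setT `&` h @^-1` U = \bigcup_s F s.
  apply: countable_bigcupT_measurable => // s; rewrite /F; case: ifP => _; last exact: measurable0.
  rewrite (_ : h @^-1` cyl s = \big[setI/setT]_(p <- s)
      [set t | b p.2 (pairing (h t : fields R A N) (D p.1))]).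
    by apply: big_rec => [|p B _ mB]; [exact: measurableT|apply: measurableI => //; exact: mh].
  by rewrite -bigcap_seq; apply/seteqP; split=> t ht p; exact: ht.
rewrite setTI; apply/seteqP; split=> [t Ut|t [s _]]; last first.
  by rewrite /F; case: asboolP => // h1; exact: h1.
suff [s hs sU] : exists2 s, cyl s (h t) & cyl s `<=` U.
  by exists s => //; rewrite /F; case: asboolP.
case: oU Ut => V oV <- /= Vt.
(* That [U] contains one of these cylinders around [h t] is expressed as convergence of the filter
   they generate, which can be checked one evaluation at a time. *)
pose FF : set_system {ptws homology R N 1 -> A} :=
  [set P | exists2 s, cyl s (h t) & cyl s `<=` (@period R A N) @^-1` P].
have fF : Filter FF.
  split.
  - by exists [::] => // nu _.
  - move=> P Q [s hs sP] [s' hs' sQ]; exists (s ++ s').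
      by move=> p; rewrite mem_cat => /orP[]; [exact: hs|exact: hs'].
    by move=> nu hnu; split; [apply: sP => p ps|apply: sQ => p ps]; apply: hnu; rewrite mem_cat ps ?orbT.
  - by move=> P Q PQ [s hs sP]; exists s => // nu /sP; exact: PQ.
suff /(_ V) : FF --> (@period R A N (h t) : {ptws homology R N 1 -> A}).
  by apply; exact: open_nbhs_nbhs.
apply/cvg_sup => c P [Q [[B oB <-] Bt] BP].
have [k hk] := hD c; have [j [bj jB]] := bb _ _ (open_nbhs_nbhs (conj oB Bt)).
exists [:: (k, j)] => [p|nu hnu].
  by rewrite inE => /eqP -> /=; rewrite -hk.
apply: BP; apply: jB; rewrite /period hk.
by apply: (hnu (k, j)); rewrite inE.
Qed.

End MeasurableFields.

Section HaarMeasure.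
Variables (R : realType) (A : topologicalZmodType).

Local Notation F N := (fields R A N).
Local Notation BF N := (borel_fields R A N).

Definition determined (N : topologicalType) : Prop :=
  exists (I : countType) (D : I -> homology R N 1),
    forall c, exists k, forall nu : cohomology R N A 1, pairing nu c = pairing nu (D k).

Hypothesis sA : @second_countable A.

Section Invariance.
Variable N : topologicalType.
Hypothesis dN : determined N.

Lemma measurable_translation (nu : F N) :
  measurable_fun setT (fun x : BF N => (nu + (x : F N) : BF N)).
Proof.
have [I [D hD]] := dN; apply: (measurable_into_fields sA hD) => c.
rewrite (_ : (fun t => _) = fun t : BF N =>
  (pairing (nu : cohomology R N A 1) c : A) + pairing (t : F N) c).
  by apply: open_measurableD => //; [exact: open_measurable_cst|exact: evaluation_measurable].
by apply/funext => t; rewrite pairingDl.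
Qed.

Lemma haar_preimage (mu : haar_measure R A N) (nu : F N)
    (B : set (BF N)) : measurable B ->
  mu [set x | B (nu + (x : F N))] = mu B.
Proof.
move=> mB; rewrite -[RHS](haar_invariant mu (- nu) mB); congr (haar mu _).
apply/seteqP; split=> x /=; first by move=> Bx; exists (nu + x) => //; rewrite addKr.
by move=> [y By <-]; rewrite addNKr.
Qed.

Lemma haar_integral_translate (mu : haar_measure R A N) (nu : F N)
    (f : BF N -> \bar R) :
  measurable_fun setT f -> (forall x, (0 <= f x)%E) ->
  (\int[mu]_x f (nu + (x : F N))%R = \int[mu]_x f x)%E.
Proof.
move=> mf f0; rewrite -[LHS](ge0_integral_pushforward (measurable_translation nu) mu measurableT mf)//.
apply: eq_measure_integral => [|mt B mB _]; first exact: measurable_translation.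
by rewrite -[RHS](haar_preimage mu nu mB).
Qed.

End Invariance.

Section Product.
Variables N1 N2 N : topologicalType.
Hypotheses (d1 : determined N1) (dN : determined N).
Variables (mu1 : haar_measure R A N1) (mu2 : haar_measure R A N2) (mu : haar_measure R A N).

Lemma product_haar_translate (x0 : F N1) (y0 : F N2)
    (C : set (BF N1 * BF N2)) : measurable C ->
  (mu1 \x mu2)%E [set p | C (x0 + (p.1 : F N1), y0 + (p.2 : F N2))] =
  (mu1 \x mu2)%E C.
Proof.
move=> mC; rewrite /product_measure1.
rewrite -[RHS](haar_integral_translate d1 mu1 x0) => [|//|//]; last first.
  exact: measurable_fun_xsection.
apply: eq_integral => x _ /=; rewrite -[RHS](haar_preimage mu2 y0) => [|//]; last first.
  exact: measurable_xsection.
by congr (haar mu2 _); apply/seteqP; split=> y; rewrite /= /xsection /= !inE.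
Qed.

Variable phi : BF N1 * BF N2 -> F N.
Hypothesis phiD : forall (x x' : F N1) (y y' : F N2),
  phi (x + x', y + y') = phi (x, y) + phi (x', y').
Hypothesis phi_surj : forall z, exists p, phi p = z.
Hypothesis phi_evaluation : forall c, exists c1 c2, forall p,
  pairing (phi p) c = pairing (p.1 : F N1) c1 + pairing (p.2 : F N2) c2.

Lemma measurable_phi : measurable_fun setT (phi : _ -> BF N).
Proof.
have [I [D hD]] := dN; apply: (measurable_into_fields sA hD) => c.
have [c1 [c2 hc]] := phi_evaluation c.
rewrite (_ : (fun t => _) = fun t : BF N1 * BF N2 =>
  (pairing (t.1 : F N1) c1 : A) + pairing (t.2 : F N2) c2).
  apply: open_measurableD => //.
    exact: (open_measurable_comp (@evaluation_measurable _ _ _ c1) measurable_fst).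
  exact: (open_measurable_comp (@evaluation_measurable _ _ _ c2) measurable_snd).
by apply/funext => t.
Qed.

Lemma measurable_phiD : measurable_fun setT
  (fun q : BF N * (BF N1 * BF N2) =>
     ((q.1 : F N) + phi q.2 : BF N)).
Proof.
have [I [D hD]] := dN; apply: (measurable_into_fields sA hD) => c.
rewrite (_ : (fun t => _) = fun q : BF N * (BF N1 * BF N2) =>
  (pairing (q.1 : F N) c : A) + pairing (phi q.2) c).
  apply: open_measurableD => //.
    exact: (open_measurable_comp (@evaluation_measurable _ _ _ c) measurable_fst).
  apply: (open_measurable_comp (@evaluation_measurable _ _ _ c)).
  exact: (measurableT_comp measurable_phi measurable_snd).
by apply/funext => t; rewrite pairingDl.
Qed.

(* Integrate the indicator of [z + phi p \in B] in both orders: invariance of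
   [mu] gives the right-hand side, invariance of [mu1 \x mu2] and surjectivity of
   [phi] give the left-hand side. *)
Lemma haar_product (B : set (BF N)) : measurable B ->
  (mu1 \x mu2)%E (phi @^-1` B) = mu B.
Proof.
move=> mB; pose S := [set q : BF N * (BF N1 * BF N2) |
  B ((q.1 : F N) + phi q.2)].
have mS : measurable S by rewrite -[S]setTI; exact: measurable_phiD.
have mC : measurable (phi @^-1` B) by rewrite -[_ @^-1` _]setTI; exact: measurable_phi.
pose mu12 : probability (BF N1 * BF N2)%type R := (mu1 \x mu2)%E.
have hx z : (mu12 \o xsection S) z = mu12 (phi @^-1` B).
  have [[x0 y0] <-] := phi_surj z.
  rewrite -[RHS](product_haar_translate x0 y0 mC) /=; congr product_measure1.
  by apply/seteqP; split=> -[x y]; rewrite /xsection /S /= inE phiD.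
have hy p : (mu \o ysection S) p = mu B.
  rewrite /= -(haar_preimage mu (phi p) mB); congr (haar mu _).
  by apply/seteqP; split=> z; rewrite /ysection /S /= inE addrC.
have := indic_fubini_tonelli mu mu12 mS.
rewrite indic_fubini_tonelli_FE// indic_fubini_tonelli_GE//.
rewrite (eq_integral _ _ (fun z _ => hx z)) (eq_integral _ _ (fun p _ => hy p)).
have cstE d (T : measurableType d) (P : probability T R) (c : \bar R) : (\int[P]_x c = c)%E.
  by rewrite integral_cst// -[RHS]mule1; congr (_ * _)%E; exact: probability_setT.
by move=> e; apply: etrans (cstE _ _ mu12 (mu B)); rewrite -e; exact/esym/(cstE _ _ mu).
Qed.

Lemma haar_product_integral (f : BF N -> \bar R) :
  mu.-integrable setT f ->
  (\int[mu]_z f z = \int[mu1]_x \int[mu2]_y f (phi (x, y)))%E.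
Proof.
move=> intf; have mf := measurable_int _ intf.
pose psi : _ -> BF N := phi.
pose mu12 : probability (BF N1 * BF N2)%type R := (mu1 \x mu2)%E.
have pushE (g : BF N -> \bar R) :
    (\int[mu]_z g z = \int[pushforward mu12 psi]_z g z)%E.
  apply: eq_measure_integral => [|mp B mB _]; first exact: measurable_phi.
  exact/esym/haar_product.
have intp : mu12.-integrable setT (f \o psi).
  apply/integrableP; split; first exact: (measurableT_comp mf measurable_phi).
  have /integrableP[_] := intf; rewrite pushE.
  by rewrite (ge0_integral_pushforward measurable_phi)//; exact: measurableT_comp.
rewrite pushE (integral_pushforward measurable_phi mf intp)//.
by rewrite -(integral12_prod_meas1 intp).
Qed.

End Product.
End HaarMeasure.

Section Determined.
Variables (R : realType) (A : topologicalZmodType).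

Lemma determined_manifold d X :
  closed_manifold R d X -> joinable R X -> determined R A X.
Proof.
move=> hX jX; have [T [code hcode]] := homology_code hX jX.
exists T, (fun k => xget 0 [set c | code c = k]) => c; exists (code c) => nu.
by apply: hcode; case: xgetP => [c' _ ->//|/(_ c)[]].
Qed.

Lemma determined_prod X Y : joinable R X -> joinable R Y ->
  determined R A X -> determined R A Y -> determined R A (X * Y)%type.
Proof.
move=> jX jY [I [D hD]] [J [E hE]].
pose same (k : I * J) (c : homology R (X * Y)%type 1) :=
  (forall nu : cohomology R X A 1, pairing nu (push (cts_fst X Y) c) = pairing nu (D k.1)) /\
  (forall nu : cohomology R Y A 1, pairing nu (push (cts_snd X Y) c) = pairing nu (E k.2)).
exists (I * J)%type, (fun k => xget 0 [set c | same k c]) => c.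
have [i hi] := hD (push (cts_fst X Y) c); have [j hj] := hE (push (cts_snd X Y) c).
exists (i, j) => nu; have [b [b' ->]] := kunneth1 nu jX jY.
case: xgetP => [c' _ [hi' hj']|/(_ c)[]//].
by rewrite !pairingDl !pairing_pull hi hi' hj hj'.
Qed.

End Determined.

Section ProductFields.
Variables (R : realType) (A : topologicalZmodType) (m n : nat) (W W' : topologicalType).
Hypothesis sA : @second_countable A.
Hypotheses (hW : closed_manifold R m W) (hW' : closed_manifold R n W').
Hypotheses (jW : joinable R W) (jW' : joinable R W').

Definition product_field (p : borel_fields R A W * borel_fields R A W') :
    fields R A (W * W')%type :=
  pull (cts_fst W W') (p.1 : cohomology R W A 1) + pull (cts_snd W W') (p.2 : cohomology R W' A 1).

Lemma haar_product_Rintegral (mu1 : haar_measure R A W) (mu2 : haar_measure R A W')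
    (mu : haar_measure R A (W * W')%type) (f : fields R A (W * W')%type -> R)
    (g : fields R A W -> fields R A W' -> R) :
  (forall x y, f (product_field (x, y)) = g x y) ->
  mu.-integrable setT (EFin \o f) ->
  (forall x, mu2.-integrable setT (EFin \o g x)) ->
  \int[mu]_z f z = \int[mu1]_x \int[mu2]_y g x y.
Proof.
move=> fg intf intg; have d1 := determined_manifold A hW jW; have d2 := determined_manifold A hW' jW'.
have phiD (x x' : fields R A W) (y y' : fields R A W') :
    product_field (x + x', y + y') = product_field (x, y) + product_field (x', y').
  by rewrite /product_field /= !raddfD /= addrACA.
have phi_surj z : exists p, product_field p = z.
  by have [b [b' ->]] := kunneth1 (z : cohomology R _ A 1) jW jW'; exists (b, b').
have phi_ev c : exists c1 c2, forall p, pairing (product_field p) c =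
    pairing (p.1 : fields R A W) c1 + pairing (p.2 : fields R A W') c2.
  exists (push (cts_fst W W') c), (push (cts_snd W W') c) => p.
  by rewrite pairingDl !pairing_pull.
rewrite /Rintegral (haar_product_integral sA d1 (determined_prod jW jW' d1 d2) mu1 mu2
  phiD phi_surj phi_ev intf).
congr fine; apply: eq_integral => x _.
(* The inner integral is finite at every [x], so the real-valued integral agrees with the extended
   one. *)
rewrite fineK; last exact: (integrable_fin_num measurableT (intg x)).
by apply: eq_integral => y _; rewrite /= fg.
Qed.

End ProductFields.

Theorem theorem4p7 (R : realType) (A : topologicalZmodType)
  (hA : compact_abelian_lie_group R A) (K : EM_space R A) (m n : nat)
  (W W' : topologicalType)
  (hW : closed_manifold R m.+1 W) (hW' : closed_manifold R n.+1 W')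
  (cW : connected [set: W]%classic) (cW' : connected [set: W']%classic)
  (oW : orientation R W m.+1) (oW' : orientation R W' n.+1)
  (fW : homology R W m.+1) (fW' : homology R W' n.+1)
  (hfW : fundamental_class oW fW) (hfW' : fundamental_class oW' fW')
  (muW : haar_measure R A W) (muW' : haar_measure R A W')
  (muWW' : haar_measure R A (W * W')%type)
  (theta : cohomology R K (circle R) (m.+1 + n.+1))
  (int_WW' : Cintegrable muWW' (dw_integrand theta (cross fW fW')))
  (int_W' : forall nu : fields R A W,
    Cintegrable muW'
      (dw_integrand (slant theta (push (classifying_map K nu) fW)) fW'))
  (int_W : Cintegrable muW (fun nu : fields R A W =>
    dw_invariant (slant theta (push (classifying_map K nu) fW)) fW' muW')) :
  dw_invariant theta (cross fW fW') muWW' =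
  Cintegral muW (fun nu : fields R A W =>
    dw_invariant (slant theta (push (classifying_map K nu) fW)) fW' muW').
Proof.
have sA := lie_group_second_countable hA.
have jW := manifold_joinable hW cW; have jW' := manifold_joinable hW' cW'.
have integrandE x y : dw_integrand theta (cross fW fW') (product_field (x, y)) =
    dw_integrand (slant theta (push (classifying_map K x) fW)) fW' y.
  by rewrite /dw_integrand (integrand_product hW hW').
have [intRe intIm] := int_WW'.
congr Complex; apply: (haar_product_Rintegral sA hW hW' jW jW') => //.
- by move=> x y; rewrite integrandE.
- by move=> x; have [] := int_W' x.
- by move=> x y; rewrite integrandE.
- by move=> x; have [] := int_W' x.
Qed.
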